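(* Let $\tau$ and $\sigma$ be independent (non-delayed) renewal processes such that, for some real $\alpha,\tilde\alpha\ge 0$ and some slowly varying functions $\varphi,\tilde\varphi$, $$\mathbf P(\tau_1=n)=\varphi(n)\,n^{-(1+\alpha)},\qquad \mathbf P(\sigma_1=n)=\tilde\varphi(n)\,n^{-(1+\tilde\alpha)}\qquad\text{for all integers } n\ge 1 .$$ Let $\rho=\tau\cap\sigma$, and suppose that $\rho$ is transient. Then $$\mathbf P(\rho_1=n)\ \sim\ \frac{1}{\mathbf E(|\rho|)^2}\,\mathbf P(n\in\tau)\,\mathbf P(n\in\sigma)\qquad\text{as } n\to\infty .$$
   Context: A (non-delayed) renewal process $\tau=\{\tau_0,\tau_1,\tau_2,\dots\}$ has $\tau_0=0$ and i.i.d. inter-arrival times $\tau_i-\tau_{i-1}$ with values in $\{1,2,3,\dots\}\cup\{\infty\}$; it is identified with the random set of its finite values, so $n\in\tau$ means $\tau_i=n$ for some $i\ge0$. It is recurrent if $\mathbf P(\tau_1<\infty)=1$ and transient otherwise. For independent renewal processes $\tau,\sigma$, $\rho=\tau\cap\sigma$ is again a renewal process with $\rho_0=0$ and $\rho_1=\inf\{n\ge1:\ n\in\tau\cap\sigma\}$ ($\inf\emptyset=\infty$); $|\rho|$ denotes the cardinality of $\rho$ (counting the point $0$). A function $\varphi:\{1,2,\dots\}\to[0,\infty)$ is slowly varying if it is eventually positive and $\varphi(\lfloor\lambda n\rfloor)/\varphi(n)\to1$ as $n\to\infty$ for every $\lambda>0$. $a_n\sim b_n$ means $a_n/b_n\to1$.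 *)

(* Defs.v *)
From HB Require Import structures.
From mathcomp Require Import all_boot all_order all_algebra finmap.
From mathcomp Require Import all_classical all_reals all_analysis.
From mathcomp Require Import measurable_realfun.

Set Implicit Arguments.
Unset Strict Implicit.
Unset Printing Implicit Defensive.

Import Order.TTheory GRing.Theory Num.Theory.
Import numFieldNormedType.Exports.

Local Open Scope classical_set_scope.
Local Open Scope ring_scope.

(* [phi 0] is irrelevant: sequences are indexed by the integers [n >= 1], and
   for fixed [lambda > 0] the index [truncn (lambda * n)] is eventually
   positive. *)
Definition slowly_varying (R : realType) (phi : nat -> R) : Prop :=
  [/\ forall n, (1 <= n)%N -> 0 <= phi n,
      \forall n \near \oo, 0 < phi n
    & forall lambda : R, 0 < lambda ->
        phi (Num.truncn (lambda * n%:R)) / phi n @[n --> \oo] --> (1 : R)].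

Definition asymp_equiv (R : realType) (a b : nat -> R) : Prop :=
  a n / b n @[n --> \oo] --> (1 : R).

Definition mutually_independent d (T : measurableType d) (R : realType)
    (P : probability T R) (X : nat -> {RV P >-> \bar R}) : Prop :=
  forall (J : {fset nat}) (A : nat -> set (\bar R)),
    (forall i, measurable (A i)) ->
    P (\bigcap_(i in [set` J]) (X i @^-1` A i)) =
    (\prod_(i <- J) P (X i @^-1` A i))%E.

Definition identically_distributed d (T : measurableType d) (R : realType)
    (P : probability T R) (X : nat -> {RV P >-> \bar R}) : Prop :=
  forall i (A : set (\bar R)), measurable A ->
    distribution P (X i) A = distribution P (X 0%N) A.

Definition sigma_of d (T : measurableType d) (R : realType)
    (P : probability T R) (X : nat -> {RV P >-> \bar R}) : set (set T) :=
  <<s \bigcup_k preimage_set_system setT (X k) measurable >>.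

Definition independent_processes d (T : measurableType d) (R : realType)
    (P : probability T R) (X Y : nat -> {RV P >-> \bar R}) : Prop :=
  forall A B, sigma_of X A -> sigma_of Y B -> P (A `&` B) = (P A * P B)%E.

(* The inter-arrival times [xi i] (= tau_(i+1) - tau_i) are data rather than
   differences of the [tau k], since +oo - +oo is meaningless once the process
   has terminated. *)
Definition renewal_process d (T : measurableType d) (R : realType)
    (P : probability T R) (tau : nat -> {RV P >-> \bar R}) : Prop :=
  exists xi : nat -> {RV P >-> \bar R},
    [/\ forall i w,
          xi i w = +oo%E \/ exists2 n, (1 <= n)%N & xi i w = (n%:R)%:E,
        mutually_independent xi,
        identically_distributed xi
      & forall k w, tau k w = (\sum_(i < k) xi i w)%E].

Definition renewal_set d (T : measurableType d) (R : realType)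
    (P : probability T R) (tau : nat -> {RV P >-> \bar R}) (w : T) : set nat :=
  [set n | exists k, tau k w = (n%:R)%:E].

Definition renewal_cap d (T : measurableType d) (R : realType)
    (P : probability T R) (tau sigma : nat -> {RV P >-> \bar R}) (w : T) :
    set nat :=
  renewal_set tau w `&` renewal_set sigma w.

(* [ereal_inf set0 = +oo]. *)
Definition first_point (R : realType) (S : set nat) : \bar R :=
  ereal_inf [set (n%:R)%:E | n in [set n | (1 <= n)%N /\ S n]].

Definition recurrent d (T : measurableType d) (R : realType)
    (P : probability T R) (rho : T -> set nat) : Prop :=
  P [set w | (first_point R (rho w) < +oo)%E] = 1%E.

Definition transient d (T : measurableType d) (R : realType)
    (P : probability T R) (rho : T -> set nat) : Prop :=
  ~ recurrent P rho.

(* 'E_P is only available for real-valued variables, and |rho| may be +oo. *)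
Definition expected_card d (T : measurableType d) (R : realType)
    (P : probability T R) (rho : T -> set nat) : \bar R :=
  (\int[P]_w counting (rho w))%E.

(* Main.v *)
Require Import Defs.
From HB Require Import structures.
From mathcomp Require Import all_boot all_order all_algebra finmap.
From mathcomp Require Import all_classical all_reals all_analysis.
From mathcomp Require Import measurable_realfun.
From mathcomp Require Import zify ring lra.

Set Implicit Arguments.
Unset Strict Implicit.
Unset Printing Implicit Defensive.

Import Order.TTheory GRing.Theory Num.Theory.
Import numFieldNormedType.Exports.

Local Open Scope classical_set_scope.
Local Open Scope ring_scope.

(** Let [a] and [b] be the renewal sequences of tau and sigma: [a n] is the
    probability that [n] is a point of tau, and similarly for [b].  By
    independence the renewal sequence of rho is [u n = a n * b n].  Let [g] be
    the law of the first point of rho.  Regeneration gives [u = delta0 + g * u],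
    with [*] the convolution; summing over [n], the total masses [U] of [u] and
    [G] of [g] satisfy [U (1 - G) = 1].  Transience means [G < 1], so [U] is
    finite, and [U] is the expected number of points of rho.

    The limit of [y = g / u] follows from two qualitative properties of [u],
    collected in [regular_decay]: [u (n + 1) / u n] tends to 1, and
    [u k <= C * u n] whenever [k <= n <= 2 k].  Consider
    [u n = sum_k g k * u (n - k)].  The terms with both [k] and [n - k] large
    are negligible before [u n]: [g <= u], one of the two indices is at least
    [n / 2], where [u] is at most [C * u n], and [u] is summable.  The terms
    with [k] small add up to about [G * u n], and those with [n - k] small to
    about [(u * y) n * u n].  Hence [u * y] tends to [1 - G]
    ([conv_ratio_cvg]).  Finally [delta0 - g] is summable and inverse to [u] for
    the convolution, so that [y = (delta0 - g) * (u * y)] tends to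
    [(1 - G)^2 = 1 / U^2] ([first_renewal_ratio]).

    The two properties pass to products ([regular_decayM]), so it remains to
    establish them for one renewal sequence [a] whose inter-arrival law [f]
    varies regularly with exponent [s = 1 + alpha]
    ([renewal_regular_decay]).  They only involve orders of magnitude and
    consecutive ratios, which are within reach without the exact asymptotics
    of [a].  With [A n] the sum of [a] up to [n] and [m n] the truncated mean of
    the inter-arrival time, there are three regimes.
    - Transient, or [s < 2].  Differentiating [1 / (1 - F(z))] gives
      [n * a n = sum_k (k * f k) * (a * a) (n - k)], where the indices [k] of
      order [n] dominate; [a n] is of the order of [f n * A n ^ 2], and inherits
      its regularity from [f].
    - Recurrent with infinite mean and [s = 2].  The same identity for the
      differences of [a] has a small kernel, and a bootstrap shows that these
      differences are small compared with [1 / (n * m n)], while [a n] is of the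
      order of [1 / m n].
    - Recurrent with finite mean.  The renewal theorem of Erdos, Feller and
      Pollard gives a positive limit for [a].

    On the probabilistic side everything is read off from one formula: the
    probability that a renewal process passes through all sites of an
    increasing list is the product of [a] over the gaps
    ([probability_visits]).  Its form is stable under intersection of
    independent processes, and it implies the renewal equation of rho
    ([first_law_renewal_pair]). *)

(** * Convolution and renewal sequences *)

Section Convolution.
Variable R : realType.
Implicit Types x y z : nat -> R.

Definition conv x y : nat -> R := fun n => \sum_(i < n.+1) x i * y (n - i)%N.
Definition ones : nat -> R := fun=> 1.
Definition delta0 : nat -> R := fun n => (n == 0%N)%:R.
Definition psum x : nat -> R := fun n => \sum_(i < n.+1) x i.
(** The Euler operator [z d/dz] on generating series: a derivation for [conv]. *)
Definition euler x : nat -> R := fun n => n%:R * x n.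

(** Up to any given index, convolution is multiplication of truncating
    polynomials; the ring laws of convolution come from those of polynomials. *)
Lemma conv_coef x y N n : (n < N)%N ->
  conv x y n = (\poly_(i < N) x i * \poly_(i < N) y i)`_n.
Proof.
move=> nN; rewrite coefM; apply: eq_bigr => i _; rewrite !coef_poly.
by rewrite (leq_ltn_trans (leq_subr _ _) nN) (leq_ltn_trans _ nN)// -ltnS.
Qed.

Lemma convC x y : conv x y = conv y x.
Proof.
by apply/funext => n; rewrite !(conv_coef _ _ (ltnSn n)) mulrC.
Qed.

Lemma convA x y z : conv x (conv y z) = conv (conv x y) z.
Proof.
apply/funext => n.
set p := \poly_(i < n.+1) x i; set q := \poly_(i < n.+1) y i.
set r := \poly_(i < n.+1) z i.
transitivity ((p * (q * r))`_n).
  rewrite coefM; apply: eq_bigr => i _; rewrite coef_poly ltn_ord.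
  by rewrite (@conv_coef _ _ n.+1)// ltnS leq_subr.
rewrite mulrA coefM; apply: eq_bigr => i _; rewrite coef_poly ltnS leq_subr.
by rewrite (@conv_coef _ _ n.+1).
Qed.

Lemma convDr x y z : conv x (y \+ z) = conv x y \+ conv x z.
Proof.
apply/funext => n; rewrite /conv /= -big_split.
by apply: eq_bigr => i _; rewrite mulrDr.
Qed.

Lemma convDl x y z : conv (x \+ y) z = conv x z \+ conv y z.
Proof. by rewrite convC convDr convC [conv z y]convC. Qed.

Lemma convNr x y : conv x (\- y) = \- conv x y.
Proof.
apply/funext => n; rewrite /conv /= -sumrN.
by apply: eq_bigr => i _; rewrite mulrN.
Qed.

Lemma conv_delta0 x : conv delta0 x = x.
Proof.
apply/funext => n; rewrite /conv big_ord_recl subn0 mul1r big1 ?addr0// => i _.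
by rewrite mul0r.
Qed.

Lemma conv_ones x : conv x ones = psum x.
Proof. by apply/funext => n; apply: eq_bigr => i _; rewrite mulr1. Qed.

Lemma euler_conv x y : euler (conv x y) = conv (euler x) y \+ conv x (euler y).
Proof.
apply/funext => n; rewrite /euler /conv /= mulr_sumr -big_split.
apply: eq_bigr => i _ /=.
have -> : n%:R = i%:R + (n - i)%N%:R :> R by rewrite -natrD subnKC// -ltnS.
by ring.
Qed.

Lemma conv_ge0 x y : (forall n, 0 <= x n) -> (forall n, 0 <= y n) ->
  forall n, 0 <= conv x y n.
Proof. by move=> x0 y0 n; apply: sumr_ge0 => i _; rewrite mulr_ge0. Qed.

Lemma convE x y n : conv x y n = \sum_(0 <= i < n.+1) x i * y (n - i)%N.
Proof. by rewrite big_mkord. Qed.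

Lemma psumE x n : psum x n = \sum_(0 <= i < n.+1) x i.
Proof. by rewrite big_mkord. Qed.

Lemma psumS x n : psum x n.+1 = psum x n + x n.+1.
Proof. by rewrite /psum big_ord_recr. Qed.

Lemma psum0 x : psum x 0%N = x 0%N.
Proof. by rewrite /psum big_ord1. Qed.

Lemma psum_ge0 x : (forall n, 0 <= x n) -> forall n, 0 <= psum x n.
Proof. by move=> x0 n; apply: sumr_ge0. Qed.

Lemma psum_le x : (forall n, 0 <= x n) ->
  forall m n, (m <= n)%N -> psum x m <= psum x n.
Proof.
move=> x0 m n /subnKC <-; elim: (n - m)%N => [|k IH]; first by rewrite addn0.
by rewrite addnS psumS (le_trans IH)// lerDl.
Qed.

Lemma sum_nat_psum x m n : (m <= n)%N ->
  \sum_(m.+1 <= i < n.+1) x i = psum x n - psum x m.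
Proof.
by move=> mn; rewrite !psumE (@big_cat_nat _ _ _ m.+1 0 n.+1)//= addrAC subrr add0r.
Qed.

End Convolution.

(** [f] is the, possibly defective, law of the inter-arrival time and [a] its
    renewal sequence. *)
Record renewal_pair (R : realType) (f a : nat -> R) : Prop := RenewalPair {
  rp_ge0 : forall n, 0 <= f n;
  rp_f0 : f 0%N = 0;
  rp_le1 : forall n, psum f n <= 1;
  rp_eq : a = delta0 R \+ conv f a }.

Definition tail (R : realType) (f : nat -> R) : nat -> R :=
  fun n => 1 - psum f n.

(** The mean of the inter-arrival time truncated at [n.+1]. *)
Definition tmean (R : realType) (f : nat -> R) : nat -> R := psum (tail f).

Section RenewalPair.
Variables (R : realType) (f a : nat -> R).
Hypothesis fa : renewal_pair f a.
Let f_ge0 := rp_ge0 fa.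

Lemma ren0 : a 0%N = 1.
Proof.
rewrite (rp_eq fa) /= /conv big_ord1 (rp_f0 fa) mul0r addr0.
by rewrite /delta0 eqxx.
Qed.

Lemma renS n : a n.+1 = \sum_(i < n.+1) f i.+1 * a (n - i)%N.
Proof.
rewrite [in LHS](rp_eq fa) /= /delta0 /= add0r /conv big_ord_recl (rp_f0 fa).
by rewrite mul0r add0r; apply: eq_bigr => i _; rewrite subSS.
Qed.

Lemma ren_ge0 n : 0 <= a n.
Proof.
elim/ltn_ind: n => -[_|n IH]; first by rewrite ren0.
rewrite renS; apply: sumr_ge0 => i _; rewrite mulr_ge0 ?IH//.
by rewrite ltnS leq_subr.
Qed.

Lemma ren_le1 n : a n <= 1.
Proof.
elim/ltn_ind: n => -[_|n IH]; first by rewrite ren0.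
rewrite renS (le_trans _ (rp_le1 fa n.+1))// /psum [leRHS]big_ord_recl (rp_f0 fa) add0r.
apply: ler_sum => i _; rewrite ler_piMr ?IH//.
by rewrite ltnS leq_subr.
Qed.

Lemma ren_psum_ge1 n : 1 <= psum a n.
Proof.
by rewrite -ren0 -psum0; apply: psum_le => //; exact: ren_ge0.
Qed.

Lemma tail_ge0 n : 0 <= tail f n.
Proof. by rewrite subr_ge0 (rp_le1 fa). Qed.

Lemma tail_le m n : (m <= n)%N -> tail f n <= tail f m.
Proof. by move=> mn; rewrite lerD2l lerN2 psum_le. Qed.

Lemma tail0 : tail f 0 = 1.
Proof. by rewrite /tail psum0 (rp_f0 fa) subr0. Qed.

Lemma tmean_ge1 n : 1 <= tmean f n.
Proof. by rewrite -tail0 -psum0; apply: psum_le => //; exact: tail_ge0. Qed.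

Lemma tmean_gt0 n : 0 < tmean f n.
Proof. by rewrite (lt_le_trans _ (tmean_ge1 n)). Qed.

Lemma tmean_le m n : (m <= n)%N -> tmean f m <= tmean f n.
Proof. by apply: psum_le; exact: tail_ge0. Qed.

(** In generating series, [1 / (1 - F(z))] times [(1 - F(z)) / (1 - z)]. *)
Lemma conv_ren_tail : conv a (tail f) = ones R.
Proof.
have -> : tail f = conv (delta0 R \+ \- f) (ones R).
  by rewrite convDl conv_delta0 [conv (\- f) _]convC convNr convC conv_ones.
rewrite convA convDr convNr [conv a (delta0 R)]convC conv_delta0.
have -> : a \+ \- conv a f = delta0 R.
  by apply/funext => n /=; rewrite [in LHS](rp_eq fa) /= -(rp_eq fa) convC addrK.
by rewrite conv_delta0.
Qed.

Lemma conv_ren_tmean n : conv a (tmean f) n = n.+1%:R.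
Proof.
rewrite /tmean -conv_ones convA conv_ren_tail /conv.
by rewrite (eq_bigr (fun=> 1)) ?sumr_const ?card_ord// => i _; rewrite mulr1.
Qed.

(** Monotonicity of [tail f] and [tmean f] turns the exact convolution
    identities into bounds on products: [psum a n] is of the order of
    [n / tmean f n]. *)
Lemma psum_tail_le1 n : psum a n * tail f n <= 1.
Proof.
have <- : conv a (tail f) n = 1 by rewrite conv_ren_tail.
rewrite /psum mulr_suml; apply: ler_sum => i _.
by rewrite ler_wpM2l ?ren_ge0// tail_le// leq_subr.
Qed.

Lemma psum_tmean_ge n : n.+1%:R <= psum a n * tmean f n.
Proof.
rewrite -conv_ren_tmean /psum mulr_suml; apply: ler_sum => i _.
by rewrite ler_wpM2l ?ren_ge0// tmean_le// leq_subr.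
Qed.

Lemma psum_tmean_le n : psum a n * tmean f n <= (2 * n).+1%:R.
Proof.
rewrite -conv_ren_tmean convE (@big_cat_nat _ _ _ n.+1)//=; last lia.
rewrite -[X in X <= _]addr0 lerD//; last first.
  by apply: sumr_ge0 => i _; rewrite mulr_ge0 ?ren_ge0 ?(ltW (tmean_gt0 _)).
rewrite psumE mulr_suml !big_nat; apply: ler_sum => i /andP[_ iN].
by rewrite ler_wpM2l ?ren_ge0// tmean_le//; lia.
Qed.

(** [psum a n] is comparable with [n / tmean f n], whose denominator increases. *)
Lemma psum_double n : psum a (2 * n) <= 4 * psum a n.
Proof.
have h1 := psum_tmean_le (2 * n).
have h2 := psum_tmean_ge n.
have h3 : tmean f n <= tmean f (2 * n) by rewrite tmean_le//; lia.
have m0 := tmean_gt0 n.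
have A2 := psum_ge0 ren_ge0 (2 * n).
rewrite -(ler_pM2r m0).
apply: (@le_trans _ _ (4 * n.+1%:R)); last by rewrite -mulrA ler_wpM2l.
apply: (@le_trans _ _ (psum a (2 * n) * tmean f (2 * n))).
  by rewrite ler_wpM2l.
apply: (le_trans h1).
by rewrite -natrM ler_nat; lia.
Qed.

(** [tmean f] sums a nonincreasing sequence. *)
Lemma tmean_double m n : (n <= (2 * m).+1)%N -> tmean f n <= 2 * tmean f m.
Proof.
move=> nm; apply: (le_trans (tmean_le nm)).
rewrite /tmean psumE (@big_cat_nat _ _ _ m.+1)//=; last lia.
rewrite -psumE mulr_natl mulr2n lerD2l -[X in \sum_(X <= _ < _) _]add0n.
rewrite (big_addn 0 (2 * m).+2 m.+1).
have -> : ((2 * m).+2 - m.+1 = m.+1)%N by lia.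
by rewrite psumE; apply: ler_sum => i _; apply: tail_le; rewrite leq_addr.
Qed.

(** Differentiating [1 / (1 - F(z))].  On the right [f] is weighted by its index,
    which favours the long jumps; regularity of [a] will come from that of
    [euler f]. *)
Lemma euler_ren : euler a = conv (euler f) (conv a a).
Proof.
have h : euler a = conv (euler f) a \+ conv f (euler a).
  rewrite -euler_conv [in LHS](rp_eq fa); apply/funext => n /=.
  by rewrite /euler mulrDr /delta0; case: n => [|n] /=; rewrite !(mul0r, mulr0, add0r).
have h2 : euler a \+ \- conv f (euler a) = conv (euler f) a.
  by apply/funext => n /=; rewrite [in LHS]h /= -h addrK.
rewrite convA -h2 [conv _ a]convC convDr convNr.
apply/funext => n /=.
rewrite convA [conv a f]convC -[LHS]/(euler a n).
have -> : conv a (euler a) = euler a \+ conv (conv f a) (euler a).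
  by rewrite {1}(rp_eq fa) convDl conv_delta0.
by rewrite /= addrK.
Qed.

End RenewalPair.

(** * Uniform convergence of slowly varying sequences *)

Section UniformConvergence.
Variable R : realType.
Local Notation mu := (@lebesgue_measure R).

(** Dilation by [c], written as a preimage by its inverse. *)
Lemma lebesgue_measure_dilation (c : R) (A : set R) : 0 < c -> measurable A ->
  mu ((fun x => c^-1 * x) @^-1` A) = (c%:E * mu A)%E.
Proof.
move=> c0 mA; have ci0 : 0 <= c^-1 by rewrite invr_ge0 ltW.
have mf : measurable_fun setT ((fun x : R => c^-1 * x) : _ -> measurableTypeR R).
  exact: mulrl_measurable.
have h : forall B, measurable B ->
    mu B = pushforward (mscale (NngNum ci0) mu)
      ((fun x : R => c^-1 * x) : _ -> measurableTypeR R) B.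
  move=> B mB; apply: lebesgue_measure_unique => //= _ [[a b]] _ <-.
  rewrite /mscale /= /pushforward.
  rewrite (_ : _ @^-1` _ = `]c * a, c * b]%classic); last first.
    have E x : (a < c^-1 * x <= b) = (c * a < x <= c * b).
      by rewrite ![c^-1 * _]mulrC ltr_pdivlMr// ler_pdivrMr// ![_ * c]mulrC.
    by apply/seteqP; split => x /=; rewrite !in_itv/= E.
  rewrite !lebesgue_measure_itv /= !lte_fin ltr_pM2l//.
  case: ifPn => _; last by rewrite mule0.
  by rewrite -!EFinD -EFinM -mulrBr mulKf// gt_eqF.
rewrite (h A mA) /mscale /= /pushforward muleA -EFinM mulfV ?gt_eqF//.
by rewrite mul1e.
Qed.

(** A set of measure [r] has dilates of measure [c * r] and [d * r], too small to
    cover a longer interval. *)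
Lemma measure_dilation_cover (c d r a b : R) (B : set R) :
  0 < c -> 0 < d -> measurable B -> (mu B <= r%:E)%E ->
  `[a, b]%classic `<=` (fun x => c^-1 * x) @^-1` B `|` (fun x => d^-1 * x) @^-1` B ->
  b - a <= (c + d) * r.
Proof.
move=> c0 d0 mB Br sub.
pose pre (e : R) := (fun x => e^-1 * x) @^-1` B.
have mpre (e : R) : measurable (pre e).
  by rewrite -[X in measurable X]setTI; apply: (mulrl_measurable e^-1).
have h : (mu `[a, b]%classic <= mu (pre c `|` pre d))%E.
  apply: le_measure => //; rewrite inE; first exact: measurable_itv.
  exact: measurableU (mpre c) (mpre d).
have : (mu `[a, b]%classic <= mu (pre c) + mu (pre d))%E.
  exact: le_trans h (measureU2 mu (mpre c) (mpre d)).
rewrite /pre !lebesgue_measure_dilation// lebesgue_measure_itv /= lte_fin => h1.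
have [ab|ba] := ltP a b; last first.
  have r0 : 0 <= r by rewrite -lee_fin (le_trans _ Br).
  by rewrite (@le_trans _ _ 0)// ?subr_le0// mulr_ge0// addr_ge0 ?ltW.
rewrite ab in h1.
rewrite -lee_fin EFinB (le_trans h1)// mulrDl EFinD !EFinM leeD//;
  by rewrite lee_pmul2l// lte_fin.
Qed.

Lemma ratio_close (eps eta r1 r2 : R) : 4 * eta <= eps -> eta <= 1 / 2 ->
  `|r1 - 1| <= eta -> `|r2 - 1| <= eta -> `|r1 / r2 - 1| <= eps.
Proof.
move=> etaE eta2; rewrite !ler_distl => /andP[a1 a2] /andP[b1 b2].
have r20 : 0 < r2 by lra.
have eps0 : 0 <= eps by lra.
have er2 : eps * (1 / 2) <= eps * r2 by rewrite ler_wpM2l//; lra.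
rewrite ler_pdivlMr// ler_pdivrMr// mulrBl mulrDl mul1r.
by apply/andP; split; lra.
Qed.

(** The uniform convergence theorem for slowly varying sequences.  For each fixed
    ratio [x] the convergence is only pointwise; but the set of [x] in [1, 4]
    that are bad for some index beyond [N] decreases to the empty set, hence has
    small measure for large [N].  Its dilates by [n] and by [k] cannot cover
    [[k, 4 n]], so some real [x] there is good for both: [phi n] and [phi k] are
    then both close to the value of [phi] at the integer part of [x]. *)
Lemma sv_uniform (phi : nat -> R) : slowly_varying phi ->
  forall eps : R, 0 < eps -> exists N, forall n k,
    (N <= n)%N -> (n <= k <= 2 * n)%N ->
    0 < phi n /\ `|phi k / phi n - 1| <= eps.
Proof.
move=> [_ phi_gt0 phi_sv] eps eps0.
pose eta : R := Num.min (eps / 4) (1 / 2).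
have eta0 : 0 < eta by rewrite lt_min; apply/andP; split; lra.
have eta2 : eta <= 1 / 2 by rewrite ge_min lexx orbT.
have etaE : 4 * eta <= eps by rewrite mulrC -ler_pdivlMr// ge_min lexx.
pose bad n k := eta < `|phi k / phi n - 1|.
(* The countable union over [k] is over the values of the integer part of
   [n * x], which makes [B N] visibly measurable. *)
pose B N := `[1, 4]%classic `&` \bigcup_(n in [set n | (N <= n)%N])
  \bigcup_(k in [set k | bad n k])
    ((fun x : R => n%:R * x) @^-1` `[k%:R, k.+1%:R[%classic).
have inB N n (x : R) : (N <= n)%N -> 1 <= x <= 4 ->
    bad n (Num.truncn (n%:R * x)) -> B N x.
  move=> Nn x14 bx; split; first by rewrite /= in_itv.
  exists n => //; exists (Num.truncn (n%:R * x)) => //=.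
  by rewrite in_itv /= truncn_itv// mulr_ge0//; lra.
have mB N : measurable (B N).
  apply: measurableI; first exact: measurable_itv.
  apply: bigcup_measurable => n _; apply: bigcup_measurable => k _.
  rewrite -[X in measurable X]setTI.
  by apply: (mulrl_measurable (n%:R : R)) => //; exact: measurable_itv.
(* Each [x] leaves [B N] for [N] large, by slow variation at the ratio [x]. *)
have capB : \bigcap_N B N = set0.
  rewrite -subset0 => x Bx.
  have [x14 _] := Bx 0%N I.
  move: x14; rewrite /= in_itv /= => /andP[x1 x4].
  have := phi_sv x (lt_le_trans ltr01 x1).
  move=> /cvgrPdist_lt /(_ _ eta0) [N _ HN].
  have [_ [n Nn [k /= bk]]] := Bx N I.
  rewrite in_itv /= => /truncn_def kE.
  have := HN n Nn; rewrite /= [x * _]mulrC kE distrC.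
  by move: bk; rewrite /bad => h1 h2; have := lt_trans h1 h2; rewrite ltxx.
have : mu \o B @ \oo --> mu (\bigcap_N B N).
  apply: nonincreasing_cvg_mu => //.
  - rewrite (@le_lt_trans _ _ (mu `[1, 4]%classic))//.
      by apply: le_measure; [rewrite inE; exact: mB | rewrite inE; exact: measurable_itv | move=> x []].
    by rewrite /= lebesgue_measure_itv /= lte_fin; case: ifP => _; rewrite -?EFinD ltry.
  - by rewrite capB; exact: measurable0.
  - move=> m n mn; apply/subsetPset => x [x14 [j /= nj bj]]; split => //.
    by exists j => //=; exact: leq_trans nj.
rewrite capB measure0 => cvB.
have [N0 _ HN0] : \forall n \near \oo, (mu (B n) < (1 / 4)%:E)%E.
  apply: (cvB [set y | (y < (1 / 4)%:E)%E]).
  by apply: open_ereal_lt'; rewrite lte_fin; lra.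
have [N1 _ HN1] := phi_gt0.
pose N := (N0 + N1 + 1)%N.
exists N => n k Nn /andP[nk kn].
have n0 : 0 < n%:R :> R by rewrite ltr0n; lia.
have k0 : 0 < k%:R :> R by rewrite ltr0n; lia.
have phin : 0 < phi n by apply: HN1 => /=; lia.
have phik : 0 < phi k by apply: HN1 => /=; lia.
split => //.
have nkR : n%:R <= k%:R :> R by rewrite ler_nat.
have knR : k%:R <= 2 * n%:R :> R by rewrite -natrM ler_nat.
(* [4 n - k >= 2 n] exceeds the measure [(n + k) / 4] of the two dilates. *)
have [x [x1 x2 gn gk]] : exists x : R, [/\ k%:R <= x, x <= 4 * n%:R,
    ~~ bad n (Num.truncn x) & ~~ bad k (Num.truncn x)].
  apply: contrapT => nox.
  have muBN : (mu (B N) <= (1 / 4)%:E)%E.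
    by apply/ltW/HN0; rewrite /= /N -addnA leq_addr.
  have sub : `[(k%:R : R), 4 * n%:R]%classic `<=`
      (fun x => n%:R^-1 * x) @^-1` (B N) `|` (fun x => k%:R^-1 * x) @^-1` (B N).
    move=> x /=; rewrite in_itv /= => /andP[kx x4].
    have [bn|gn] := boolP (bad n (Num.truncn x)).
      left; apply: (inB _ n) => //; last by rewrite mulrA mulfV ?gt_eqF// mul1r.
      rewrite mulrC ler_pdivlMr// ler_pdivrMr//; apply/andP; split; lra.
    have [bk|gk] := boolP (bad k (Num.truncn x)).
      right; apply: (inB _ k) => //; [exact: leq_trans nk| |
        by rewrite mulrA mulfV ?gt_eqF// mul1r].
      rewrite mulrC ler_pdivlMr// ler_pdivrMr//; apply/andP; split; lra.
    by exfalso; apply: nox; exists x.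
  have := measure_dilation_cover n0 k0 (mB N) muBN sub.
  lra.
move: gn gk; rewrite /bad -!leNgt.
set p := phi (Num.truncn x) => gn gk.
have phinV : phi k / phi n = (p / phi n) / (p / phi k).
  have p0 : p / phi k != 0.
    by apply/eqP => pk0; move: gk; rewrite pk0 sub0r normrN1; lra.
  have pn0 : p != 0 by apply: contraNneq p0 => ->; rewrite mul0r.
  by field; rewrite pn0 !gt_eqF.
rewrite phinV.
exact: (ratio_close etaE eta2).
Qed.

End UniformConvergence.

(** * Regularly varying sequences *)

(** Regular variation with exponent [- s] in its uniform form, for ratios of
    indices between 1 and 2. *)
Definition reg_var (R : realType) (f : nat -> R) (s : R) : Prop :=
  forall eps : R, 0 < eps -> exists2 N, (0 < N)%N & forall n k,
    (N <= n)%N -> (n <= k <= 2 * n)%N ->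
    0 < f n /\ `|f k / f n * (k%:R / n%:R) `^ s - 1| <= eps.

Section RegularVariation.
Variable R : realType.
Implicit Types (f phi : nat -> R) (s : R).

Lemma powR_div (x y s : R) : 0 <= x -> 0 < y ->
  (x / y) `^ s = x `^ s / y `^ s.
Proof.
move=> x0 y0; rewrite powRM ?invr_ge0 ?(ltW y0)//; congr (_ * _).
by rewrite -powR_inv1 ?(ltW y0)// -powRrM mulN1r powRN.
Qed.

Lemma reg_var_mass phi f s : slowly_varying phi ->
  (forall n, (1 <= n)%N -> f n = phi n * n%:R `^ (- s)) -> reg_var f s.
Proof.
move=> sv fE eps eps0; have [N HN] := sv_uniform sv eps0.
exists N.+1 => // n k Nn nk; have [phin phik] := HN n k (ltnW Nn) nk.
have n1 : (1 <= n)%N by apply: leq_trans Nn.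
have k1 : (1 <= k)%N by case/andP: nk => /(leq_trans n1).
have n0 : 0 < n%:R :> R by rewrite ltr0n.
have k0 : 0 < k%:R :> R by rewrite ltr0n.
rewrite !fE//; split; first by rewrite mulr_gt0// powR_gt0.
rewrite (_ : _ * _ = phi k / phi n)//.
rewrite powR_div ?(ltW k0)//.
have := powR_gt0 s k0; have := powR_gt0 s n0.
rewrite !powRN; set x := k%:R `^ s; set y := n%:R `^ s => y0 x0.
by field; rewrite !gt_eqF.
Qed.

Variables (f : nat -> R) (s : R).
Hypotheses (fs : reg_var f s) (s_ge0 : 0 <= s).

Let powR1s : 1 `^ s = 1 :> R. Proof. by rewrite powR1. Qed.

Lemma reg_var_gt0 : exists N, forall n, (N <= n)%N -> 0 < f n.
Proof.
have [N _ HN] := fs ltr01; exists N => n Nn.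
by have [] := HN n n Nn; rewrite ?leqnn//= leq_pmull.
Qed.

Lemma reg_var_ratio (eps : R) : 0 < eps -> exists2 N, (0 < N)%N &
  forall n k, (N <= n)%N -> (n <= k <= 2 * n)%N ->
  (1 - eps) * (f n * (n%:R / k%:R) `^ s) <= f k <=
  (1 + eps) * (f n * (n%:R / k%:R) `^ s).
Proof.
move=> eps0; have [N N0 HN] := fs eps0; exists N => // n k Nn nk.
have [fn0] := HN n k Nn nk.
have n0 : 0 < n%:R :> R by rewrite ltr0n (leq_trans N0).
have k0 : 0 < k%:R :> R.
  by rewrite ltr0n (leq_trans N0)// (leq_trans Nn)//; case/andP: nk.
have -> : (n%:R / k%:R) `^ s = ((k%:R / n%:R) `^ s)^-1 :> R.
  by rewrite !powR_div ?(ltW n0) ?(ltW k0)// invf_div.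
have : 0 < (k%:R / n%:R) `^ s :> R by rewrite powR_gt0// divr_gt0.
move: (_ `^ s) => x x0; rewrite ler_distl => /andP[h1 h2].
have E : f k = f k / f n * x * (f n / x) by field; rewrite !gt_eqF.
have fx : 0 < f n / x by rewrite divr_gt0.
by apply/andP; split; rewrite [f k]E ler_wpM2r// ltW.
Qed.

Lemma powR_ratio_bounds (n k : nat) : (0 < n)%N -> (n <= k <= 2 * n)%N ->
  (2 `^ s)^-1 <= (n%:R / k%:R) `^ s <= (1 : R).
Proof.
move=> n0 /andP[nk kn].
have n0R : 0 < n%:R :> R by rewrite ltr0n.
have k0R : 0 < k%:R :> R by rewrite ltr0n (leq_trans n0).
have nkR : n%:R <= k%:R :> R by rewrite ler_nat.
have knR : k%:R <= 2 * n%:R :> R by rewrite -natrM ler_nat.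
apply/andP; split.
  have -> : (2 `^ s)^-1 = (1 / 2) `^ s :> R by rewrite powR_div// powR1 div1r.
  rewrite ge0_ler_powR ?nnegrE ?divr_ge0 ?(ltW n0R) ?(ltW k0R)//.
  by rewrite ler_pdivlMr//; lra.
rewrite -[leRHS]powR1s ge0_ler_powR ?nnegrE ?divr_ge0 ?(ltW n0R) ?(ltW k0R)//.
by rewrite ler_pdivrMr//; lra.
Qed.

(** Going from [n] to [L * n] takes at most [L] doublings, each of which costs the
    factor [B]. *)
Lemma reg_var_bounded (L : nat) : exists C N, [/\ 1 <= C, (0 < N)%N &
  forall n k, (N <= n)%N -> (n <= k <= L * n)%N -> f k <= C * f n /\ f n <= C * f k].
Proof.
have h2 : (0 : R) < 1 / 2 by lra.
have [N N0 HN] := reg_var_ratio h2.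
have [N1 fpos] := reg_var_gt0.
pose B : R := 2 * 2 `^ s.
have p2 : 1 <= 2 `^ s :> R.
  by rewrite -[leLHS]powR1s ge0_ler_powR ?nnegrE//; lra.
have B1 : 1 <= B by rewrite /B; lra.
have step n k : (N + N1 <= n)%N -> (n <= k <= 2 * n)%N ->
    f k <= B * f n /\ f n <= B * f k.
  move=> Nn nk; have Nn' := leq_trans (leq_addr N1 N) Nn.
  have /andP[] := HN n k Nn' nk.
  have /andP[] := powR_ratio_bounds (leq_trans N0 Nn') nk.
  have f0 : 0 < f n by apply: fpos; exact: leq_trans (leq_addl _ _) Nn.
  set y := (_ / _) `^ s; rewrite /B; set t := 2 `^ s in p2 * => y1 y2 h3 h4.
  have t0 : 0 < t by lra.
  split.
    apply: (le_trans h4); have : f n * y <= f n by rewrite ler_piMr// ltW.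
    have : f n <= t * f n by rewrite ler_peMl// ltW.
    lra.
  have : f n * t^-1 <= f n * y by rewrite ler_wpM2l// ltW.
  rewrite ler_pdivrMr// => h5.
  have : t * ((1 - 1 / 2) * (f n * y)) <= t * f k by rewrite ler_wpM2l// ltW.
  lra.
exists (B ^+ L), (N + N1)%N; split; rewrite ?exprn_ege1 ?addn_gt0 ?N0//.
have B0 : 0 <= B by lra.
suff h n k : (N + N1 <= n)%N -> (n <= k <= 2 ^ L * n)%N ->
    f k <= B ^+ L * f n /\ f n <= B ^+ L * f k.
  move=> n k Nn /andP[nk kn]; apply: h => //; rewrite nk (leq_trans kn)//.
  by rewrite leq_mul2r (ltnW (ltn_expl _ _)) ?orbT.
elim: L n k => [|L IH] n k Nn /andP[nk kn].
  have -> : k = n by apply/eqP; rewrite eqn_leq nk -(mul1n n) kn.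
  by rewrite expr0 mul1r.
have [p [np pL pk kp]] : exists p, [/\ (n <= p)%N, (p <= 2 ^ L * n)%N,
    (p <= k)%N & (k <= 2 * p)%N].
  have nL : (n <= 2 ^ L * n)%N by rewrite leq_pmull// expn_gt0.
  exists (maxn n (uphalf k)); move: nL kn; rewrite expnS -mulnA.
  move: (2 ^ L * n)%N => M; clear -nk => h3 h4; split; lia.
have [] := IH n p Nn; first by rewrite np.
have [] := step p k (leq_trans Nn np); first by rewrite pk.
move=> h3 h4 h5 h6; rewrite exprS; split.
  by apply: (le_trans h3); rewrite -mulrA ler_wpM2l.
apply: (le_trans h6); rewrite [B * _]mulrC -mulrA ler_wpM2l// exprn_ge0//.
Qed.

End RegularVariation.

(** * Truncated first moments *)

Section MomentsOfRegularVariation.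
Variable R : realType.

Lemma natr_large (x : R) : exists N, forall n, (N <= n)%N -> x <= n%:R.
Proof.
exists (Num.truncn x).+1 => n Nn; apply: ltW.
by rewrite (lt_le_trans (truncnS_gt _))// ler_nat.
Qed.

Lemma natr_large_pos (x : R) : exists2 N, (0 < N)%N &
  forall n, (N <= n)%N -> x <= n%:R /\ 0 < n%:R :> R.
Proof.
have [N HN] := natr_large x; exists N.+1 => // n Nn; split; first exact/HN/ltnW.
by rewrite ltr0n (leq_trans _ Nn).
Qed.

Variables (f : nat -> R) (s : R).
Hypotheses (f_ge0 : forall n, 0 <= f n) (fs : reg_var f s).

Let euler_ge0 n : 0 <= euler f n. Proof. by rewrite mulr_ge0. Qed.

(** One step changes [k ^ (- s)] by a relative amount [s / k]. *)
Lemma euler_step_small : 0 <= s -> forall eps : R, 0 < eps -> exists N, forall n, (N <= n)%N ->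
  `|euler f n.+1 - euler f n| <= eps * euler f n.
Proof.
move=> s_ge0 eps eps0; pose eta : R := Num.min (eps / 3) (1 / 2).
have eta0 : 0 < eta by rewrite lt_min; apply/andP; split; lra.
have eta2 : eta <= 1 / 2 by rewrite ge_min lexx orbT.
have etaE : 3 * eta <= eps by rewrite mulrC -ler_pdivlMr// ge_min lexx.
have [N N0 HN] := reg_var_ratio fs eta0.
have [N1 N10 HN1] := natr_large_pos ((1 + s) / eta).
exists (N + N1)%N => n Nn.
have [n1 n0] := HN1 n (leq_trans (leq_addl _ _) Nn).
have := HN n n.+1 (leq_trans (leq_addr _ _) Nn).
have n0' : (0 < n)%N by rewrite -(ltr0n R).
have nk : (n <= n.+1 <= 2 * n)%N.
  by rewrite leqnSn/= mul2n -addnn -addn1 leq_add2l.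
move=> /(_ nk).
have pk : 1 - s / n%:R <= (n%:R / n.+1%:R) `^ s <= 1.
  have E : n%:R / n.+1%:R = 1 / (1 + n%:R^-1) :> R.
    by rewrite -natr1; field; rewrite !gt_eqF// addr_gt0.
  have i0 : 0 < n%:R^-1 :> R by rewrite invr_gt0.
  apply/andP; split; last first.
    by have /andP[] := powR_ratio_bounds s_ge0 n0' nk.
  have j0 : 0 < 1 + n%:R^-1 :> R by lra.
  rewrite E powR_div//.
  rewrite powR1 div1r /powR gt_eqF//.
  rewrite -expRN (le_trans _ (expR_ge1Dx _))// lerD2l lerN2 ler_wpM2l//.
  by apply: le_ln1Dx; lra.
move: pk; set y := (_ / _) `^ s => /andP[y1 y2] /andP[h1 h2].
have f0 := f_ge0 n.
have sn : (1 + s) / n%:R <= eta.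
  by rewrite ler_pdivrMr// mulrC -ler_pdivrMr.
have sE : s / n%:R + n%:R^-1 = (1 + s) / n%:R by field; rewrite gt_eqF.
have s1 : 0 <= s / n%:R by rewrite divr_ge0// ltW.
have s2 : 0 <= n%:R^-1 :> R by rewrite invr_ge0 ltW.
have fy : f n * y <= f n by rewrite ler_piMr.
have fy1 : (1 - eta) * f n <= f n * y by rewrite mulrC ler_wpM2l//; lra.
have nf : 0 <= n%:R * f n by rewrite mulr_ge0// ltW.
have k1 : n.+1%:R <= (1 + eta) * n%:R :> R.
  rewrite -natr1 mulrDl mul1r lerD2l -ler_pdivrMr//; lra.
have k2 : n%:R <= n.+1%:R :> R by rewrite ler_nat.
have up : f n.+1 <= (1 + eta) * f n.
  by apply: (le_trans h2); rewrite ler_wpM2l//; lra.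
have lo : (1 - eta) * ((1 - eta) * f n) <= f n.+1.
  by apply: le_trans h1; rewrite ler_wpM2l//; lra.
rewrite ler_distl /euler; apply/andP; split.
  apply: (@le_trans _ _ (n%:R * ((1 - eta) * ((1 - eta) * f n)))); last first.
    apply: (@le_trans _ _ (n%:R * f n.+1)); first by rewrite ler_wpM2l// ltW.
    by rewrite ler_wpM2r.
  have -> : n%:R * ((1 - eta) * ((1 - eta) * f n)) = (1 - eta) ^+ 2 * (n%:R * f n).
    by ring.
  rewrite -[X in X - _]mul1r -mulrBl ler_wpM2r// expr2.
  have : 0 <= eta * eta by rewrite mulr_ge0// ltW.
  lra.
apply: (@le_trans _ _ ((1 + eta) * n%:R * f n.+1)); first by rewrite ler_wpM2r.
apply: (@le_trans _ _ ((1 + eta) * n%:R * ((1 + eta) * f n))).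
  by rewrite ler_wpM2l// mulr_ge0 ?ltW//; lra.
have -> : (1 + eta) * n%:R * ((1 + eta) * f n) = (1 + eta) ^+ 2 * (n%:R * f n).
  by ring.
rewrite [leRHS](_ : _ = (1 + eps) * (n%:R * f n)); last by ring.
rewrite ler_wpM2r// expr2.
have : eta * eta <= eta * 1 by rewrite ler_wpM2l ?(ltW eta0)//; lra.
lra.
Qed.

(** The order of magnitude of the sum of [euler f] over the block [[n / 2, n]]. *)
Let w n : R := n%:R ^+ 2 * f n.

Let w_ge0 n : 0 <= w n. Proof. by rewrite mulr_ge0// exprn_ge0. Qed.

Lemma euler_block_le : 0 <= s -> exists C N, 1 <= C /\ forall n, (N <= n)%N ->
  psum (euler f) n <= psum (euler f) (uphalf n) + C * w n.
Proof.
move=> s_ge0; have [C [N [C1 N0 HN]]] := reg_var_bounded fs s_ge0 2.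
exists (C * C), (2 * N)%N; split; first by rewrite -expr2 exprn_ege1.
move=> n Nn; have C0 : 0 <= C by lra.
have [pn nq Np] : [/\ (uphalf n <= n)%N, (n <= 2 * uphalf n)%N & (N <= uphalf n)%N].
  by clear -Nn; split; lia.
rewrite -lerBlDl -sum_nat_psum//.
apply: (@le_trans _ _ (\sum_((uphalf n).+1 <= i < n.+1) n%:R * (C * C * f n))).
  rewrite !big_nat; apply: ler_sum => i /andP[pi]; rewrite ltnS => iN.
  apply: ler_pM => //; first by rewrite ler_nat.
  have [|h1 _] := HN _ i Np; first by rewrite (ltnW pi) (leq_trans iN).
  have [|_ h2] := HN _ n Np; first by rewrite pn.
  by apply: (le_trans h1); rewrite -mulrA ler_wpM2l.
rewrite big_const_nat iter_addr addr0 -[leLHS]mulr_natl.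
have -> : C * C * w n = n%:R * (n%:R * (C * C * f n)) by rewrite /w; ring.
by rewrite ler_wpM2r ?mulr_ge0// ler_nat; clear; lia.
Qed.

(** [w] varies regularly with the positive exponent [2 - s], so that it grows
    geometrically along doublings.  The ratio [3 / 2], rather than 2, leaves room
    for the rounding in [uphalf]. *)
Lemma sq_mass_half_le : 0 <= s < 2 -> exists (q : R) N, 0 < q < 1 /\ forall n, (N <= n)%N ->
  w (uphalf n) <= q * w n.
Proof.
move=> /andP[s_ge0 s2]; pose t : R := (3 / 2) `^ (2 - s).
have t1 : 1 < t.
  have <- : 1 `^ (2 - s) = 1 :> R by rewrite powR1.
  by rewrite /t gt0_ltr_powR ?nnegrE//; lra.
have eta0 : 0 < (t - 1) / (2 * t) by rewrite divr_gt0; lra.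
have [N N0 HN] := reg_var_ratio fs eta0.
exists (2 / (t + 1)), (2 * N + 2)%N; split.
  by apply/andP; split; [rewrite divr_gt0//; lra | rewrite ltr_pdivrMr; lra].
move=> n Nn.
have [Np pn np p32] : [/\ (N <= uphalf n)%N, (uphalf n <= n)%N,
    (n <= 2 * uphalf n)%N & (3 * uphalf n <= 2 * n)%N].
  by clear -Nn; split; lia.
have := HN _ n Np; rewrite pn np => /(_ isT) /andP[lo _].
have p0 : 0 < (uphalf n)%:R :> R by rewrite ltr0n (leq_trans N0).
have n0 : 0 < n%:R :> R by rewrite ltr0n (leq_trans N0 (leq_trans Np pn)).
rewrite /w; set p := uphalf n in lo p0 *.
have r32 : 3 / 2 <= n%:R / p%:R :> R.
  by rewrite ler_pdivlMr// mulrAC ler_pdivrMr// -!natrM ler_nat mulnC [(n * 2)%N]mulnC mulnC.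
set y := (_ / _) `^ s in lo.
have pE : p%:R ^+ 2 <= n%:R ^+ 2 * y / t :> R.
  rewrite ler_pdivlMr ?(lt_trans _ t1)//.
  have -> : n%:R ^+ 2 * y = p%:R ^+ 2 * (n%:R / p%:R) `^ (2 - s).
    have r0 : 0 < n%:R / p%:R :> R by rewrite divr_gt0.
    rewrite powRB; last by rewrite (gt_eqF r0) implybT.
    rewrite (powR_mulrn 2 (ltW r0)).
    rewrite /y !powR_div ?(ltW n0) ?(ltW p0)//.
    have := powR_gt0 s n0; have := powR_gt0 s p0; move: (_ `^ s) (_ `^ s) => u v u0 v0.
    by field; rewrite !gt_eqF.
  rewrite ler_wpM2l ?exprn_ge0 ?(ltW p0)// ge0_ler_powR ?nnegrE; lra.
have f0 := f_ge0 p; have fn0 := f_ge0 n.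
apply: (@le_trans _ _ (n%:R ^+ 2 * y / t * f p)); first by rewrite ler_wpM2r.
have t0 : 0 < t by lra.
have e1 : (1 - (t - 1) / (2 * t)) = (t + 1) / (2 * t) by field; rewrite gt_eqF.
rewrite e1 in lo.
have e2 : f p * y <= 2 * t / (t + 1) * f n.
  rewrite -ler_pdivrMl ?divr_gt0//; last lra; last lra.
  by rewrite invf_div.
apply: (@le_trans _ _ (n%:R ^+ 2 / t * (2 * t / (t + 1) * f n))).
  rewrite [leLHS](_ : _ = n%:R ^+ 2 / t * (f p * y)); last by ring.
  by rewrite ler_wpM2l// divr_ge0 ?exprn_ge0 ?ltW.
rewrite le_eqVlt; apply/orP; left; apply/eqP; field.
by rewrite !gt_eqF//; lra.
Qed.

(** The sums over the dyadic blocks form a geometric progression dominated by its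
    last term. *)
Lemma psum_euler_le : 0 <= s < 2 -> exists K N, forall n, (N <= n)%N ->
  psum (euler f) n <= K * w n.
Proof.
move=> s02; have /andP[s_ge0 _] := s02.
have [q [N1 [/andP[q0 q1] H1]]] := sq_mass_half_le s02.
have [C [N2 [C1 H2]]] := euler_block_le s_ge0.
have [N3 H3] := reg_var_gt0 fs.
pose N := (N1 + N2 + N3 + 1)%N; pose S := psum (euler f).
have S0 n : 0 <= S n by exact: psum_ge0.
have w0 n : (N <= n)%N -> 0 < w n.
  rewrite /N => Nn; rewrite mulr_gt0 ?exprn_gt0 ?ltr0n ?H3//; move: Nn; clear; lia.
pose K0 := \sum_(i < 2 * N) S i / w i.
have K00 : 0 <= K0 by apply: sumr_ge0 => i _; rewrite divr_ge0.
pose K := K0 + C / (1 - q); exists K, N.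
have Cq : 0 <= C / (1 - q) by rewrite divr_ge0; lra.
elim/ltn_ind => n IH Nn; have [nN|nN] := ltnP n (2 * N).
  rewrite -ler_pdivrMr ?w0// /K (le_trans _ (_ : K0 <= _)) ?lerDl//.
  rewrite /K0 (bigD1 (Ordinal nN))//= lerDl.
  by apply: sumr_ge0 => i _; rewrite divr_ge0.
have [h1 h2 h3 h4] : [/\ (N1 <= n)%N, (N2 <= n)%N, (uphalf n < n)%N & (N <= uphalf n)%N].
  by move: nN; rewrite /N; clear; split; lia.
apply: (le_trans (H2 n h2)).
have /(ler_wpM2l (_ : 0 <= K)) h5 := H1 n h1.
have h6 := IH _ h3 h4.
have CE : C * w n = (C / (1 - q)) * (1 - q) * w n by rewrite divfK// gt_eqF; lra.
have K0q : K0 * q * w n <= K0 * w n.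
  by rewrite ler_wpM2r ?w_ge0// ler_piMr//; lra.
have {}h5 : K * w (uphalf n) <= K * (q * w n) by apply: h5; rewrite /K addr_ge0.
apply: (@le_trans _ _ (K * (q * w n) + C * w n)); first by rewrite lerD2r (le_trans h6).
rewrite CE /K; move: (C / _) => D; lra.
Qed.

(** Stopping [j] doublings before [n] gains a factor [q ^ j]. *)
Lemma psum_euler_small : 0 <= s < 2 -> forall eps : R, 0 < eps ->
  exists L N, (0 < L)%N /\ forall n, (N <= n)%N ->
  psum (euler f) (n %/ L) <= eps * w n.
Proof.
move=> s02 eps eps0; have /andP[s_ge0 _] := s02.
have [q [N1 [/andP[q0 q1] H1]]] := sq_mass_half_le s02.
have [K [N2 H2]] := psum_euler_le s02.
have [j qj] : exists j, `|K| * q ^+ j <= eps.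
  have := @cvg_expr R q; rewrite ger0_norm ?(ltW q0)// => /(_ q1).
  move=> /cvgrPdist_le /(_ (eps / (1 + `|K|))).
  have K1 : 0 < 1 + `|K| by rewrite ltr_pwDl.
  move=> /(_ (divr_gt0 eps0 K1)) [j _ /(_ j (leqnn _))] /=.
  rewrite sub0r normrN ger0_norm ?exprn_ge0 ?(ltW q0)// ler_pdivlMr// => h.
  exists j; apply: le_trans h; rewrite mulrC ler_wpM2l ?exprn_ge0 ?(ltW q0)//.
  by rewrite lerDr.
pose N := (N1 + N2)%N.
have iter_w i n : (2 ^ i * N <= n)%N ->
    [/\ (N <= iter i uphalf n)%N, (n <= 2 ^ i * iter i uphalf n)%N &
        w (iter i uphalf n) <= q ^+ i * w n].
  elim: i n => [|i IH] n; first by rewrite expn0 !mul1n expr0 mul1r.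
  rewrite iterSr expnS -mulnA => Nn.
  have [|a1 a2 a3] := IH (uphalf n).
    by move: Nn; move: (2 ^ i * N)%N; clear; lia.
  split => //; first by move: a2; rewrite -mulnA; move: (2 ^ i * _)%N; clear; lia.
  apply: (le_trans a3); rewrite exprSr -mulrA ler_wpM2l ?exprn_ge0 ?(ltW q0)//.
  apply: H1; apply: leq_trans Nn; rewrite mulnA -expnS.
  by rewrite (leq_trans (leq_addr N2 N1))// leq_pmull// expn_gt0.
exists (2 ^ j)%N, (2 ^ j * N)%N; split; first by rewrite expn_gt0.
move=> n Nn; have [a1 a2 a3] := iter_w j n Nn.
apply: (@le_trans _ _ (psum (euler f) (iter j uphalf n))).
  apply: psum_le => //; rewrite -(leq_pmul2l (expn_gt0 2 j : 0 < 2 ^ j)%N).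
  by rewrite mulnC (leq_trans (leq_trunc_div _ _)).
have Nq : (N2 <= iter j uphalf n)%N by rewrite (leq_trans _ a1)// leq_addl.
apply: (le_trans (H2 _ Nq)).
apply: (@le_trans _ _ (`|K| * w (iter j uphalf n))).
  by rewrite ler_wpM2r// ler_norm.
apply: (@le_trans _ _ (`|K| * (q ^+ j * w n))); first by rewrite ler_wpM2l.
by rewrite mulrA ler_wpM2r.
Qed.

(** Here [w] varies regularly with the negative exponent [2 - s]. *)
Lemma sq_mass_double_le : 2 < s -> exists (q : R) N, 0 < q < 1 /\ forall n, (N <= n)%N ->
  w (2 * n) <= q * w n.
Proof.
move=> s2; pose t : R := 2 `^ (s - 2).
have t1 : 1 < t.
  have <- : 1 `^ (s - 2) = 1 :> R by rewrite powR1.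
  by rewrite /t gt0_ltr_powR ?nnegrE//; lra.
have eta0 : 0 < (t - 1) / 2 by rewrite divr_gt0; lra.
have [N N0 HN] := reg_var_ratio fs eta0.
exists ((t + 1) / (2 * t)), N; split.
  by apply/andP; split; [rewrite divr_gt0//; lra | rewrite ltr_pdivrMr; lra].
move=> n Nn.
have := HN n (2 * n)%N Nn; rewrite leqnn leq_pmull// => /(_ isT) /andP[_ up].
have n0 : 0 < n%:R :> R by rewrite ltr0n (leq_trans N0).
have E : (n%:R / (2 * n)%:R) `^ s = (4 * t)^-1 :> R.
  rewrite natrM (_ : _ / _ = 1 / 2); last by field; rewrite gt_eqF.
  rewrite powR_div// powR1 div1r /t powRB; last by rewrite pnatr_eq0 implybT.
  by rewrite (powR_mulrn 2)//; congr (_^-1); field.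
have t0 : 0 < t by lra.
rewrite E in up; rewrite /w natrM.
apply: (@le_trans _ _ ((2 * n%:R) ^+ 2 * ((1 + (t - 1) / 2) * (f n * (4 * t)^-1)))).
  by rewrite ler_wpM2l// exprn_ge0// mulr_ge0// ltW.
rewrite le_eqVlt; apply/orP; left; apply/eqP; field.
by rewrite gt_eqF.
Qed.

(** The sums over the dyadic blocks decrease geometrically; the quantity in [H]
    absorbs the rest of the series, so that it does not increase. *)
Lemma psum_euler_bounded : 2 < s -> exists B, forall n, psum (euler f) n <= B.
Proof.
move=> s2; have s_ge0 : 0 <= s by lra.
have [q [N1 [/andP[q0 q1] H1]]] := sq_mass_double_le s2.
have [C [N2 [C1 H2]]] := euler_block_le s_ge0.
pose N := (N1 + N2 + 1)%N; pose K : R := C / (1 - q).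
have K0 : 0 <= K by rewrite divr_ge0; lra.
have KE : C + K * q = K by rewrite /K; field; rewrite gt_eqF; lra.
have H i : psum (euler f) (2 ^ i * N) + K * q * w (2 ^ i * N) <=
    psum (euler f) N + K * q * w N.
  elim: i => [|i IH]; first by rewrite mul1n.
  apply: le_trans IH; rewrite expnS -mulnA; set m := (2 ^ i * N)%N.
  have Nm : (N <= m)%N by rewrite leq_pmull// expn_gt0.
  have [m1 m2] : (N1 <= m)%N /\ (N2 <= 2 * m)%N.
    by move: Nm; rewrite /N; clear; lia.
  have := H2 _ m2; rewrite (_ : uphalf (2 * m) = m); last by clear; lia.
  have := H1 m m1 => /(ler_wpM2l K0).
  have : C * w (2 * m) + K * q * w (2 * m) = K * w (2 * m) by rewrite -mulrDl KE.
  lra.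
exists (psum (euler f) N + K * q * w N) => n.
apply: le_trans (H n).
have nN : (n <= 2 ^ n * N)%N.
  by rewrite (leq_trans (ltnW (ltn_expl n (ltnSn 1))))// leq_pmulr// /N addn1.
apply: (le_trans (psum_le _ nN)) => //.
by rewrite lerDl mulr_ge0// mulr_ge0// ltW.
Qed.

(** [1 / j^2] lies between the telescoping terms [1 / (j (j + 1))] and
    [1 / ((j - 1) j)]. *)
Lemma sum_inv_sq (k m : nat) : (1 < k)%N -> (k <= m)%N ->
  (k%:R^-1 - m%:R^-1 : R) <= \sum_(k <= j < m) (j%:R ^+ 2)^-1
    <= (k.-1%:R^-1 - m.-1%:R^-1 : R).
Proof.
move=> k1 /subnKC <-; elim: (m - k)%N => [|i /andP[IH1 IH2]].
  by rewrite addn0 !subrr big_geq// lexx.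
rewrite addnS big_nat_recr ?leq_addr//=; move: (k + i)%N (leq_addr i k) IH1 IH2.
move=> [|[|j]] kj; [by lia..|] => /= IH1 IH2.
have j0 : 0 < j.+1%:R :> R by rewrite ltr0n.
have E1 : j.+3%:R = j.+1%:R + 2 :> R by rewrite -!natr1; ring.
have E2 : j.+2%:R = j.+1%:R + 1 :> R by rewrite -!natr1; ring.
rewrite E1; rewrite E2 in IH1 IH2 *; move: j.+1%:R j0 IH1 IH2 => x x0 IH1 IH2.
have h1 : (x + 1)^-1 - (x + 2)^-1 <= ((x + 1) ^+ 2)^-1.
  have -> : (x + 1)^-1 - (x + 2)^-1 = ((x + 1) * (x + 2))^-1.
    by field; rewrite !gt_eqF//; lra.
  by rewrite expr2 lef_pV2 ?posrE; nra.
have h2 : ((x + 1) ^+ 2)^-1 <= x^-1 - (x + 1)^-1.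
  have -> : x^-1 - (x + 1)^-1 = ((x + 1) * x)^-1.
    by field; rewrite !gt_eqF//; lra.
  by rewrite expr2 lef_pV2 ?posrE; nra.
by apply/andP; split; lra.
Qed.

End MomentsOfRegularVariation.

(** * Tails of regularly varying laws of exponent 2 *)

Section CriticalIndex.
Variables (R : realType) (f : nat -> R).
Hypotheses (f_ge0 : forall n, 0 <= f n) (f2 : reg_var f 2).

(** On a block where [f j] is close to [f k * k^2 / j^2], the mass is close to
    [f k * k^2 * (1 / k - 1 / (2 k))], that is to [k * f k / 2], and so is the
    decrease of [euler f], since [f (2 k)] is close to [f k / 4].  Written this
    way, the estimates for consecutive blocks telescope. *)
Lemma dyadic_block_mass (eps : R) : 0 < eps <= 1 -> exists2 N, (0 < N)%N &
  forall k, (N <= k)%N ->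
  (1 - eps) * (euler f k - euler f (2 * k)) <= \sum_(k <= j < 2 * k) f j
    <= (1 + eps) * (euler f k - euler f (2 * k)).
Proof.
move=> /andP[eps0 eps1]; pose eta : R := eps / 5.
have eta0 : 0 < eta by rewrite divr_gt0.
have eta5 : eta <= 1 / 5 by rewrite ler_pM2r ?invr_gt0.
have [N N0 HN] := reg_var_ratio f2 eta0.
have [N1 N10 HN1] := natr_large_pos (3 / eta).
exists (N + N1)%N; first by rewrite addn_gt0 N0.
move=> k Nk; have Nk' := leq_trans (leq_addr N1 N) Nk.
have [k3 k0] := HN1 k (leq_trans (leq_addl N N1) Nk).
have fk := f_ge0 k.
have kf : 0 <= k%:R * f k by rewrite mulr_ge0// ltW.
have K : 3 <= eta * k%:R by rewrite mulrC -ler_pdivrMr.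
have k15 : 15 <= k%:R :> R.
  have : eta * k%:R <= 1 / 5 * k%:R by rewrite ler_wpM2r// ltW.
  lra.
have k1 : (1 < k)%N by rewrite -(ltr_nat R); lra.
have fj j : (k <= j < 2 * k)%N ->
    (1 - eta) * (f k * k%:R ^+ 2) * (j%:R ^+ 2)^-1 <= f j <=
    (1 + eta) * (f k * k%:R ^+ 2) * (j%:R ^+ 2)^-1.
  move=> /andP[kj jk]; have := HN k j Nk'; rewrite kj (ltnW jk) => /(_ isT).
  have j0 : 0 < j%:R :> R by rewrite (lt_le_trans k0)// ler_nat.
  rewrite (powR_mulrn 2) ?divr_ge0 ?(ltW k0) ?(ltW j0)// expr_div_n.
  by rewrite !mulrA.
have [lo up] : (1 - eta) * (f k * k%:R ^+ 2) * \sum_(k <= j < 2 * k) (j%:R ^+ 2)^-1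
      <= \sum_(k <= j < 2 * k) f j /\
    \sum_(k <= j < 2 * k) f j
      <= (1 + eta) * (f k * k%:R ^+ 2) * \sum_(k <= j < 2 * k) (j%:R ^+ 2)^-1.
  by split; rewrite mulr_sumr !big_nat; apply: ler_sum => j /fj /andP[].
have /andP[] := sum_inv_sq R k1 (leq_pmull k (ltn0Sn 1)).
set Q := \sum_(k <= j < 2 * k) _ in lo up *; set B := \sum_(k <= j < 2 * k) _ in lo up *.
have k10 : 0 < k.-1%:R :> R by rewrite ltr0n; move: k1; clear; lia.
have E1 : k.-1%:R = k%:R - 1 :> R by rewrite -subn1 natrB// ltnW.
have E2 : (2 * k).-1%:R = 2 * k%:R - 1 :> R.
  by rewrite -subn1 natrB ?natrM//; move: k1; clear; lia.
rewrite E1 E2 natrM => Q1 Q2.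
have lo' : (1 - eta) * (k%:R * f k / 2) <= B.
  apply: le_trans lo; rewrite -[leRHS]mulrA ler_wpM2l//; first lra.
  have -> : k%:R * f k / 2 = f k * k%:R ^+ 2 * (k%:R^-1 - (2 * k%:R)^-1).
    by field; rewrite gt_eqF.
  by rewrite ler_wpM2l// mulr_ge0// exprn_ge0// ltW.
have up' : B <= (1 + eta) ^+ 2 * (k%:R * f k / 2).
  apply: (le_trans up).
  have -> : (1 + eta) ^+ 2 * (k%:R * f k / 2) = (1 + eta) * (f k * ((1 + eta) * k%:R / 2)).
    by ring.
  rewrite -[leLHS]mulrA ler_wpM2l//; first lra.
  apply: (@le_trans _ _ (f k * k%:R ^+ 2 * ((k%:R - 1)^-1 - (2 * k%:R - 1)^-1))).
    by rewrite ler_wpM2l// mulr_ge0// exprn_ge0// ltW.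
  rewrite -[leLHS]mulrA ler_wpM2l//.
  have -> : k%:R ^+ 2 * ((k%:R - 1)^-1 - (2 * k%:R - 1)^-1) =
      k%:R * (k%:R ^+ 2 / ((k%:R - 1) * (2 * k%:R - 1))) :> R.
    by field; rewrite !gt_eqF//; lra.
  rewrite [leRHS](_ : _ = k%:R * ((1 + eta) / 2)); last by ring.
  rewrite ler_wpM2l ?(ltW k0)//.
  rewrite ler_pdivrMr ?mulr_gt0//; [|lra..].
  have : 3 * k%:R <= eta * k%:R * k%:R by rewrite ler_wpM2r// ltW.
  have : eta * k%:R <= 1 / 5 * k%:R by rewrite ler_wpM2r// ltW.
  rewrite expr2; lra.
have /andP[] := HN k (2 * k)%N Nk' (introT andP (conj (leq_pmull k (ltn0Sn 1)) (leqnn _))).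
have -> : (k%:R / (2 * k)%:R) `^ 2 = 1 / 4 :> R.
  rewrite natrM (_ : _ / _ = 1 / 2); last by field; rewrite gt_eqF.
  by rewrite (powR_mulrn 2)//; field.
rewrite /euler natrM => a1 a2.
have b1 : (1 - eta) * (k%:R * f k / 2) <= 2 * k%:R * f (2 * k)%N.
  apply: (@le_trans _ _ (2 * k%:R * ((1 - eta) * (f k * (1 / 4))))); first lra.
  by rewrite ler_wpM2l// mulr_ge0// ltW.
have b2 : 2 * k%:R * f (2 * k)%N <= (1 + eta) * (k%:R * f k / 2).
  apply: (@le_trans _ _ (2 * k%:R * ((1 + eta) * (f k * (1 / 4))))); last lra.
  by rewrite ler_wpM2l// mulr_ge0// ltW.
have eE : eps = 5 * eta by rewrite /eta mulrC divfK.
move: b1 b2 lo' up' => {a1 a2 lo up fj Q1 Q2 HN HN1 K k3}.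
move: (2 * k%:R * f (2 * k)%N) B {Q} => y B.
move: (k%:R * f k) kf => x x0 b1 b2 lo' up'.
have ex : 0 <= eta * x by rewrite mulr_ge0// ltW.
have eex : eta * (eta * x) <= 1 / 5 * (eta * x) by rewrite ler_wpM2r.
have eex0 : 0 <= eta * (eta * x) by rewrite mulr_ge0// ltW.
have d1 : (1 - eta) * (x / 2) <= x - y by lra.
have d2 : x - y <= (1 + eta) * (x / 2) by lra.
apply/andP; split.
  apply: le_trans lo'.
  apply: (@le_trans _ _ ((1 - eps) * ((1 + eta) * (x / 2)))).
    by rewrite ler_wpM2l//; lra.
  rewrite eE; lra.
apply: (le_trans up').
apply: (@le_trans _ _ ((1 + eps) * ((1 - eta) * (x / 2)))); last first.
  by rewrite ler_wpM2l//; lra.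
rewrite eE expr2; lra.
Qed.

Hypothesis f_le1 : forall n, psum f n <= 1.
Hypothesis tail_cvg0 : forall eps : R, 0 < eps -> exists n, tail f n <= eps.

Lemma tail_sub_psum m n : (m <= n)%N -> tail f m - tail f n = \sum_(m.+1 <= i < n.+1) f i.
Proof. by move=> mn; rewrite sum_nat_psum// /tail; ring. Qed.

(** Karamata's theorem for the exponent 2.  The telescoping block estimates are
    added up, and the end terms vanish in the limit. *)
Lemma tail_asymp (eps : R) : 0 < eps -> exists N, forall k, (N <= k)%N ->
  `|tail f k - euler f k.+1| <= eps * tail f k.
Proof.
move=> eps0; pose eta : R := Num.min (eps / 2) (1 / 2).
have eta0 : 0 < eta by rewrite lt_min; apply/andP; split; lra.
have eta2 : eta <= 1 / 2 by rewrite ge_min lexx orbT.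
have etaE : 2 * eta <= eps by rewrite mulrC -ler_pdivlMr// ge_min lexx.
have [|N1 N10 H1] := @dyadic_block_mass eta; first by apply/andP; split; lra.
have [C [N2 [C1 N20 H2]]] := reg_var_bounded f2 (ler0n R 2) 2.
have T0 n : 0 <= tail f n by rewrite subr_ge0.
have Tle m n : (m <= n)%N -> tail f n <= tail f m.
  by move=> mn; rewrite lerD2l lerN2 psum_le.
pose x k := tail f k.-1.
have xE k : (0 < k)%N -> x k - x (2 * k)%N = \sum_(k <= i < 2 * k) f i.
  move=> k0; rewrite /x tail_sub_psum; last by move: k0; clear; lia.
  by rewrite !prednK// muln_gt0 k0.
exists (N1 + N2)%N => k Nk.
have iter i : (1 - eta) * (euler f k.+1 - euler f (2 ^ i * k.+1)) <=
    x k.+1 - x (2 ^ i * k.+1)%N <= (1 + eta) * (euler f k.+1 - euler f (2 ^ i * k.+1)).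
  elim: i => [|i /andP[IH1 IH2]]; first by rewrite mul1n !subrr !mulr0 lexx.
  have km : (k.+1 <= 2 ^ i * k.+1)%N by rewrite leq_pmull// expn_gt0.
  rewrite expnS -mulnA; move: (2 ^ i * k.+1)%N km IH1 IH2 => m km IH1 IH2.
  have Nm : (N1 <= m)%N.
    by rewrite (leq_trans _ km)// (leq_trans _ (leqW Nk))// leq_addr.
  have := H1 m Nm; rewrite -xE ?(leq_trans _ km)// => /andP[h1 h2].
  by apply/andP; split; lra.
have small (del : R) : 0 < del -> exists i,
    x (2 ^ i * k.+1)%N <= del /\ euler f (2 ^ i * k.+1) <= del.
  move=> del0; have C0 : 0 < C by lra.
  have [n Tn] := tail_cvg0 (divr_gt0 del0 C0).
  have nk : (n <= (2 ^ n * k.+1).-1)%N.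
    by have := ltn_expl n (ltnSn 1); move: (2 ^ n)%N; clear; nia.
  have km : (k.+1 <= 2 ^ n * k.+1)%N by rewrite leq_pmull// expn_gt0.
  exists n; move: (2 ^ n * k.+1)%N nk km => m nm km.
  have xd : x m <= del / C by exact: le_trans (Tle _ _ nm) Tn.
  have m0 : (0 < m)%N by exact: leq_trans km.
  split; first by rewrite (le_trans xd)// ler_pdivrMr// ler_peMr// ltW.
  move: xd; rewrite ler_pdivlMr//; apply: le_trans.
  apply: (@le_trans _ _ ((x m - x (2 * m)%N) * C)); last first.
    by rewrite ler_wpM2r ?(ltW C0)// gerBl T0.
  rewrite xE// mulr_suml; apply: (@le_trans _ _ (\sum_(m <= i < 2 * m) f m)).
    rewrite big_const_nat iter_addr addr0 /euler mulr_natl.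
    by rewrite (_ : 2 * m - m = m)%N//; clear; lia.
  rewrite !big_nat; apply: ler_sum => i /andP[mi im].
  have Nm : (N2 <= m)%N.
    by rewrite (leq_trans _ km)// (leq_trans _ (leqW Nk))// leq_addl.
  by rewrite mulrC; have [] := H2 m i Nm; rewrite ?mi ?(ltnW im).
rewrite -[tail f k]/(x k.+1).
move: (x k.+1) (T0 k : 0 <= x k.+1) iter => X X0 iter.
have ef : 0 <= euler f k.+1 by rewrite mulr_ge0.
have up : X <= (1 + eta) * euler f k.+1.
  apply/ler_addgt0Pr => del del0; have [i [h1 h2]] := small _ del0.
  have /andP[_ h3] := iter i.
  have : 0 <= (1 + eta) * euler f (2 ^ i * k.+1) by rewrite mulr_ge0 ?mulr_ge0//; lra.
  lra.
have lo : (1 - eta) * euler f k.+1 <= X.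
  apply/ler_addgt0Pr => del del0; have [i [h1 h2]] := small _ del0.
  have /andP[h3 _] := iter i.
  have x0 : 0 <= x (2 ^ i * k.+1)%N by exact: T0.
  have : eta * euler f (2 ^ i * k.+1) >= 0 by rewrite mulr_ge0 ?mulr_ge0// ltW.
  lra.
have h1 : eta * euler f k.+1 <= eps * X.
  apply: (@le_trans _ _ (2 * eta * X)); last by rewrite ler_wpM2r.
  rewrite [2 * _]mulrC -mulrA ler_wpM2l ?(ltW eta0)//.
  have : 1 / 2 * euler f k.+1 <= (1 - eta) * euler f k.+1 by rewrite ler_wpM2r//; lra.
  lra.
by rewrite ler_distl; apply/andP; split; lra.
Qed.

End CriticalIndex.

(** * Renewal sequences with small truncated moment *)

(** What the final convolution argument requires of a renewal sequence: positive,
    long-tailed, and without sudden drops. *)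
Record regular_decay (R : realType) (a : nat -> R) : Prop := RegularDecay {
  rd_gt0 : exists N, forall n, (N <= n)%N -> 0 < a n;
  rd_step : forall eps : R, 0 < eps -> exists N, forall n, (N <= n)%N ->
    `|a n.+1 - a n| <= eps * a n;
  rd_dominated : exists (C : R) N, forall k n, (N <= k)%N -> (k <= n <= 2 * k)%N ->
    a k <= C * a n }.

Section SmallTruncatedMoment.
Variables (R : realType) (f a : nat -> R) (s : R).
Hypotheses (fa : renewal_pair f a) (fs : reg_var f s) (s_ge0 : 0 <= s).
Let f_ge0 := rp_ge0 fa.
Let a_ge0 := ren_ge0 fa.
Local Notation A := (psum a).
Local Notation e := (euler f).
Local Notation h := (conv a a).

Let A_ge0 n : 0 <= A n. Proof. exact: psum_ge0. Qed.
Let h_ge0 n : 0 <= h n. Proof. exact: conv_ge0. Qed.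
Let e_ge0 n : 0 <= e n. Proof. by rewrite mulr_ge0. Qed.

(** The doubling bound, three times. *)
Lemma psum_ren_octuple m n : (n <= 8 * m)%N -> A n <= 64 * A m.
Proof.
move=> nm; have h1 := psum_double fa m.
have h2 := psum_double fa (2 * m); have h3 := psum_double fa (2 * (2 * m)).
have h4 : A n <= A (2 * (2 * (2 * m))).
  by apply: psum_le => //; move: nm; clear; lia.
lra.
Qed.

Lemma psum_conv_self n : psum h n = conv a A n.
Proof. by rewrite -!conv_ones convA. Qed.

Lemma psum_conv_self_le n : psum h n <= A n ^+ 2.
Proof.
rewrite psum_conv_self expr2 [in leRHS]/psum mulr_suml; apply: ler_sum => i _.
by rewrite ler_wpM2l// psum_le// leq_subr.
Qed.

(** Pairs of indices at most [p] have sum at most [2 * p]. *)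
Lemma psum_conv_self_ge p : A p ^+ 2 <= psum h (2 * p).
Proof.
rewrite psum_conv_self convE (@big_cat_nat _ _ _ p.+1)//=; last by clear; lia.
rewrite -[leLHS]addr0 lerD//; last first.
  by apply: sumr_ge0 => i _; rewrite mulr_ge0.
rewrite expr2 [X in X * _]psumE mulr_suml !big_nat.
apply: ler_sum => i /andP[_ ip]; rewrite ler_wpM2l// psum_le//.
by move: ip; clear; lia.
Qed.

(** In each product [a i * a (j - i)] one of the indices is at least [j / 2]. *)
Lemma conv_self_le (M : R) j : (forall i, (uphalf j <= i <= j)%N -> a i <= M) ->
  h j <= 2 * A j * M.
Proof.
move=> aM; have AE : A j = \sum_(i < j.+1) a (j - i)%N.
  rewrite -conv_ones convC /conv; apply: eq_bigr => i _; exact: mul1r.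
have -> : 2 * A j * M = \sum_(i < j.+1) (a i * M + a (j - i)%N * M).
  by rewrite big_split/= -!mulr_suml -AE -/(psum a j); ring.
apply: ler_sum => i _; have ij : (i <= j)%N by rewrite -ltnS.
have M0 : 0 <= M by apply: le_trans (aM j _) => //; rewrite leqnn andbT; clear; lia.
have [ji|ji] := leqP (uphalf j) i.
  have : a i <= M by apply: aM; rewrite ji.
  move=> /(ler_wpM2r (a_ge0 (j - i))); have := mulr_ge0 (a_ge0 i) M0; lra.
have : a (j - i)%N <= M by apply: aM; rewrite leq_subr andbT; move: ji ij; clear; lia.
move=> /(ler_wpM2l (a_ge0 i)); have := mulr_ge0 (a_ge0 (j - i)%N) M0; lra.
Qed.

(** The expected order of magnitude of [a]. *)
Let g n : R := f n * A n ^+ 2.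

(** In [euler_ren], keep the indices of [h] up to [n / 2]: there [euler f] is of
    the order of [n * f n], and the sum of [h] of the order of [A n ^ 2]. *)
Lemma ren_lower : exists c N, 0 < c /\ forall n, (N <= n)%N -> c * g n <= a n.
Proof.
have [C [N [C1 N0 HC]]] := reg_var_bounded fs s_ge0 2.
have C0 : 0 < C by lra.
exists (2 * C * 64 ^+ 2)^-1, (2 * N + 8)%N; split; first by rewrite invr_gt0 !mulr_gt0 ?exprn_gt0.
move=> n Nn; have n0 : 0 < n%:R :> R by rewrite ltr0n; move: Nn; clear; lia.
rewrite -(ler_pM2l n0) -[leRHS]/(euler a n) (euler_ren fa) convC convE.
set p := (n %/ 4)%N; have pn : (2 * (2 * p) <= n)%N by rewrite /p; clear; lia.
have np : (n <= 8 * p)%N by rewrite /p; move: Nn; clear; lia.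
rewrite (@big_cat_nat _ _ _ (2 * p).+1)//=; last by move: pn; clear; lia.
rewrite -[leLHS]addr0 lerD//; last by apply: sumr_ge0 => i _; rewrite mulr_ge0.
apply: (@le_trans _ _ (\sum_(0 <= i < (2 * p).+1) h i * (n%:R * f n / (2 * C)))); last first.
  rewrite !big_nat; apply: ler_sum => i /andP[_ ip]; rewrite ler_wpM2l//.
  have ni : (n <= 2 * (n - i))%N by move: ip pn; clear; lia.
  have Nni : (N <= n - i)%N by move: ip pn Nn; clear; lia.
  have [fn _] := HC _ n Nni (introT andP (conj (leq_subr _ _) ni)).
  rewrite ler_pdivrMr ?mulr_gt0// /euler.
  have -> : (n - i)%:R * f (n - i)%N * (2 * C) = (2 * (n - i))%:R * (C * f (n - i)%N).
    by rewrite natrM; ring.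
  by apply: ler_pM => //; rewrite ler_nat.
have fnC : 0 <= n%:R * f n / (2 * C) by rewrite divr_ge0 ?mulr_ge0// ltW.
rewrite -mulr_suml -psumE.
apply: (@le_trans _ _ (A p ^+ 2 * (n%:R * f n / (2 * C)))); last first.
  by rewrite ler_wpM2r// psum_conv_self_ge.
have AA : A n ^+ 2 <= 64 ^+ 2 * A p ^+ 2.
  by rewrite -exprMn lerXn2r ?nnegrE ?mulr_ge0// psum_ren_octuple.
have -> : n%:R * ((2 * C * 64 ^+ 2)^-1 * g n) = A n ^+ 2 / 64 ^+ 2 * (n%:R * f n / (2 * C)).
  by rewrite /g; field; rewrite gt_eqF.
by rewrite ler_wpM2r// ler_pdivrMr ?exprn_gt0// mulrC.
Qed.

Lemma ren_profile_le (L : nat) : exists C N, [/\ 1 <= C, (0 < N)%N & forall i n, (N <= i)%N ->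
  (i <= n <= L * i)%N -> f i <= C * f n /\ g i <= C * g n].
Proof.
have [C [N [C1 N0 HC]]] := reg_var_bounded fs s_ge0 L.
exists C, N; split => // i n Ni /andP[iN ni].
have [|_ h1] := HC i n Ni; first by rewrite iN ni.
split => //; rewrite /g [leRHS]mulrA; apply: ler_pM => //; first exact: exprn_ge0.
by rewrite lerXn2r ?nnegrE// psum_le.
Qed.

(** Jumps much shorter than [n] contribute little to [n * a n]. *)
Hypothesis small_moment : forall eps : R, 0 < eps -> exists L N, (0 < L)%N /\
  forall n, (N <= n)%N -> A n * psum e (n %/ L) <= eps * n%:R.

Lemma conv_self_profile_le (M : R) n k : (0 < k)%N -> (2 * k <= n)%N ->
  (forall i, (n <= 4 * i)%N -> (i < n)%N -> a i <= M) -> h (n - k) <= 2 * A n * M.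
Proof.
move=> k0 kn aM; have M0 : 0 <= M.
  by apply: (le_trans (a_ge0 n.-1)); apply: aM; move: k0 kn; clear; lia.
apply: (@le_trans _ _ (2 * A (n - k) * M)).
  apply: conv_self_le => i /andP[i1 i2]; apply: aM.
    by move: i1 kn; clear; lia.
  by move: i2 k0 kn; clear; lia.
by rewrite ler_wpM2r// ler_wpM2l// psum_le// leq_subr.
Qed.

(** Strong induction with the bound [a <= K * g].  In [euler_ren] the indices
    [k <= n / L] are controlled by values of [a] at indices in [[n / 4, n[], and by
    [small_moment] they contribute at most half of the bound; for the other
    indices [euler f] is of the order of [n * f n], which gives the order of [g]
    with a constant independent of [K]. *)
Lemma ren_upper : exists (K : R) N, forall n, (N <= n)%N -> a n <= K * g n.
Proof.
have [C4 [N1 [C41 N10 H4]]] := ren_profile_le 4.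
have eps0 : 0 < (4 * C4)^-1 by rewrite invr_gt0; lra.
have [L0 [N2 [L00 H2]]] := small_moment eps0.
pose L := (2 * L0)%N.
have [C [N3 [C1 N30 H3]]] := ren_profile_le L.
have [N4 H4'] := reg_var_gt0 fs.
pose N0 := (N1 + N4 + 1)%N; pose N := (4 * N0 + N2 + L * N3)%N.
have g0 n : (N0 <= n)%N -> 0 < g n.
  rewrite /N0 => Nn; rewrite mulr_gt0 ?exprn_gt0//.
    by apply: H4'; move: Nn; clear; lia.
  by rewrite (lt_le_trans ltr01)// (ren_psum_ge1 fa).
(* [K0] takes care of the indices below [N]; [2 * C] is twice the constant
   given by the long jumps. *)
pose K0 := \sum_(i < N) `|a i / g i|; pose K := K0 + 2 * C.
have K00 : 0 <= K0 by apply: sumr_ge0.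
exists K, N0; elim/ltn_ind => n IH Nn.
have [nN|nN] := ltnP n N.
  rewrite -ler_pdivrMr ?g0// (le_trans (ler_norm _))// /K0.
  rewrite /K /K0 (bigD1 (Ordinal nN))//= -addrA lerDl addr_ge0//; last lra.
  by apply: sumr_ge0.
have n0 : 0 < n%:R :> R by rewrite ltr0n (leq_trans _ Nn)// /N0 addn1.
have fn0 := f_ge0 n; have gn0 := g0 n Nn.
have Kg : 0 <= K * g n by rewrite mulr_ge0 ?ltW// /K; lra.
have aM i : (n <= 4 * i)%N -> (i < n)%N -> a i <= K * (C4 * g n).
  move=> n4 iN; have N0i : (N0 <= i)%N by move: nN n4; rewrite /N; clear; lia.
  apply: (le_trans (IH i iN N0i)); rewrite ler_wpM2l//; first by rewrite /K; lra.
  have [||_] // := H4 i n; last by rewrite (ltnW iN).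
  by move: N0i; rewrite /N0; clear; lia.
rewrite -(ler_pM2l n0) -[leLHS]/(euler a n) (euler_ren fa) convE.
have mn : ((n %/ L).+1 <= n.+1)%N by rewrite ltnS leq_div.
rewrite (@big_cat_nat _ _ _ (n %/ L).+1)//=.
have part1 : \sum_(0 <= i < (n %/ L).+1) e i * h (n - i)%N <= n%:R * (K * g n) / 2.
  apply: (@le_trans _ _ (\sum_(0 <= i < (n %/ L).+1) e i * (2 * A n * (K * (C4 * g n))))).
    rewrite !big_nat; apply: ler_sum => -[|i] /andP[_ iN].
      by rewrite /euler !mul0r.
    rewrite ler_wpM2l// conv_self_profile_le//.
    rewrite ltnS in iN; rewrite (leq_trans _ (leq_trunc_div n L))//.
    by rewrite mulnC leq_mul// /L; move: L00; clear; lia.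
  rewrite -mulr_suml -psumE.
  have := H2 n _; rewrite (_ : (N2 <= n)%N); last by move: nN; rewrite /N; clear; lia.
  move=> /(_ isT) h1.
  have h2 : A n * psum e (n %/ L) <= (4 * C4)^-1 * n%:R.
    apply: le_trans h1; rewrite ler_wpM2l// psum_le// leq_div2l//.
    by rewrite /L; move: L00; clear; lia.
  have := ler_wpM2r (_ : 0 <= 2 * C4 * (K * g n)) h2.
  have -> : (4 * C4)^-1 * n%:R * (2 * C4 * (K * g n)) = n%:R * (K * g n) / 2.
    by field; rewrite gt_eqF; lra.
  have -> : A n * psum e (n %/ L) * (2 * C4 * (K * g n)) =
    psum e (n %/ L) * (2 * A n * (K * (C4 * g n))) by ring.
  by apply; rewrite mulr_ge0//; lra.
have part2 : \sum_((n %/ L).+1 <= i < n.+1) e i * h (n - i)%N <= n%:R * (C * g n).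
  apply: (@le_trans _ _ (\sum_((n %/ L).+1 <= i < n.+1) n%:R * (C * f n) * h (n - i)%N)).
    rewrite !big_nat; apply: ler_sum => i /andP[iL iN]; rewrite ler_wpM2r//.
    have L0' : (0 < L)%N by rewrite /L; move: L00; clear; lia.
    have N3i : (N3 <= i)%N.
      rewrite (leq_trans _ (ltnW iL))// leq_divRL// mulnC.
      by move: nN; rewrite /N; clear; lia.
    have nLi : (n <= L * i)%N by rewrite mulnC ltnW// -ltn_divLR.
    have [||h1 _] // := H3 i n; first by rewrite nLi -ltnS iN.
    by rewrite /euler; apply: ler_pM => //; rewrite ler_nat -ltnS.
  rewrite -mulr_sumr /g.
  have -> : n%:R * (C * (f n * A n ^+ 2)) = n%:R * (C * f n) * A n ^+ 2 by ring.
  rewrite ler_wpM2l//; first by rewrite mulr_ge0 ?mulr_ge0//; lra.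
  apply: le_trans (psum_conv_self_le n).
  have -> : psum h n = \sum_(0 <= i < n.+1) h (n - i)%N.
    rewrite -conv_ones convC convE; apply: eq_bigr => i _; exact: mul1r.
  rewrite [leRHS](@big_cat_nat _ _ _ (n %/ L).+1)//= lerDr.
  by apply: sumr_ge0.
have : n%:R * (2 * C * g n) <= n%:R * (K * g n).
  by rewrite !ler_wpM2l ?(ltW n0)// ler_wpM2r ?(ltW gn0)// /K; lra.
lra.
Qed.

Lemma ren_dominated : exists (C : R) N, forall k n, (N <= k)%N ->
  (k <= n <= 4 * k)%N -> a k <= C * a n.
Proof.
have [c [N1 [c0 H1]]] := ren_lower; have [K [N2 H2]] := ren_upper.
have [C [N3 [C1 N30 H3]]] := ren_profile_le 4.
exists (`|K| * C / c), (N1 + N2 + N3)%N => k n Nk kn.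
have [k1 k2 k3] : [/\ (N1 <= n)%N, (N2 <= k)%N & (N3 <= k)%N].
  by move: Nk kn; clear; split; lia.
have g0 i : 0 <= g i by rewrite mulr_ge0// exprn_ge0.
apply: (le_trans (H2 k k2)); apply: (@le_trans _ _ (`|K| * g k)).
  by rewrite ler_wpM2r// ler_norm.
rewrite -!mulrA ler_wpM2l//; have [_ h] := H3 k n k3 kn.
apply: (le_trans h); rewrite ler_wpM2l//; first lra.
by rewrite mulrC ler_pdivlMr// mulrC H1.
Qed.

Lemma psum_ren_small (eps : R) : 0 < eps -> exists N, forall n, (N <= n)%N ->
  A n <= eps * n%:R.
Proof.
move=> eps0; have [N1 fpos] := reg_var_gt0 fs.
have e0 : 0 < e N1.+1 by rewrite mulr_gt0 ?ltr0n// fpos.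
have [L [N [L0 HN]]] := small_moment (mulr_gt0 eps0 e0).
exists (N + L * N1.+1)%N => n Nn.
have Ln : (N1.+1 <= n %/ L)%N by rewrite leq_divRL// mulnC (leq_trans (leq_addl _ _) Nn).
rewrite -(ler_pM2r e0) mulrAC; apply: le_trans (HN n (leq_trans (leq_addr _ _) Nn)).
rewrite ler_wpM2l//; apply: le_trans (psum_le e_ge0 Ln).
by rewrite psumS lerDr psum_ge0.
Qed.

(** The increment of [n * a n] is obtained from [euler_ren] by replacing
    [euler f] with its increments, which are relatively small beyond some index
    [K]; the finitely many other terms are of the order of [A n * a n], which is
    negligible before [n * a n]. *)
Lemma small_moment_regular_decay : regular_decay a.
Proof.
have [C [N1 H1]] := ren_dominated.
split.
- have [c [N2 [c0 H2]]] := ren_lower; have [N3 H3] := reg_var_gt0 fs.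
  exists (N2 + N3)%N => n Nn.
  apply: lt_le_trans (H2 n (leq_trans (leq_addr _ _) Nn)).
  rewrite mulr_gt0// mulr_gt0 ?exprn_gt0//; first exact/H3/(leq_trans (leq_addl _ _) Nn).
  by rewrite (lt_le_trans ltr01)// (ren_psum_ge1 fa).
- move=> eps eps0; have eps4 : 0 < eps / 4 by rewrite divr_gt0.
  have [K HK] := euler_step_small f_ge0 fs s_ge0 eps4.
  pose D : R := \sum_(0 <= k < K) `|e k.+1 - e k|.
  have D0 : 0 <= D by apply: sumr_ge0.
  have eta0 : 0 < eps / (8 * (D + 1) * (`|C| + 1)).
    by rewrite divr_gt0// !mulr_gt0// ltr_pwDr.
  have [N2 H2] := psum_ren_small eta0.
  have [N3 H3] := natr_large (4 / eps).
  exists (N1 * 4 + N2 + N3 + 2 * K.+1)%N => n Nn.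
  have [n1 n2 n3 n4 n5] : [/\ (N1 * 4 <= n)%N, (N2 <= n)%N, (N3 <= n)%N, (2 * K <= n)%N & (0 < n)%N].
    by move: Nn; clear; split; lia.
  have n0 : 0 < n%:R :> R by rewrite ltr0n.
  have an := a_ge0 n.
  have diff : `|n.+1%:R * a n.+1 - n%:R * a n| <= eps / 2 * n%:R * a n.
    have -> : n.+1%:R * a n.+1 - n%:R * a n =
        \sum_(0 <= k < n.+1) (e k.+1 - e k) * h (n - k)%N.
      rewrite -[n.+1%:R * _]/(euler a n.+1) -[n%:R * _]/(euler a n) (euler_ren fa).
      rewrite !convE big_nat_recl// {1}/euler !mul0r add0r -sumrB.
      by apply: eq_bigr => i _; rewrite subSS mulrBl.
    apply: (le_trans (ler_norm_sum _ _ _)).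
    have Kn : (K <= n.+1)%N by move: n4; clear; lia.
    rewrite (@big_cat_nat _ _ _ K)//=.
    have p1 : \sum_(0 <= k < K) `|(e k.+1 - e k) * h (n - k)%N| <= eps / 4 * n%:R * a n.
      apply: (@le_trans _ _ (\sum_(0 <= k < K) `|e k.+1 - e k| * (2 * A n * (`|C| * a n)))).
        rewrite !big_nat; apply: ler_sum => k /andP[_ kK].
        rewrite normrM (ger0_norm (h_ge0 _)) ler_wpM2l//.
        apply: (@le_trans _ _ (2 * A (n - k) * (`|C| * a n))).
          apply: conv_self_le => i /andP[i1 i2].
          apply: (@le_trans _ _ (C * a n)); last by rewrite ler_wpM2r// ler_norm.
          by apply: H1; [move: i1 n1 n4 kK | move: i1 i2 n4 kK]; clear; lia.
        by rewrite ler_wpM2r ?mulr_ge0// ler_wpM2l// psum_le// leq_subr.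
      rewrite -mulr_suml -/D.
      have := H2 n n2; move: (A n) (A_ge0 n) => An An0 hA.
      apply: (@le_trans _ _ ((D + 1) * (2 * An * ((`|C| + 1) * a n)))).
        apply: ler_pM; rewrite ?mulr_ge0 ?lerDl//.
        by rewrite ler_wpM2l ?mulr_ge0// ler_wpM2r// lerDl.
      have -> : (D + 1) * (2 * An * ((`|C| + 1) * a n)) = 2 * (D + 1) * (`|C| + 1) * a n * An.
        by ring.
      apply: (@le_trans _ _ (2 * (D + 1) * (`|C| + 1) * a n *
          (eps / (8 * (D + 1) * (`|C| + 1)) * n%:R))).
        by rewrite ler_wpM2l// !mulr_ge0// addr_ge0.
      rewrite le_eqVlt; apply/orP; left; apply/eqP.
      have : 0 < D + 1 by rewrite ltr_pwDr.
      have : 0 < `|C| + 1 by rewrite ltr_pwDr.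
      move: (D + 1) (`|C| + 1) => u v v0 u0; field.
      by rewrite !gt_eqF.
    have p2 : \sum_(K <= k < n.+1) `|(e k.+1 - e k) * h (n - k)%N| <= eps / 4 * n%:R * a n.
      rewrite -mulrA -[n%:R * _]/(euler a n) (euler_ren fa) convE mulr_sumr.
      rewrite [leRHS](@big_cat_nat _ _ _ K)//= -[leLHS]add0r lerD//.
        by apply: sumr_ge0 => i _; apply: mulr_ge0; [exact: ltW | exact: mulr_ge0].
      rewrite !big_nat; apply: ler_sum => k /andP[Kk _].
      rewrite normrM (ger0_norm (h_ge0 _)) mulrA ler_wpM2r//.
      exact: HK.
    have -> : eps / 2 * n%:R * a n = eps / 4 * n%:R * a n + eps / 4 * n%:R * a n by field.
    exact: lerD.
  have n10 : 0 < n.+1%:R :> R by rewrite ltr0n.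
  rewrite -(ler_pM2l n10) -[X in X * `|_|](gtr0_norm n10) -normrM.
  have -> : n.+1%:R * (a n.+1 - a n) = (n.+1%:R * a n.+1 - n%:R * a n) - a n.
    by rewrite -natr1; ring.
  apply: (le_trans (ler_normB _ _)); rewrite (ger0_norm an).
  apply: (@le_trans _ _ (eps / 2 * n%:R * a n + eps / 4 * n%:R * a n)).
    apply: lerD => //; rewrite ler_peMl//.
    have := H3 n n3; rewrite ler_pdivrMr// mulrC => ?; lra.
  have : 0 <= eps * n%:R * a n by rewrite !mulr_ge0// ltW.
  have : 0 <= eps * a n by rewrite !mulr_ge0// ltW.
  have -> : n.+1%:R * (eps * a n) = eps * n%:R * a n + eps * a n by rewrite -natr1; ring.
  lra.
- exists C, N1 => k n Nk /andP[kn nk]; apply: H1 => //; rewrite kn (leq_trans nk)//.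
  by rewrite leq_mul2r orbT.
Qed.

End SmallTruncatedMoment.

(** * Recurrent renewal sequences with infinite mean and exponent 2 *)

Section Differences.
Variable R : realType.
Implicit Types x y : nat -> R.

(** Multiplication of the generating series by [1 - z]. *)
Definition diffs x : nat -> R := fun n => x n - (if n is k.+1 then x k else 0).

Lemma diffsS x n : diffs x n.+1 = x n.+1 - x n. Proof. by []. Qed.

Lemma psum_diffs x : psum (diffs x) = x.
Proof.
apply/funext; elim=> [|n IH]; first by rewrite psum0 /diffs subr0.
by rewrite psumS IH diffsS addrC subrK.
Qed.

Lemma diffs_psum x : diffs (psum x) = x.
Proof.
apply/funext => -[|n]; first by rewrite /diffs subr0 psum0.
by rewrite diffsS psumS addrAC subrr add0r.
Qed.

Lemma diffs_conv x y : diffs (conv x y) = conv (diffs x) y.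
Proof.
by rewrite -{1}(psum_diffs x) -conv_ones convC convA conv_ones diffs_psum convC.
Qed.

Lemma diffs_ones : diffs (ones R) = delta0 R.
Proof. by apply/funext => -[|n]; rewrite /diffs /ones /delta0 ?subr0 ?subrr. Qed.

(** Summation by parts: afterwards [diffs x] is only evaluated at large indices. *)
Lemma abel_half x n p : (p <= n)%N ->
  \sum_(0 <= j < p.+1) diffs x j * x (n - j)%N =
  x p * x (n - p)%N + \sum_(0 <= j < p) x j * diffs x (n - j)%N.
Proof.
elim: p => [_|p IH pn]; first by rewrite big_nat1 big_geq// addr0 /diffs subr0.
rewrite big_nat_recr//= IH 1?ltnW// [in RHS]big_nat_recr//= diffsS.
rewrite -(subnSK pn) diffsS; ring.
Qed.

End Differences.

Section InfiniteMeanCritical.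
Variables (R : realType) (f a : nat -> R).
Hypothesis fa : renewal_pair f a.
Hypothesis tail_equiv : forall eps : R, 0 < eps -> exists N, forall k, (N <= k)%N ->
  `|tail f k - euler f k.+1| <= eps * tail f k.
Hypothesis tmean_infty : forall M : R, exists n, M <= tmean f n.

Local Notation m := (tmean f).
Local Notation d := (diffs a).
Local Notation A := (psum a).
(** Since [k * f k] is close to the tail, [c] is small: [c k] is negligible before
    [tail f k.-1]. *)
Let c := diffs (euler (tail f)).
(** The increments of [a * a], by [diffs_conv]. *)
Let E := conv d a.
Let a_ge0 := ren_ge0 fa.
Let t_ge0 := tail_ge0 fa.
Let m_gt0 := tmean_gt0 fa.

Let cS k : c k.+1 = tail f k - euler f k.+1.
Proof.
rewrite /c diffsS /euler -!natr1 /tail psumS; ring.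
Qed.

Let c0 : c 0%N = 0. Proof. by rewrite /c /diffs /euler mul0r subr0. Qed.

(** Differentiating the identity [D(z) T(z) = 1] between the generating series of
    [d] and of [tail f], and multiplying by [D(z)]: since [E] is [d * a], the
    factor [D(z)^2] is that of [E] times [1 - z], which is moved to the other
    factor. *)
Lemma euler_diffs_ren : euler d = \- conv c E.
Proof.
have dt : conv d (tail f) = delta0 R.
  by rewrite -diffs_ones -(conv_ren_tail fa) diffs_conv.
have h : conv (euler d) (tail f) = \- conv d (euler (tail f)).
  have := euler_conv d (tail f); rewrite dt => h.
  apply/funext => n /=; have := congr1 (fun x => x n) h => /= /esym/eqP.
  rewrite {1}/euler /delta0 => /eqP hn; apply/eqP; rewrite -addr_eq0 hn.
  by rewrite /euler; case: n {hn} => [|n]; rewrite ?mul0r//= mulr0.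
have -> : euler d = conv d (conv (euler d) (tail f)).
  by rewrite [conv (euler d) _]convC convA dt conv_delta0.
rewrite h convNr; congr (\- _).
rewrite -{1}(psum_diffs (euler (tail f))) -conv_ones -/c [conv c _]convC.
by rewrite [conv d (conv (ones R) c)]convA conv_ones psum_diffs convA [RHS]convC.
Qed.

(** The bootstrap hypothesis on the differences up to [n]. *)
Definition diffs_bounded (B : R) (n : nat) :=
  forall j, (1 <= j <= n)%N -> `|d j| * (j%:R * m j) <= B.

Lemma diffs_bounded_near B n j : diffs_bounded B n -> 0 <= B -> (0 < j <= n)%N ->
  (n <= 2 * j)%N -> `|d j| <= 4 * B / (n%:R * m n).
Proof.
move=> Bn B0 /andP[j0 jn] nj.
have j0R : 0 < j%:R :> R by rewrite ltr0n.
have n0R : 0 < n%:R :> R by rewrite ltr0n (leq_trans j0).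
have dB := Bn j; rewrite j0 jn in dB; have {}dB := dB isT.
have njR : n%:R <= 2 * j%:R :> R by rewrite -natrM ler_nat.
have mnj : m n <= 2 * m j by apply: (tmean_double fa); exact: leqW.
rewrite ler_pdivlMr ?mulr_gt0//.
apply: (@le_trans _ _ (`|d j| * ((2 * j%:R) * (2 * m j)))).
  by rewrite ler_wpM2l// ler_pM// ltW.
lra.
Qed.

(** With increments bounded by [B / (n * m n)], it takes a number [X] of steps, of
    the order of [a n * n * m n / B], to halve [a n].  These steps contribute at
    least [X * a n / 2] to [A n], itself of the order of [n / m n]; whence the
    bound on [(a n * m n) ^ 2].  It is linear in [B], not quadratic, which is
    what lets the bootstrap close. *)
Lemma ren_sq_bound B n : 1 <= B -> diffs_bounded B n -> (a n * m n) ^+ 2 <= 144 * B.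
Proof.
case: n => [B1 _|n B1 Bn].
  by rewrite (ren0 fa) mul1r /tmean psum0 (tail0 fa) expr1n; lra.
set q := n.+1 in Bn *; set x := a q; set v := m q.
have q0 : 0 < q%:R :> R by rewrite ltr0n.
have v0 : 0 < v by exact: m_gt0.
have x0 : 0 <= x by exact: a_ge0.
have [xv|xv] := leP (x * v) 12.
  have : (x * v) ^+ 2 <= 12 ^+ 2 by rewrite lerXn2r ?nnegrE// mulr_ge0// ltW.
  lra.
have xp : 0 < x by rewrite -(pmulr_lgt0 _ v0) (lt_trans _ xv).
pose X := x * (q%:R * v) / (8 * B).
have X0 : 0 <= X by rewrite divr_ge0 ?mulr_ge0 ?ltW//; lra.
(* As long as i <= X, the increments seen so far cannot halve a. *)
have near i : (i <= q./2)%N -> i%:R <= X -> x / 2 <= a (q - i)%N.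
  move=> iq iX.
  have : `|a q - a (q - i)%N| <= i%:R * (4 * B / (q%:R * v)).
    elim: i iq {iX} => [|i IH] iq; first by rewrite subn0 subrr normr0 mul0r.
    have h := IH (ltnW iq).
    have -> : a q - a (q - i.+1)%N = (a q - a (q - i)%N) + d (q - i)%N.
      have E2 : (q - i = (q - i.+1).+1)%N by move: iq; rewrite /q; clear; lia.
      by rewrite E2 diffsS; ring.
    apply: (le_trans (ler_normD _ _)); rewrite -natr1 mulrDl mul1r lerD//.
    apply: diffs_bounded_near => //; first lra.
      by move: iq; rewrite /q; clear; lia.
    by move: iq; rewrite /q; clear; lia.
  have : i%:R * (4 * B / (q%:R * v)) <= X * (4 * B / (q%:R * v)).
    by rewrite ler_wpM2r// divr_ge0 ?mulr_ge0 ?ltW//; lra.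
  have -> : X * (4 * B / (q%:R * v)) = x / 2.
    by rewrite /X; field; rewrite !gt_eqF//; lra.
  rewrite -/x => h1 h2; have := le_trans h2 h1; rewrite ler_norml => /andP[_].
  lra.
have Aq : A q * v <= 3 * q%:R.
  apply: (le_trans (psum_tmean_le fa q)); rewrite -natrM ler_nat.
  by rewrite /q; clear; lia.
have mass t : (t <= q./2)%N -> t%:R <= X -> t.+1%:R * (x / 2) <= A q.
  move=> tq tX.
  have -> : A q = \sum_(0 <= i < q.+1) a (q - i)%N.
    rewrite -conv_ones convC convE; apply: eq_bigr => i _; exact: mul1r.
  rewrite (@big_cat_nat _ _ _ t.+1)//=; last by move: tq; clear; lia.
  rewrite -[leLHS]addr0 lerD//; last by apply: sumr_ge0.
  have -> : t.+1%:R * (x / 2) = \sum_(0 <= i < t.+1) (x / 2).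
    by rewrite big_const_nat iter_addr addr0 subn0 [LHS]mulr_natl.
  rewrite !big_nat; apply: ler_sum => i /andP[_]; rewrite ltnS => it.
  by apply: near; [exact: leq_trans tq | rewrite (le_trans _ tX)// ler_nat].
have [Xq|Xq] := leqP (Num.truncn X) q./2.
  have := mass _ Xq; rewrite truncn_le X0 => /(_ isT) h.
  have XS : X <= (Num.truncn X).+1%:R by rewrite ltW// truncnS_gt.
  have : X * (x / 2) * v <= 3 * q%:R.
    apply: le_trans Aq; rewrite ler_wpM2r ?(ltW v0)//; apply: le_trans h.
    by rewrite ler_wpM2r//; lra.
  rewrite /X => h3.
  have : (x * v) ^+ 2 * q%:R <= 48 * B * q%:R.
    have -> : (x * v) ^+ 2 * q%:R = x * (q%:R * v) / (8 * B) * (x / 2) * v * (16 * B).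
      by field; rewrite gt_eqF; lra.
    have -> : 48 * B * q%:R = 3 * q%:R * (16 * B) by ring.
    by rewrite ler_wpM2r//; lra.
  rewrite ler_pM2r//; lra.
have := mass _ (leqnn _); have qX : (q./2)%:R <= X.
  by rewrite -truncn_ge_nat// ltnW.
move=> /(_ qX) h.
have q2 : q%:R <= 2 * (q./2).+1%:R :> R.
  by rewrite -natrM ler_nat /q; clear; lia.
have : q%:R / 2 * (x / 2) * v <= 3 * q%:R.
  apply: le_trans Aq; rewrite ler_wpM2r ?(ltW v0)//; apply: le_trans h.
  by rewrite ler_wpM2r//; lra.
have -> : q%:R / 2 * (x / 2) * v = q%:R * (x * v / 4) by field.
rewrite [3 * _]mulrC ler_pM2l//; lra.
Qed.

(** After summation by parts, [E n] is the product [a p * a (n - p)], bounded by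
    [ren_sq_bound], plus sums in which the differences have index at least
    [n / 2], bounded by [A n * B / (n * m n)]. *)
Lemma conv_diffs_bound : exists M : R, 0 < M /\
  forall B n, 1 <= B -> diffs_bounded B n -> `|E n| * m n ^+ 2 <= M * B.
Proof.
exists 600; split; first by rewrite ltr0n.
move=> B n B1 Bn; case: n Bn => [|n'] Bn.
  rewrite /E /conv big_ord1 /diffs subr0 (ren0 fa) mul1r normr1 mul1r.
  by rewrite /tmean psum0 (tail0 fa) expr1n; lra.
set n := n'.+1 in Bn *; pose p := n./2.
have n0 : 0 < n%:R :> R by rewrite ltr0n.
have mn0 := m_gt0 n.
have pn : (p <= n)%N by rewrite /p; clear; lia.
have EE : E n = a p * a (n - p)%N + \sum_(0 <= j < p) a j * d (n - j)%N +
    \sum_(0 <= i < n - p) a i * d (n - i)%N.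
  rewrite -abel_half// /E convC convE (@big_cat_nat _ _ _ (n - p))//=; last first.
    by clear; lia.
  rewrite addrC; congr (_ + _).
  rewrite -{1}[(n - p)%N]add0n big_addn (_ : n.+1 - (n - p) = p.+1)%N; last first.
    by move: pn; clear; lia.
  rewrite big_nat_rev/= add0n !big_nat; apply: eq_bigr => i /andP[_ ip].
  rewrite mulrC; congr (d _ * a _); by move: ip pn; clear; lia.
have bulk k : (k <= n - p)%N -> `|\sum_(0 <= i < k) a i * d (n - i)%N| * m n ^+ 2 <= 12 * B.
  move=> kn; have [->|k0] := posnP k; first by rewrite big_geq// normr0 mul0r; lra.
  have h1 : `|\sum_(0 <= i < k) a i * d (n - i)%N| <= A n * (4 * B / (n%:R * m n)).
    apply: (le_trans (ler_norm_sum _ _ _)).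
    apply: (@le_trans _ _ (\sum_(0 <= i < k) a i * (4 * B / (n%:R * m n)))).
      rewrite !big_nat; apply: ler_sum => i /andP[_ ik].
      rewrite normrM (ger0_norm (a_ge0 _)) ler_wpM2l//.
      apply: diffs_bounded_near => //; first lra.
        by move: ik kn; rewrite /p; clear; lia.
      by move: ik kn; rewrite /p; clear; lia.
    rewrite -mulr_suml ler_wpM2r//; first by rewrite divr_ge0 ?mulr_ge0 ?ltW//; lra.
    rewrite -[k]prednK// -psumE psum_le//; by move: kn k0; clear; lia.
  have h2 := psum_tmean_le fa n.
  have h3 : (2 * n).+1%:R <= 3 * n%:R :> R by rewrite -natrM ler_nat /n; clear; lia.
  apply: (@le_trans _ _ (A n * (4 * B / (n%:R * m n)) * m n ^+ 2)).
    by rewrite ler_wpM2r// exprn_ge0// ltW.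
  have -> : A n * (4 * B / (n%:R * m n)) * m n ^+ 2 = A n * m n * (4 * B / n%:R).
    by field; rewrite !gt_eqF.
  apply: (@le_trans _ _ (3 * n%:R * (4 * B / n%:R))).
    rewrite ler_wpM2r//; last by lra.
    by rewrite divr_ge0 ?(ltW n0)//; lra.
  by rewrite le_eqVlt; apply/orP; left; apply/eqP; field; rewrite gt_eqF.
have sub k : (k <= n)%N -> diffs_bounded B k.
  by move=> kn j /andP[j1 jk]; apply: Bn; rewrite j1 (leq_trans jk).
have half k : (k <= n)%N -> (n <= (2 * k).+1)%N -> a k * m n <= 24 * B /\ (a k * m n) ^+ 2 <= 576 * B.
  move=> kn nk; have mk : m n <= 2 * m k by exact: (tmean_double fa).
  have h := ren_sq_bound B1 (sub k kn).
  have h2 : (a k * m n) ^+ 2 <= 576 * B.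
    apply: (@le_trans _ _ ((a k * (2 * m k)) ^+ 2)).
      by rewrite lerXn2r ?nnegrE ?mulr_ge0 ?ler_wpM2l// ltW.
    have -> : (a k * (2 * m k)) ^+ 2 = 4 * (a k * m k) ^+ 2 by ring.
    lra.
  split => //; rewrite -(ler_pXn2r (ltn0Sn 1)) ?nnegrE ?mulr_ge0 ?(ltW mn0)//; try lra.
  apply: (le_trans h2); rewrite exprMn; nra.
have [_ s1] : _ := half p pn ltac:(rewrite /p; clear; lia).
have [_ s2] : _ := half (n - p)%N (leq_subr _ _) ltac:(rewrite /p; clear; lia).
have aa : a p * a (n - p)%N * m n ^+ 2 <= 576 * B.
  have := sqr_ge0 (a p * m n - a (n - p)%N * m n).
  rewrite sqrrB mulr2n; have -> : a p * m n * (a (n - p)%N * m n) = a p * a (n - p)%N * m n ^+ 2 by ring.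
  lra.
have b1 := bulk (n - p)%N (leqnn _).
have b2 := bulk p ltac:(rewrite /p; clear; lia).
have m2 : 0 <= m n ^+ 2 by rewrite exprn_ge0// ltW.
rewrite EE; apply: (@le_trans _ _ ((a p * a (n - p)%N + `|\sum_(0 <= j < p) a j * d (n - j)%N| +
    `|\sum_(0 <= i < n - p) a i * d (n - i)%N|) * m n ^+ 2)).
  rewrite ler_wpM2r// (le_trans (ler_normD _ _))// lerD2r (le_trans (ler_normD _ _))// lerD2r.
  by rewrite ger0_norm// mulr_ge0.
have -> : 600 * B = 576 * B + 12 * B + 12 * B by ring.
have dist (x y z w : R) : (x + y + z) * w = x * w + y * w + z * w by ring.
by rewrite dist; apply: lerD b1; exact: lerD.
Qed.

Lemma tmean_large (M : R) : exists N, forall n, (N <= n)%N -> M <= m n.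
Proof.
have [N MN] := tmean_infty M; exists N => n Nn.
exact: le_trans MN (tmean_le fa Nn).
Qed.

Lemma psum_abs_c_small (eps : R) : 0 < eps -> exists N, forall n, (N <= n)%N ->
  \sum_(0 <= k < n.+1) `|c k| <= eps * m n.
Proof.
move=> eps0; have e2 : 0 < eps / 2 by rewrite divr_gt0.
have [K HK] := tail_equiv e2.
pose D : R := \sum_(0 <= k < K.+1) `|c k|.
have [N HN] := tmean_large (2 * D / eps).
exists (N + K)%N => n Nn.
have Kn : (K.+1 <= n.+1)%N by move: Nn; clear; lia.
rewrite (@big_cat_nat _ _ _ K.+1)//= -/D.
have h1 : D <= eps / 2 * m n.
  have := HN n (leq_trans (leq_addr _ _) Nn); rewrite ler_pdivrMr// => ?; lra.
have h2 : \sum_(K.+1 <= k < n.+1) `|c k| <= eps / 2 * m n.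
  rewrite big_add1 /=.
  apply: (@le_trans _ _ (\sum_(K <= k < n) eps / 2 * tail f k)).
    by rewrite !big_nat; apply: ler_sum => k /andP[Kk _]; rewrite cS HK.
  rewrite -mulr_sumr ler_wpM2l ?(ltW e2)//.
  have nm : (n <= n.+1)%N by [].
  rewrite /tmean psumE (@big_cat_nat _ _ _ n 0 n.+1)//= (@big_cat_nat _ _ _ K 0 n)//.
  rewrite /= addrAC lerDr addr_ge0//; apply: sumr_ge0 => i _; exact: t_ge0.
have -> : eps * m n = eps / 2 * m n + eps / 2 * m n by field.
exact: lerD.
Qed.

Lemma euler_tail_small (eps : R) : 0 < eps -> exists N, forall n, (N <= n)%N ->
  n%:R * tail f n <= eps * m n.
Proof.
move=> /psum_abs_c_small[N HN]; exists N => n /HN; apply: le_trans.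
rewrite -[leLHS]/(euler (tail f) n) -{1}(psum_diffs (euler (tail f))) psumE.
by apply: ler_sum => i _; exact: ler_norm.
Qed.

(** [n / m n ^ 2] has increments of at least half of [1 / m n ^ 2], as [m] varies
    slowly by [euler_tail_small]. *)
Lemma sum_inv_tmean_sq : exists (K : R) N, 0 < K /\ forall n, (N <= n)%N ->
  \sum_(0 <= j < n) (m j ^+ 2)^-1 <= K * (n%:R / m n ^+ 2).
Proof.
have q0 : (0 : R) < 1 / 4 by rewrite divr_gt0.
have [N1 HN] := euler_tail_small q0.
pose N := N1.+1; pose y (n : nat) : R := n%:R / m n ^+ 2.
have m20 n : 0 < m n ^+ 2 by rewrite exprn_gt0.
have step n : (N1 <= n)%N -> (m n ^+ 2)^-1 <= 2 * (y n.+1 - y n).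
  move=> Nn; have h := HN n.+1 (leqW Nn).
  have mS : m n.+1 = m n + tail f n.+1 by rewrite /tmean psumS.
  have mn := m_gt0 n; have ms := m_gt0 n.+1; have ts := t_ge0 n.+1.
  have n0 : 0 <= n%:R :> R by [].
  rewrite /y -natr1 in h *; move: (n%:R : R) n0 h => z z0.
  move: (m n) (m n.+1) (tail f n.+1) mn ms ts mS => M M' t M0 M'0 t0 E1 h.
  have -> : 2 * ((z + 1) / M' ^+ 2 - z / M ^+ 2) = (2 * ((z + 1) * M ^+ 2 - z * M' ^+ 2) / M' ^+ 2) / M ^+ 2.
    by field; rewrite !gt_eqF.
  rewrite -[leLHS]mul1r ler_wpM2r ?invr_ge0 ?exprn_ge0 ?(ltW M0)//.
  rewrite ler_pdivlMr ?exprn_gt0// mul1r.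
  have h2 : (z + 1) * t * M' <= 1 / 4 * M' * M' by rewrite ler_wpM2r// ltW.
  have h3 : 0 <= t * t by rewrite mulr_ge0.
  have h4 : 0 <= z * (t * t) by rewrite mulr_ge0.
  have h5 : 0 <= t * M by rewrite mulr_ge0// ltW.
  by move: h2; rewrite E1 !expr2; lra.
have yN n : (N <= n)%N -> y N <= y n.
  move=> /subnKC <-; elim: (n - N)%N => [|i IH]; first by rewrite addn0.
  rewrite addnS (le_trans IH)// -subr_ge0 -(pmulr_rge0 _ (ltr0n R 2)).
  apply: le_trans (step _ _); first by rewrite invr_ge0 ltW.
  by rewrite /N; clear; lia.
have yN0 : 0 < y N by rewrite divr_gt0.
pose S : R := \sum_(0 <= j < N) (m j ^+ 2)^-1.
have S0 : 0 <= S by apply: sumr_ge0 => i _; rewrite invr_ge0 ltW.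
exists (S / y N + 2), N; split; first by rewrite ltr_wpDl// divr_ge0// ltW.
move=> n Nn; rewrite -/(y n).
have : \sum_(0 <= j < n) (m j ^+ 2)^-1 <= S + 2 * (y n - y N).
  rewrite -(subnKC Nn); elim: (n - N)%N => [|i IH]; first by rewrite addn0 subrr mulr0 addr0.
  rewrite addnS big_nat_recr//=.
  have h : (m (N + i) ^+ 2)^-1 <= 2 * (y (N + i).+1 - y (N + i)%N).
    by apply: step; rewrite /N; clear; lia.
  lra.
have : S <= S / y N * y n.
  by rewrite -mulrA ler_peMr// ler_pdivlMl// mulr1 yN.
move: (S / y N) (yN n Nn) => Q; lra.
Qed.

(** In [n * d n = - (c * E) n], the indices [k <= n / 2] of [c] are handled by the
    smallness of the sum of [c] before [m n], the others by the smallness of [c]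
    before the tail and by [sum_inv_tmean_sq].  The factor [eps] makes this a
    contraction. *)
Lemma diffs_contraction : exists K : R, 0 < K /\ forall eps : R, 0 < eps ->
  exists N, forall n B, (N <= n)%N -> 1 <= B -> diffs_bounded B n.-1 ->
  `|d n| * (n%:R * m n) <= K * eps * B.
Proof.
have [Q [N1 [Q0 HQ]]] := sum_inv_tmean_sq.
have [M [M0 HM]] := conv_diffs_bound.
exists (4 * M + 2 * M * Q); split; first by rewrite addr_gt0 ?mulr_gt0.
move=> eps eps0; have [N2 H2] := psum_abs_c_small eps0.
have [N3 H3] := tail_equiv eps0.
exists (N1 + N2 + 2 * N3 + 2)%N => n B Nn B1 Bn.
have [n1 n2 n3 n4] : [/\ (N1 <= n)%N, (N2 <= n)%N, (2 * N3 + 2 <= n)%N & (0 < n)%N].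
  by move: Nn; clear; split; lia.
have n0 : 0 < n%:R :> R by rewrite ltr0n.
have mn0 := m_gt0 n; have m20 : 0 < m n ^+ 2 by rewrite exprn_gt0.
have MB0 : 0 <= M * B by rewrite mulr_ge0 ?(ltW M0)// (le_trans ler01).
pose p := n./2.
have Ebd j : (j < n)%N -> `|E j| <= M * B / m j ^+ 2.
  move=> jn; rewrite ler_pdivlMr ?exprn_gt0//; apply: HM => // i /andP[i1 ij].
  by apply: Bn; rewrite i1; move: ij jn; clear; lia.
have dE : n%:R * `|d n| <= \sum_(0 <= k < n) `|c k.+1| * `|E (n - k.+1)%N|.
  rewrite -{1}(ger0_norm (ler0n R n)) -normrM -[_ * d n]/(euler d n) euler_diffs_ren /=.
  rewrite normrN convE big_nat_recl// c0 mul0r add0r (le_trans (ler_norm_sum _ _ _))//.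
  by apply: ler_sum => k _; rewrite normrM.
have pn : (p <= n)%N by rewrite /p; clear; lia.
rewrite (@big_cat_nat _ _ _ p)//= in dE.
have part1 : \sum_(0 <= k < p) `|c k.+1| * `|E (n - k.+1)%N| <= 4 * M * B * eps / m n.
  apply: (@le_trans _ _ (\sum_(0 <= k < p) `|c k.+1| * (4 * M * B / m n ^+ 2))).
    rewrite !big_nat; apply: ler_sum => k /andP[_ kp]; rewrite ler_wpM2l//.
    apply: (le_trans (Ebd _ _)); first by move: n4; clear; lia.
    rewrite ler_pdivrMr ?exprn_gt0// mulrAC ler_pdivlMr//.
    have mk : m n <= 2 * m (n - k.+1).
      by apply: (tmean_double fa); move: kp; rewrite /p; clear; lia.
    have : m n ^+ 2 <= (2 * m (n - k.+1)) ^+ 2.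
      by rewrite lerXn2r ?nnegrE ?mulr_ge0// ltW.
    rewrite exprMn => /(ler_wpM2l (_ : 0 <= M * B)) h.
    have {}h := h (mulr_ge0 (ltW M0) (le_trans ler01 B1)).
    by apply: (le_trans h); rewrite le_eqVlt; apply/orP; left; apply/eqP; ring.
  rewrite -mulr_suml.
  have h : \sum_(0 <= k < p) `|c k.+1| <= eps * m n.
    apply: le_trans (H2 n n2); rewrite big_nat_recl// c0 normr0 add0r.
    by rewrite [leRHS](@big_cat_nat _ _ _ p)//= lerDl; apply: sumr_ge0.
  apply: (@le_trans _ _ (eps * m n * (4 * M * B / m n ^+ 2))).
    by rewrite ler_wpM2r// divr_ge0 ?exprn_ge0 ?(ltW mn0)// -mulrA mulr_ge0.
  by rewrite le_eqVlt; apply/orP; left; apply/eqP; field; rewrite gt_eqF.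
have part2 : \sum_(p <= k < n) `|c k.+1| * `|E (n - k.+1)%N| <= 2 * M * Q * B * eps / m n.
  have tp : tail f p * n%:R <= 2 * m n.
    apply: (@le_trans _ _ (2 * (tail f p * p.+1%:R))).
      rewrite mulrCA ler_wpM2l// -natrM ler_nat /p; clear; lia.
    rewrite ler_wpM2l// (le_trans _ (tmean_le fa pn))//.
    have -> : tail f p * p.+1%:R = \sum_(0 <= i < p.+1) tail f p.
      by rewrite big_const_nat iter_addr addr0 subn0 [LHS]mulr_natr.
    rewrite /tmean psumE !big_nat; apply: ler_sum => i /andP[_ ip].
    by apply: (tail_le fa); rewrite -ltnS.
  apply: (@le_trans _ _ (\sum_(p <= k < n) (eps * (2 * m n / n%:R)) * (M * B * (m (n - k.+1) ^+ 2)^-1))).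
    rewrite !big_nat; apply: ler_sum => k /andP[pk kn]; apply: ler_pM => //; last first.
      by apply: Ebd; move: n4; clear; lia.
    rewrite cS (le_trans (H3 _ _))//; first by move: n3 pk; rewrite /p; clear; lia.
    rewrite ler_wpM2l ?(ltW eps0)// ler_pdivlMr// (le_trans _ tp)//.
    by rewrite ler_wpM2r// (tail_le fa).
  rewrite -mulr_sumr -mulr_sumr.
  have h : \sum_(p <= k < n) (m (n - k.+1) ^+ 2)^-1 <= Q * (n%:R / m n ^+ 2).
    apply: le_trans (HQ n n1).
    rewrite [leRHS]big_nat_rev/= add0n [leRHS](@big_cat_nat _ _ _ p)//= lerDr.
    by apply: sumr_ge0 => i _; rewrite invr_ge0 exprn_ge0// ltW.
  have u0 : 0 <= eps * (2 * m n / n%:R) by rewrite mulr_ge0 ?divr_ge0 ?mulr_ge0 ?ltW.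
  apply: (@le_trans _ _ (eps * (2 * m n / n%:R) * (M * B * (Q * (n%:R / m n ^+ 2))))).
    by rewrite ler_wpM2l// ler_wpM2l.
  by rewrite le_eqVlt; apply/orP; left; apply/eqP; field; rewrite !gt_eqF.
have -> : `|d n| * (n%:R * m n) = n%:R * `|d n| * m n by ring.
have -> : (4 * M + 2 * M * Q) * eps * B = (4 * M * B * eps / m n + 2 * M * Q * B * eps / m n) * m n.
  by field; rewrite gt_eqF.
by rewrite ler_wpM2r ?(ltW mn0)// (le_trans dE)// lerD.
Qed.

(** A first use of the contraction, with factor 1, propagates the bound [B] to all
    indices; a second one, with [eps] small, improves it. *)
Lemma diffs_small (eps : R) : 0 < eps -> exists N, forall n, (N <= n)%N ->
  `|d n| * (n%:R * m n) <= eps.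
Proof.
have [K [K0 HK]] := diffs_contraction.
have Ki : 0 < K^-1 by rewrite invr_gt0.
have [N0 H0] := HK _ Ki.
pose B : R := 1 + \sum_(j < N0) `|d j| * (j%:R * m j).
have pos j : 0 <= `|d j| * (j%:R * m j) by rewrite !mulr_ge0// ltW.
have B1 : 1 <= B by rewrite lerDl; apply: sumr_ge0.
have all n : diffs_bounded B n.
  elim: n => [|n IH] j /andP[j1 jn]; first by move: j1 jn; clear; lia.
  have [jn'|jn'] := leqP j n; first by apply: IH; rewrite j1.
  have -> : j = n.+1 by move: jn jn'; clear; lia.
  have [nN|nN] := ltnP n.+1 N0; last first.
    by have := H0 _ _ nN B1 IH; rewrite mulfV ?gt_eqF// mul1r.
  rewrite /B (bigD1 (Ordinal nN))//= addrCA lerDl addr_ge0//; exact: sumr_ge0.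
move=> eps0; have e1 : 0 < eps / (K * B) by rewrite divr_gt0 ?mulr_gt0//; lra.
have [N HN] := HK _ e1; exists N => n Nn; apply: (le_trans (HN n B Nn B1 (all _))).
by rewrite le_eqVlt; apply/orP; left; apply/eqP; field; rewrite !gt_eqF//; lra.
Qed.

(** Adding up at most [j] increments, each negligible before [1 / (j * m j)]. *)
Lemma ren_flat (eps : R) : 0 < eps -> exists N, forall n j, (N <= j)%N ->
  (j <= n <= 2 * j)%N -> `|a n - a j| * m n <= eps.
Proof.
move=> eps0; have e2 : 0 < eps / 2 by rewrite divr_gt0.
have [N HN] := diffs_small e2; exists N.+1 => n j Nj /andP[jn nj].
have j0 : 0 < j%:R :> R by rewrite ltr0n; move: Nj; clear; lia.
have mn0 := m_gt0 n; have mj0 := m_gt0 j.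
have mnj : m n <= 2 * m j by apply: (tmean_double fa); exact: leqW.
suff h : `|a n - a j| * (j%:R * m j) <= (n - j)%N%:R * (eps / 2).
  have nj' : (n - j)%N%:R <= j%:R :> R by rewrite ler_nat; move: nj; clear; lia.
  have h2 : `|a n - a j| * (j%:R * m j) <= j%:R * (eps / 2).
    by apply: (le_trans h); rewrite ler_wpM2r// ltW.
  have h3 : `|a n - a j| * m j <= eps / 2.
    by rewrite -(ler_pM2l j0) mulrCA.
  apply: (@le_trans _ _ (`|a n - a j| * (2 * m j))); first by rewrite ler_wpM2l.
  by rewrite mulrCA; lra.
rewrite -{1}(subnKC jn); elim: (n - j)%N => [|i IH].
  by rewrite addn0 subrr normr0 !mul0r.
rewrite addnS; have -> : a (j + i).+1 - a j = (a (j + i)%N - a j) + d (j + i).+1.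
  by rewrite diffsS; ring.
rewrite -natr1 [leRHS]mulrDl mul1r.
apply: (@le_trans _ _ (`|a (j + i)%N - a j| * (j%:R * m j) + `|d (j + i).+1| * (j%:R * m j))).
  by rewrite -mulrDl ler_wpM2r ?mulr_ge0 ?(ltW j0) ?(ltW mj0)// ler_normD.
apply: lerD => //; have := HN (j + i).+1 _; rewrite (_ : (N <= _)%N); last first.
  by move: Nj; clear; lia.
move=> /(_ isT); apply: le_trans; rewrite ler_wpM2l// ler_pM ?(ltW j0) ?(ltW mj0)//.
  by rewrite ler_nat; clear; lia.
by apply: (tmean_le fa); clear; lia.
Qed.

(** In [sum_i tail f i * a (n - i) = 1], the values [a (n - i)] are close to [a n]
    for [i <= n / 2], so this half is about [a n * m (n / 2)]; the other half is at
    most [tail f (n / 2) * A n], which is small. *)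
Lemma ren_tmean_bounds : exists N, forall n, (N <= n)%N -> 1 / 2 <= a n * m n <= 4.
Proof.
have e8 : (0 : R) < 1 / 4 by rewrite divr_gt0.
have [N1 H1] := ren_flat e8.
have e28 : (0 : R) < 1 / 28 by rewrite divr_gt0.
have [N2 H2] := euler_tail_small e28.
exists (2 * N1 + 2 * N2 + 4)%N => n Nn; pose p := n./2.
have [p1 p2 p0 pn] : [/\ (N1 <= n - p)%N, (N2 <= p)%N, (0 < p)%N & (p <= n)%N].
  by rewrite /p; move: Nn; clear; split; lia.
have mn0 := m_gt0 n; have mp0 := m_gt0 p.
have mnp : m n <= 2 * m p by apply: (tmean_double fa); rewrite /p; clear; lia.
have mpn : m p <= m n by exact: (tmean_le fa).
have near i : (i <= p)%N -> `|a n - a (n - i)%N| * m n <= 1 / 4.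
  by move=> ip; apply: H1; move: ip p1; rewrite /p; clear; lia.
have total : \sum_(0 <= i < n.+1) tail f i * a (n - i)%N = 1.
  by rewrite -convE convC conv_ren_tail.
have pn1 : (p.+1 <= n.+1)%N by [].
rewrite (@big_cat_nat _ _ _ p.+1)//= in total.
set S1 := \sum_(0 <= i < p.+1) _ in total; set S2 := \sum_(p.+1 <= i < n.+1) _ in total.
have S20 : 0 <= S2 by apply: sumr_ge0 => i _; rewrite mulr_ge0.
have S2le : S2 <= 1 / 4.
  apply: (@le_trans _ _ (tail f p * A n)).
    have -> : A n = \sum_(0 <= i < n.+1) a (n - i)%N.
      rewrite -conv_ones convC convE; apply: eq_bigr => i _; exact: mul1r.
    apply: (@le_trans _ _ (\sum_(p.+1 <= i < n.+1) tail f p * a (n - i)%N)).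
      rewrite /S2 !big_nat; apply: ler_sum => i /andP[pi _].
      by rewrite ler_wpM2r// (tail_le fa)// ltnW.
    rewrite -mulr_sumr ler_wpM2l// [leRHS](@big_cat_nat _ _ _ p.+1)//= lerDr.
    exact: sumr_ge0.
  have h1 := psum_tmean_le fa n; have h2 := H2 p p2.
  have h3 : (2 * n).+1%:R <= 7 * p%:R :> R.
    by rewrite -natrM ler_nat; rewrite /p in p0 *; move: p0; clear; lia.
  rewrite -(ler_pM2r mn0) -mulrA.
  apply: (@le_trans _ _ (tail f p * (7 * p%:R))).
    by rewrite ler_wpM2l// (le_trans h1).
  have -> : tail f p * (7 * p%:R) = 7 * (p%:R * tail f p) by ring.
  apply: (@le_trans _ _ (7 * (1 / 28 * m p))); first by rewrite ler_wpM2l.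
  lra.
have S1E : `|a n * m p - S1| * m n <= 1 / 4 * m p.
  have -> : a n * m p - S1 = \sum_(0 <= i < p.+1) tail f i * (a n - a (n - i)%N).
    rewrite /S1 /tmean psumE mulr_sumr -sumrB; apply: eq_bigr => i _; ring.
  apply: (@le_trans _ _ (\sum_(0 <= i < p.+1) tail f i * (1 / 4))); last first.
    by rewrite -mulr_suml -psumE mulrC.
  apply: (@le_trans _ _ ((\sum_(0 <= i < p.+1) tail f i * `|a n - a (n - i)%N|) * m n)).
    rewrite ler_wpM2r ?(ltW mn0)// (le_trans (ler_norm_sum _ _ _))//.
    by apply: ler_sum => i _; rewrite normrM (ger0_norm (t_ge0 _)).
  rewrite mulr_suml !big_nat; apply: ler_sum => i /andP[_ ip].
  by rewrite -mulrA ler_wpM2l// near.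
have {}S1E : `|a n * m p - S1| <= 1 / 4.
  rewrite -(ler_pM2r mn0); apply: (le_trans S1E); rewrite ler_wpM2l//; lra.
move: S1E; rewrite ler_norml => /andP[l1 l2].
have u1 : a n * m p <= a n * m n by rewrite ler_wpM2l.
have u2 : a n * m n <= a n * (2 * m p) by rewrite ler_wpM2l.
by apply/andP; split; lra.
Qed.

Lemma infinite_mean_regular_decay : regular_decay a.
Proof.
have [N0 H0] := ren_tmean_bounds.
split.
- exists N0 => n /H0 /andP[h _]; rewrite -(pmulr_lgt0 _ (m_gt0 n)); lra.
- move=> eps eps0; have e2 : 0 < eps / 2 by rewrite divr_gt0.
  have [N HN] := ren_flat e2; exists (N0 + N + 1)%N => n Nn.
  have [n0 n1 n2] : [/\ (N0 <= n)%N, (N <= n)%N & (n <= n.+1 <= 2 * n)%N].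
    by move: Nn; clear; split; lia.
  have mn := m_gt0 n; rewrite -(ler_pM2r mn).
  have /andP[h _] := H0 n n0.
  apply: (@le_trans _ _ (`|a n.+1 - a n| * m n.+1)).
    by rewrite ler_wpM2l// (tmean_le fa).
  apply: (le_trans (HN _ _ n1 n2)); rewrite -mulrA.
  have : eps * (1 / 2) <= eps * (a n * m n) by rewrite ler_wpM2l// ltW.
  lra.
- exists 16, N0 => k n Nk /andP[kn nk].
  have /andP[_ h1] := H0 k Nk; have /andP[h2 _] := H0 n (leq_trans Nk kn).
  have mk := m_gt0 k; rewrite -(ler_pM2r mk).
  have mnk : m n <= 2 * m k by apply: (tmean_double fa); exact: leqW.
  have : a n * m n <= a n * (2 * m k) by rewrite ler_wpM2l.
  lra.
Qed.

End InfiniteMeanCritical.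

(** * Renewal sequences with finite mean *)

Section FiniteMean.
Variable R : realType.

Lemma limsup_exists (x : nat -> R) (B : R) : (forall n, `|x n| <= B) -> exists l : R,
  (forall eps : R, 0 < eps -> exists N, forall n, (N <= n)%N -> x n <= l + eps) /\
  (forall eps : R, 0 < eps -> forall N, exists2 n, (N <= n)%N & l - eps <= x n).
Proof.
move=> xB; pose S := [set y : R | exists N, forall n, (N <= n)%N -> x n <= y].
have S0 : has_inf S.
  split; first by exists B, 0%N => n _; exact: le_trans (ler_norm _) (xB n).
  exists (- B) => y [N HN]; apply: le_trans (HN N (leqnn _)).
  by have := xB N; rewrite ler_norml => /andP[].
exists (inf S); split => eps eps0.
  have [y [N HN] yi] := inf_adherent eps0 S0; exists N => n /HN /le_trans; apply.
  exact: ltW.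
move=> N; apply: contrapT => h.
have : S (inf S - eps).
  exists N => n Nn; rewrite leNgt; apply/negP => h2; apply: h.
  by exists n => //; exact: ltW.
by move=> /(ge_inf S0.2); rewrite lerBrDr gerDl leNgt eps0.
Qed.

Variable f : nat -> R.
Hypotheses (f_ge0 : forall n, 0 <= f n) (f_le1 : forall n, psum f n <= 1).
Hypothesis tail_cvg0 : forall eps : R, 0 < eps -> exists n, tail f n <= eps.
Variable J : nat.
Hypothesis f_gt0 : forall j, (J <= j)%N -> 0 < f j.

(** [x n] is an average of the previous values with weights [f].  These values
    hardly exceed the upper limit [l]; so if the average is close to [l], then so is
    every value with positive weight. *)
Lemma renewal_average_close (x : nat -> R) (B l : R) : 0 <= B -> (forall n, `|x n| <= B) ->
  (forall n, (0 < n)%N -> x n = conv f x n) ->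
  (forall eps : R, 0 < eps -> exists N, forall n, (N <= n)%N -> x n <= l + eps) ->
  forall j, (J <= j)%N -> forall eps : R, 0 < eps -> exists del N, 0 < del /\
  forall n, (N <= n)%N -> l - del <= x n -> l - eps <= x (n - j)%N.
Proof.
move=> B0 xB xE xl j Jj eps eps0; have fj := f_gt0 Jj.
have tail_ge0 n : 0 <= tail f n by rewrite subr_ge0.
have fj1 : f j <= 1.
  apply: le_trans (f_le1 j); rewrite psumE big_nat_recr//= lerDr.
  exact: sumr_ge0.
(* [K * del] covers the error from the tail of [f] and from the excess of [x]
   over [l], before division by the weight [f j]. *)
pose K := 3 + 2 * B + `|l|.
have K0 : 0 < K by rewrite /K; have := normr_ge0 l; lra.
pose del : R := Num.min 1 (eps * f j / K).
have del0 : 0 < del by rewrite lt_min ltr01/= divr_gt0// mulr_gt0.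
have delK : K * del <= eps * f j by rewrite mulrC -ler_pdivlMr// ge_min lexx orbT.
have del1 : del <= 1 by rewrite ge_min lexx.
have [N1 H1] := xl _ del0.
have [M0 HM0] := tail_cvg0 del0.
pose M := (M0 + j)%N.
have tM : tail f M <= del.
  by apply: le_trans HM0; rewrite lerD2l lerN2 psum_le// leq_addr.
exists del, (N1 + M + 1)%N; split => // n Nn xn.
have [n0 Mn] : (0 < n)%N /\ (M <= n)%N by move: Nn; clear; lia.
have jn : (j <= n)%N by rewrite (leq_trans _ Mn)// leq_addl.
have := xE n n0; rewrite convE (@big_cat_nat _ _ _ M.+1)//= => xnE.
have p2 : `|\sum_(M.+1 <= i < n.+1) f i * x (n - i)%N| <= B * del.
  apply: (le_trans (ler_norm_sum _ _ _)).
  apply: (@le_trans _ _ (\sum_(M.+1 <= i < n.+1) B * f i)).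
    by apply: ler_sum => i _; rewrite normrM (ger0_norm (f_ge0 _)) mulrC ler_wpM2r.
  rewrite -mulr_sumr ler_wpM2l// sum_nat_psum//.
  by apply: le_trans tM; rewrite lerD2r.
have p1 : \sum_(0 <= i < M.+1) f i * x (n - i)%N <=
    f j * x (n - j)%N + (psum f M - f j) * (l + del).
  have jM : (j < M.+1)%N by rewrite ltnS leq_addl.
  have E : psum f M - f j = \sum_(i < M.+1 | i != Ordinal jM) f i.
    by rewrite /psum (bigD1 (Ordinal jM))//= addrAC subrr add0r.
  rewrite big_mkord (bigD1 (Ordinal jM))//= lerD2l E mulr_suml.
  apply: ler_sum => i _; rewrite ler_wpM2l// H1//.
  by move: (ltn_ord i) Nn; clear; lia.
have sM : psum f M = 1 - tail f M by rewrite /tail opprB addrC subrK.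
rewrite sM in p1.
have tl : - (tail f M * (l + del)) <= del * (`|l| + 1).
  have t1 : 0 <= tail f M * (l + del + (`|l| + 1)).
    by rewrite mulr_ge0//; have := ler_norm (- l); rewrite normrN; lra.
  have : tail f M * (`|l| + 1) <= del * (`|l| + 1).
    by rewrite ler_wpM2r// addr_ge0.
  move: t1; rewrite mulrDr; lra.
move: p2; rewrite ler_norml => /andP[_ p2].
have fd : 0 <= f j * del by rewrite mulr_ge0// ltW.
have key : f j * (l - eps) <= f j * x (n - j)%N.
  rewrite /K in delK; have Bd : 0 <= B * del by rewrite mulr_ge0// ltW.
  lra.
by rewrite ler_pM2l in key.
Qed.

(** All weights [f j] with [j >= J] are positive, which replaces the usual
    aperiodicity argument: all values on a window of length [M], [J] steps before
    an almost maximal one, are almost maximal at once. *)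
Lemma limsup_window (x : nat -> R) (B : R) : 0 <= B -> (forall n, `|x n| <= B) ->
  (forall n, (0 < n)%N -> x n = conv f x n) -> exists l : R,
  (forall eps : R, 0 < eps -> exists N, forall n, (N <= n)%N -> x n <= l + eps) /\
  forall eps : R, 0 < eps -> forall M N, exists2 n, (N <= n)%N &
    forall i, (i <= M)%N -> `|x (n - i)%N - l| <= eps.
Proof.
move=> B0 xB xE; have [l [lup llo]] := limsup_exists xB.
exists l; split => // eps eps0 M N.
have [N1 H1] := lup _ eps0.
have [del [N2 [del0 H2]]] : exists del N2, 0 < del /\ forall n, (N2 <= n)%N ->
    l - del <= x n -> forall i, (i <= M)%N -> l - eps <= x (n - (J + i))%N.
  elim: M => [|M [del1 [K1 [d1 H]]]].
    have [del [K [d0 H]]] := renewal_average_close B0 xB xE lup (leqnn J) eps0.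
    exists del, K; split => // n Kn xn i; rewrite leqn0 => /eqP ->.
    by rewrite addn0 H.
  have [del2 [K2 [d2 H2]]] := renewal_average_close B0 xB xE lup (leq_addr M.+1 J) eps0.
  exists (Num.min del1 del2), (K1 + K2)%N; split; first by rewrite lt_min d1.
  move=> n Kn xn i; rewrite leq_eqVlt => /orP[/eqP ->|iM].
    apply: H2; first exact: leq_trans (leq_addl _ _) Kn.
    by apply: le_trans xn; rewrite lerD2l lerN2 ge_min lexx orbT.
  apply: H => //; first exact: leq_trans (leq_addr _ _) Kn.
  by apply: le_trans xn; rewrite lerD2l lerN2 ge_min lexx.
have [n nN xn] := llo _ del0 (N1 + N2 + N + J + M)%N.
exists (n - J)%N; first by move: nN; clear; lia.
move=> i iM; rewrite -subnDA ler_distl; apply/andP; split.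
  by apply: H2 => //; move: nN; clear; lia.
by apply: H1; move: nN iM; clear; lia.
Qed.

Variable a : nat -> R.
Hypothesis fa : renewal_pair f a.
Variable B : R.
Hypothesis tmean_bounded : forall n, tmean f n <= B.

Lemma tmean_limit : exists mu, 0 < mu /\ (forall n, tmean f n <= mu) /\
  forall eps : R, 0 < eps -> exists M, mu - eps <= tmean f M.
Proof.
have S0 : has_sup (range (tmean f)).
  by split; [exists (tmean f 0); exists 0%N | exists B => _ [n _ <-]].
have ub n : tmean f n <= sup (range (tmean f)) by apply: (sup_upper_bound S0); exists n.
exists (sup (range (tmean f))); split; first exact: lt_le_trans (tmean_gt0 fa 0) (ub 0%N).
split => // eps eps0; have [_ [M _ <-] h] := sup_adherent eps0 S0.
by exists M; exact: ltW.
Qed.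

(** On a long window where [a] is close to [l], the identity
    [sum_i tail f i * a (n - i) = 1] becomes [l * mu = 1]. *)
Lemma window_limit mu l : 0 < mu -> (forall n, tmean f n <= mu) ->
  (forall eps : R, 0 < eps -> exists M, mu - eps <= tmean f M) ->
  (forall eps : R, 0 < eps -> forall M N, exists2 n, (N <= n)%N &
    forall i, (i <= M)%N -> `|a (n - i)%N - l| <= eps) -> l * mu = 1.
Proof.
move=> mu0 ub adh win; apply/eqP; rewrite -subr_eq0 -normr_le0.
apply/ler_addgt0Pr => eps eps0; rewrite add0r.
pose eta : R := eps / (mu + `|l| + 1).
have D0 : 0 < mu + `|l| + 1 by have := normr_ge0 l; lra.
have eta0 : 0 < eta by rewrite divr_gt0.
have etaE : eta * (mu + `|l| + 1) = eps by rewrite divfK// gt_eqF.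
have [M HM] := adh _ eta0; have [n Mn Hn] := win _ eta0 M M.
have : \sum_(0 <= i < n.+1) tail f i * a (n - i)%N = 1.
  by rewrite -convE convC (conv_ren_tail fa).
have t0 i : 0 <= tail f i by exact: (tail_ge0 fa).
rewrite (@big_cat_nat _ _ _ M.+1)//=.
set S1 := \sum_(0 <= i < M.+1) _; set S2 := \sum_(M.+1 <= i < n.+1) _ => total.
have S1E : `|S1 - l * tmean f M| <= eta * mu.
  have -> : S1 - l * tmean f M = \sum_(0 <= i < M.+1) tail f i * (a (n - i)%N - l).
    by rewrite /tmean psumE mulr_sumr -sumrB; apply: eq_bigr => i _; ring.
  apply: (le_trans (ler_norm_sum _ _ _)).
  apply: (@le_trans _ _ (\sum_(0 <= i < M.+1) tail f i * eta)).
    rewrite !big_nat; apply: ler_sum => i /andP[_ iM].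
    by rewrite normrM (ger0_norm (t0 _)) ler_wpM2l// Hn.
  by rewrite -mulr_suml -psumE mulrC ler_wpM2l ?(ltW eta0)//; exact: ub.
have S2E : 0 <= S2 <= eta.
  apply/andP; split; first by apply: sumr_ge0 => i _; rewrite mulr_ge0// (ren_ge0 fa).
  apply: (@le_trans _ _ (\sum_(M.+1 <= i < n.+1) tail f i)).
    by apply: ler_sum => i _; rewrite ler_piMr// (ren_le1 fa).
  by rewrite sum_nat_psum// -[psum _]/(tmean f); have := ub n; lra.
have lM : `|l * mu - l * tmean f M| <= eta * `|l|.
  rewrite -mulrBr normrM mulrC ler_wpM2r// ger0_norm; last by rewrite subr_ge0.
  lra.
move: S1E lM S2E; rewrite !ler_norml => /andP[h1 h2] /andP[h3 h4] /andP[h5 h6].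
rewrite -etaE; apply/andP; split; lra.
Qed.

(** The Erdos-Feller-Pollard theorem: applied to [a] and to [- a], the window
    argument shows that the upper and the lower limit are both [1 / mu]. *)
Lemma finite_mean_regular_decay : regular_decay a.
Proof.
have aB n : `|a n| <= 1 by rewrite ger0_norm ?(ren_ge0 fa)// (ren_le1 fa).
have aE n : (0 < n)%N -> a n = conv f a n.
  by case: n => // n _; rewrite [LHS](congr1 (fun x => x n.+1) (rp_eq fa)) /= /delta0/= add0r.
have [mu [mu0 [ub adh]]] := tmean_limit.
have [l [lup lwin]] := limsup_window ler01 aB aE.
have NB n : `|(\- a) n| <= 1 by rewrite /= normrN.
have NE n : (0 < n)%N -> (\- a) n = conv f (\- a) n by move=> n0; rewrite convNr /= -aE.
have [v [vup vwin]] := limsup_window ler01 NB NE.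
have lmu := window_limit mu0 ub adh lwin.
have vmu : (- v) * mu = 1.
  apply: (window_limit mu0 ub adh) => eps eps0 M N; have [n Nn H] := vwin _ eps0 M N.
  by exists n => // i /H; rewrite /= -opprD normrN opprK.
have vl : v = - l.
  by apply: (mulIf (lt0r_neq0 mu0)); rewrite mulNr lmu -vmu mulNr opprK.
have l0 : 0 < l by rewrite -(pmulr_lgt0 _ mu0) lmu.
have lim (eps : R) : 0 < eps -> exists N, forall n, (N <= n)%N -> l - eps <= a n <= l + eps.
  move=> eps0; have [N1 H1] := lup _ eps0; have [N2 H2] := vup _ eps0.
  exists (N1 + N2)%N => n Nn; rewrite H1 ?(leq_trans (leq_addr _ _) Nn)// andbT.
  by have := H2 n (leq_trans (leq_addl _ _) Nn); rewrite vl /=; lra.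
have [N H] := lim _ (divr_gt0 l0 (ltr0n R 2)).
split.
- by exists N => n /H /andP[h _]; lra.
- move=> eps eps0; have e8 : 0 < eps * l / 4 by rewrite divr_gt0// mulr_gt0.
  have [N2 H2] := lim _ e8; exists (N + N2)%N => n Nn.
  have /andP[h _] := H n (leq_trans (leq_addr _ _) Nn).
  have N2n := leq_trans (leq_addl _ _) Nn.
  have /andP[a1 a2] := H2 n N2n; have /andP[b1 b2] := H2 n.+1 (leqW N2n).
  have : eps * (l / 2) <= eps * a n by rewrite ler_wpM2l ?(ltW eps0)//; lra.
  by move=> h2; rewrite ler_norml; apply/andP; split; lra.
- exists 3, N => k n Nk /andP[kn _].
  by have /andP[_ h1] := H k Nk; have /andP[h2 _] := H n (leq_trans Nk kn); lra.
Qed.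

End FiniteMean.

(** * Decay of renewal sequences with regularly varying law *)

Section RenewalRegularDecay.
Variables (R : realType) (f a : nat -> R) (s : R).
Hypotheses (fa : renewal_pair f a) (fs : reg_var f s).
Let f_ge0 := rp_ge0 fa.
Let f_le1 := rp_le1 fa.
Let e_ge0 n : 0 <= euler f n. Proof. by rewrite mulr_ge0. Qed.

(** Here [psum a] is bounded, and the moment up to [p] is at most [p]. *)
Lemma transient_small_moment (q : R) : 0 < q -> (forall n, q <= tail f n) ->
  forall eps : R, 0 < eps -> exists L N, (0 < L)%N /\
  forall n, (N <= n)%N -> psum a n * psum (euler f) (n %/ L) <= eps * n%:R.
Proof.
move=> q0 qt eps eps0.
have [L L0 HL] := natr_large_pos ((q * eps)^-1).
have [{}HL Lp] := HL L (leqnn _).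
exists L, 0%N; split => // n _; set p := (n %/ L)%N.
have A1 : psum a n <= q^-1.
  rewrite -[leRHS]mul1r ler_pdivlMr// (le_trans _ (psum_tail_le1 fa n))//.
  by rewrite ler_wpM2l// psum_ge0//; exact: (ren_ge0 fa).
have S1 : psum (euler f) p <= p%:R.
  apply: (@le_trans _ _ (\sum_(i < p.+1) p%:R * f i)).
    by apply: ler_sum => i _; rewrite ler_wpM2r// ler_nat -ltnS.
  by rewrite -mulr_sumr -[leRHS]mulr1 ler_wpM2l// -/(psum f p).
have pL : p%:R * L%:R <= n%:R :> R by rewrite -natrM ler_nat leq_trunc_div.
have qe : 0 < q * eps by rewrite mulr_gt0.
apply: (@le_trans _ _ (q^-1 * p%:R)).
  by apply: ler_pM => //; apply: psum_ge0 => //; exact: (ren_ge0 fa).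
rewrite ler_pdivrMl// mulrA.
apply: le_trans (_ : q * eps * (p%:R * L%:R) <= _); last by rewrite ler_wpM2l// ltW.
rewrite mulrCA ler_peMr//.
by rewrite -ler_pdivrMl// mulr1.
Qed.

(** The moment up to [n / L] is a small multiple of [n^2 * f n], and
    [psum a n * n * f n] is bounded, because [n * f n] is at most of the order of
    [tail f n]. *)
Lemma light_small_moment : 0 <= s < 2 ->
  forall eps : R, 0 < eps -> exists L N, (0 < L)%N /\
  forall n, (N <= n)%N -> psum a n * psum (euler f) (n %/ L) <= eps * n%:R.
Proof.
move=> s02 eps eps0; have /andP[s0 _] := s02.
have [C [N1 [C1 N10 H1]]] := reg_var_bounded fs s0 2.
have C0 : 0 < C by lra.
have [L [N2 [L0 H2]]] := psum_euler_small f_ge0 fs s02 (divr_gt0 eps0 C0).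
exists L, (N1 + N2)%N; split => // n Nn.
have [n1 n2] : (N1 <= n)%N /\ (N2 <= n)%N by move: Nn; clear; lia.
have A0 : 0 <= psum a n by apply: psum_ge0; exact: (ren_ge0 fa).
apply: (@le_trans _ _ (psum a n * (eps / C * (n%:R ^+ 2 * f n)))).
  by rewrite ler_wpM2l// H2.
have nf : n%:R * f n <= C * tail f n.
  apply: (@le_trans _ _ (\sum_(n.+1 <= i < (2 * n).+1) C * f i)).
    apply: (@le_trans _ _ (\sum_(n.+1 <= i < (2 * n).+1) f n)).
      rewrite big_const_nat iter_addr addr0 mulr_natl.
      by rewrite (_ : (2 * n).+1 - n.+1 = n)%N//; clear; lia.
    rewrite !big_nat; apply: ler_sum => i /andP[ni]; rewrite ltnS => iN.
    by have [|] := H1 n i n1; first by rewrite (ltnW ni).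
  rewrite -mulr_sumr ler_wpM2l ?(ltW C0)//.
  rewrite sum_nat_psum; last by rewrite leq_pmull.
  by rewrite lerD2r.
have Anf : psum a n * (n%:R * f n) <= C.
  apply: (@le_trans _ _ (C * (psum a n * tail f n))); last first.
    by rewrite ler_piMr ?(ltW C0)// (psum_tail_le1 fa).
  by rewrite [leRHS]mulrCA ler_wpM2l.
have -> : psum a n * (eps / C * (n%:R ^+ 2 * f n)) = eps / C * n%:R * (psum a n * (n%:R * f n)).
  by ring.
apply: (@le_trans _ _ (eps / C * n%:R * C)).
  by rewrite ler_wpM2l// mulr_ge0// ltW// divr_gt0.
by rewrite le_eqVlt; apply/orP; left; apply/eqP; field; rewrite gt_eqF.
Qed.

(** Summation by parts. *)
Lemma tmeanE n : tmean f n = psum (euler f) n + n.+1%:R * tail f n.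
Proof.
elim: n => [|n IH].
  by rewrite /tmean !psum0 /euler mul0r add0r mul1r.
rewrite /tmean !psumS -/(tmean f) IH /euler /tail psumS -!natr1; ring.
Qed.

Lemma tmean_bounded_of_moment (B : R) :
  (forall eps : R, 0 < eps -> exists n, tail f n <= eps) ->
  (forall n, psum (euler f) n <= B) -> forall n, tmean f n <= 2 * B.
Proof.
move=> t0 eB n; rewrite tmeanE.
suff : n.+1%:R * tail f n <= B by have := eB n; lra.
apply/ler_addgt0Pr => eps eps0; have n0 : 0 < n.+1%:R :> R by rewrite ltr0n.
have [N HN] := t0 _ (divr_gt0 eps0 n0).
have nN : (n <= n + N)%N by rewrite leq_addr.
have : tail f n = tail f (n + N) + \sum_(n.+1 <= i < (n + N).+1) f i.
  by rewrite sum_nat_psum// /tail; ring.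
move=> ->; rewrite mulrDr addrC lerD//; last first.
  rewrite mulrC -ler_pdivlMr//; apply: le_trans HN.
  by apply: (tail_le fa); rewrite leq_addl.
apply: le_trans (eB (n + N)%N); rewrite psumE (@big_cat_nat _ _ _ n.+1 0 (n + N).+1)//=.
rewrite -[leLHS]add0r lerD//; first exact: sumr_ge0.
rewrite mulr_sumr !big_nat; apply: ler_sum => i /andP[ni _].
by rewrite /euler ler_wpM2r// ler_nat.
Qed.

Lemma reg_var_renewal_regular_decay : 0 <= s -> regular_decay a.
Proof.
move=> s0.
have [[q [q0 qt]]|rec] := pselect (exists q : R, 0 < q /\ forall n, q <= tail f n).
  exact: (small_moment_regular_decay fa fs s0 (transient_small_moment q0 qt)).
have t0 (eps : R) : 0 < eps -> exists n, tail f n <= eps.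
  move=> eps0; apply: contrapT => h; apply: rec; exists eps; split => // n.
  by rewrite leNgt; apply/negP => h2; apply: h; exists n; exact: ltW.
have [s2|s2] := ltP s 2.
  have s02 : 0 <= s < 2 by rewrite s0.
  exact: (small_moment_regular_decay fa fs s0 (light_small_moment s02)).
have finite (B : R) : (forall n, tmean f n <= B) -> regular_decay a.
  have [J HJ] := reg_var_gt0 fs.
  exact: (finite_mean_regular_decay f_ge0 f_le1 t0 HJ fa).
have [[B mB]|minf] := pselect (exists B : R, forall n, tmean f n <= B).
  exact: finite mB.
have [s2'|s2'] := ltP 2 s.
  have [B HB] := psum_euler_bounded f_ge0 fs s2'.
  exact: finite (tmean_bounded_of_moment t0 HB).
have sE : s = 2 by apply/eqP; rewrite eq_le s2 s2'.
have fs2 : reg_var f 2 by rewrite -sE.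
apply: (infinite_mean_regular_decay fa (tail_asymp f_ge0 fs2 f_le1 t0)) => M.
apply: contrapT => h; apply: minf; exists M => n.
by rewrite leNgt; apply/negP => h2; apply: h; exists n; exact: ltW.
Qed.

End RenewalRegularDecay.

(** The exponent is [s = 1 + alpha >= 1]; the three regimes are exhaustive because a
    recurrent law with [s > 2] has a finite mean. *)
Lemma renewal_regular_decay (R : realType) (f a phi : nat -> R) (alpha : R) :
  renewal_pair f a -> 0 <= alpha -> slowly_varying phi ->
  (forall n, (1 <= n)%N -> f n = phi n * n%:R `^ (- (1 + alpha))) ->
  regular_decay a.
Proof.
move=> fa alpha0 phi_sv fE; apply: (reg_var_renewal_regular_decay fa (reg_var_mass phi_sv fE)).
lra.
Qed.

(** * The law of the first renewal of a transient renewal sequence *)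

(** The sum of the series with nonnegative terms [x], as a supremum. *)
Definition total_mass (R : realType) (x : nat -> R) (G : R) : Prop :=
  (forall n, psum x n <= G) /\
  forall eps : R, 0 < eps -> exists M, G - eps <= psum x M.

Section TransientRatio.
Variable R : realType.
Implicit Types x z a b : nat -> R.

Lemma total_mass_exists x (B : R) : (forall n, psum x n <= B) -> exists G, total_mass x G.
Proof.
move=> xB; have S0 : has_sup (range (psum x)).
  by split; [exists (psum x 0); exists 0%N | exists B => _ [n _ <-]].
exists (sup (range (psum x))); split.
  by move=> n; apply: (sup_upper_bound S0); exists n.
move=> eps eps0; have [_ [M _ <-] h] := sup_adherent eps0 S0.
by exists M; exact: ltW.
Qed.

(** Finitely many indices of [x] carry almost all of its mass, and face values of
    [z] close to the limit. *)
Lemma conv_cvg x z (G Z l : R) : (forall n, 0 <= x n) -> total_mass x G ->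
  (forall n, `|z n| <= Z) -> z @ \oo --> l -> conv x z @ \oo --> G * l.
Proof.
move=> x0 [xG Gx] zZ /cvgrPdist_le zl; apply/cvgrPdist_le => eps eps0.
have G0 : 0 <= G by apply: le_trans (xG 0%N); rewrite psum0.
have Z0 : 0 <= Z by apply: le_trans (zZ 0%N).
have D0 : 0 < G + Z + `|l| + 1 by have := normr_ge0 l; lra.
pose eta := eps / (G + Z + `|l| + 1).
have eta0 : 0 < eta by rewrite divr_gt0.
have etaE : eta * (G + Z + `|l| + 1) = eps by rewrite divfK// gt_eqF.
have [M HM] := Gx _ eta0; have [N _ HN] := zl _ eta0.
exists (N + M)%N => // n /= Nn; have Mn : (M <= n)%N by rewrite (leq_trans (leq_addl _ _) Nn).
rewrite convE (@big_cat_nat _ _ _ M.+1)//=.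
set S1 := \sum_(0 <= i < M.+1) _; set S2 := \sum_(M.+1 <= i < n.+1) _.
have S1E : `|psum x M * l - S1| <= eta * G.
  rewrite psumE mulr_suml -sumrB (le_trans (ler_norm_sum _ _ _))//.
  apply: (@le_trans _ _ (\sum_(0 <= i < M.+1) eta * x i)).
    rewrite !big_nat; apply: ler_sum => i /andP[_ iM].
    rewrite -mulrBr normrM (ger0_norm (x0 _)) mulrC ler_wpM2r//.
    by apply: HN => /=; move: Nn iM; clear; lia.
  by rewrite -mulr_sumr -psumE ler_wpM2l ?(ltW eta0)//; exact: xG.
have S2E : `|S2| <= eta * Z.
  apply: (le_trans (ler_norm_sum _ _ _)).
  apply: (@le_trans _ _ (\sum_(M.+1 <= i < n.+1) x i * Z)).
    by apply: ler_sum => i _; rewrite normrM (ger0_norm (x0 _)) ler_wpM2l.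
  rewrite -mulr_suml sum_nat_psum// ler_wpM2r//.
  by have := xG n; lra.
have GE : `|(G - psum x M) * l| <= eta * `|l|.
  rewrite normrM ler_wpM2r// ger0_norm; last by rewrite subr_ge0.
  by move: HM; lra.
have -> : G * l - (S1 + S2) = (G - psum x M) * l + (psum x M * l - S1) - S2 by ring.
rewrite -etaE (le_trans (ler_normB _ _))//.
have := ler_normD ((G - psum x M) * l) (psum x M * l - S1); lra.
Qed.

Lemma regular_decayM a b : (forall n, 0 <= a n) -> (forall n, 0 <= b n) ->
  regular_decay a -> regular_decay b -> regular_decay (a \* b).
Proof.
move=> a0 b0 [[N1 a_gt0] a_step [A [N2 a_dom]]] [[N3 b_gt0] b_step [B [N4 b_dom]]].
split.
- exists (N1 + N3)%N => n Nn /=; rewrite mulr_gt0 ?a_gt0 ?b_gt0//.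
    exact: leq_trans (leq_addr _ _) Nn.
  exact: leq_trans (leq_addl _ _) Nn.
- move=> eps eps0; pose eta : R := Num.min (eps / 3) 1.
  have eta0 : 0 < eta by rewrite lt_min ltr01 divr_gt0.
  have eta1 : eta <= 1 by rewrite ge_min lexx orbT.
  have etaE : 3 * eta <= eps by rewrite mulrC -ler_pdivlMr// ge_min lexx.
  have [M1 H1] := a_step _ eta0; have [M2 H2] := b_step _ eta0.
  exists (M1 + M2)%N => n Nn /=.
  have {}H1 := H1 n (leq_trans (leq_addr _ _) Nn).
  have {}H2 := H2 n (leq_trans (leq_addl _ _) Nn).
  have -> : a n.+1 * b n.+1 - a n * b n = (a n.+1 - a n) * b n.+1 + a n * (b n.+1 - b n).
    by ring.
  apply: (le_trans (ler_normD _ _)); rewrite !normrM (ger0_norm (a0 n)) (ger0_norm (b0 n.+1)).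
  have bb : b n.+1 <= 2 * b n.
    have := ler_norm (b n.+1 - b n); have : eta * b n <= 1 * b n by rewrite ler_wpM2r.
    lra.
  have h1 : `|a n.+1 - a n| * b n.+1 <= eta * a n * (2 * b n) by apply: ler_pM.
  have h2 : a n * `|b n.+1 - b n| <= a n * (eta * b n) by rewrite ler_wpM2l.
  have h3 : 3 * eta * (a n * b n) <= eps * (a n * b n) by rewrite ler_wpM2r// mulr_ge0.
  lra.
- exists (`|A| * `|B|), (N2 + N4)%N => k n Nk kn /=; rewrite mulrACA; apply: ler_pM => //.
    apply: (le_trans (a_dom k n (leq_trans (leq_addr _ _) Nk) kn)).
    by rewrite ler_wpM2r// ler_norm.
  apply: (le_trans (b_dom k n (leq_trans (leq_addl _ _) Nk) kn)).
  by rewrite ler_wpM2r// ler_norm.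
Qed.

Lemma regular_decay_long_tailed u : (forall n, 0 <= u n) -> regular_decay u ->
  forall M (eps : R), 0 < eps -> exists N, forall n, (N <= n)%N -> forall j, (j <= M)%N ->
  `|u (n - j)%N - u n| <= eps * u n.
Proof.
move=> u0 [_ step _]; elim=> [|M IH] eps eps0.
  exists 0%N => n _ j; rewrite leqn0 => /eqP ->.
  by rewrite subn0 subrr normr0 mulr_ge0// ltW.
pose del : R := Num.min (eps / 2) 1.
have del0 : 0 < del by rewrite lt_min ltr01 divr_gt0.
have del1 : del <= 1 by rewrite ge_min lexx orbT.
have delE : 2 * del <= eps by rewrite mulrC -ler_pdivlMr// ge_min lexx.
pose eta : R := Num.min (eps / 8) (1 / 2).
have eta0 : 0 < eta by rewrite lt_min !divr_gt0.
have eta1 : eta <= 1 / 2 by rewrite ge_min lexx orbT.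
have etaE : 8 * eta <= eps by rewrite mulrC -ler_pdivlMr// ge_min lexx.
have [N1 H1] := IH _ del0; have [N2 H2] := step _ eta0.
exists (N1 + N2 + M.+1)%N => n Nn j; rewrite leq_eqVlt => /orP[/eqP ->|]; last first.
  rewrite ltnS => jM; have n1 : (N1 <= n)%N by move: Nn; clear; lia.
  apply: (le_trans (H1 n n1 j jM)); rewrite ler_wpM2r//; lra.
have [n1 n2 nM] : [/\ (N1 <= n)%N, (N2 <= n - M.+1)%N & (M < n)%N].
  by move: Nn; clear; split; lia.
have h1 := H1 n n1 M (leqnn _); have h2 := H2 _ n2.
rewrite subnSK// in h2; move: h1 h2 (u0 (n - M.+1)%N) (u0 n) (u0 (n - M)%N).
move: (u _) (u _) (u _) => y z x h1 h2 y0 z0 x0.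
have e1 : eta * y <= 1 / 2 * y by rewrite ler_wpM2r.
have e2 : del * z <= 1 * z by rewrite ler_wpM2r.
move: h1 h2; rewrite !ler_norml => /andP[p1 p2] /andP[p3 p4].
have y4 : y <= 4 * z by lra.
have e3 : eta * y <= eta * (4 * z) by rewrite ler_wpM2l// ltW.
have e4 : 8 * eta * z <= eps * z by rewrite ler_wpM2r.
have e5 : 2 * del * z <= eps * z by rewrite ler_wpM2r.
by apply/andP; split; lra.
Qed.

Variables (g u : nat -> R) (U : R).
Hypotheses (gu : renewal_pair g u) (u_decay : regular_decay u) (uU : total_mass u U).
Let u0 := ren_ge0 gu.
Let g0 := rp_ge0 gu.

Lemma first_le_renewal n : g n <= u n.
Proof.
case: n => [|n]; first by rewrite (rp_f0 gu) u0.
rewrite (renS gu) big_ord_recr/= subnn (ren0 gu) mulr1 lerDr.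
by apply: sumr_ge0 => i _; rewrite mulr_ge0.
Qed.

(** Letting [n] tend to infinity in [conv u (tail g) n = 1]. *)
Lemma total_mass_defect G : total_mass g G -> U * (1 - G) = 1.
Proof.
move=> [gG Gg].
have tl : tail g @ \oo --> (1 - G : R).
  apply/cvgrPdist_le => eps eps0; have [M HM] := Gg _ eps0.
  exists M => // n /= Mn; rewrite /tail opprB addrC addrA subrK distrC.
  have := gG n; have := psum_le g0 Mn; rewrite ler_norml => h1 h2.
  by apply/andP; split; lra.
have tb n : `|tail g n| <= 1.
  rewrite ger0_norm ?(tail_ge0 gu)// -(tail0 gu); exact: (tail_le gu).
have := conv_cvg u0 uU tb tl; rewrite (conv_ren_tail gu) => h.
exact: (cvg_unique _ h (cvg_cst _)).
Qed.

(** Dividing [u n = conv g u n] by [u n] after cutting the sum in three: small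
    indices of [g] give [G], small indices of [u] give [conv u y n], and the middle
    is negligible. *)
Lemma conv_ratio_cvg G : total_mass g G -> conv u (fun n => g n / u n) @ \oo --> (1 - G : R).
Proof.
move=> [gG Gg]; set y := fun n => g n / u n.
have y01 n : 0 <= y n <= 1.
  rewrite divr_ge0//= /y; have [->|un] := eqVneq (u n) 0; first by rewrite invr0 mulr0.
  by rewrite ler_pdivrMr ?mul1r ?first_le_renewal// lt_def un u0.
have [[N0 u_gt0] _ [C [N1 u_dom]]] := u_decay.
have [uU1 uU2] := uU.
have U1 : 1 <= U by apply: le_trans (uU1 0%N); rewrite psum0 (ren0 gu).
apply/cvgrPdist_le => eps eps0.
(* [K * eta] is the sum of the errors made on the pieces of the convolution. *)
pose K := 2 + 2 * `|C| + 1 + U.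
have K0 : 0 < K by rewrite /K; have := normr_ge0 C; lra.
pose eta := eps / K.
have eta0 : 0 < eta by rewrite divr_gt0.
have etaE : eta * K = eps by rewrite divfK// gt_eqF.
have [M1 HM1] := uU2 _ eta0; have [M2 HM2] := Gg _ eta0.
pose M := (M1 + M2)%N.
have uM : U - eta <= psum u M by rewrite (le_trans HM1)// psum_le// leq_addr.
have gM : G - eta <= psum g M by rewrite (le_trans HM2)// psum_le// leq_addl.
have [N2 long] := regular_decay_long_tailed u0 u_decay M eta0.
exists (N0 + 2 * N1 + N2 + 2 * M + 2)%N => // n /= Nn.
have [n0 n1 n2 nM] : [/\ (N0 <= n)%N, (2 * N1 <= n)%N, (N2 <= n)%N & (2 * M + 2 <= n)%N].
  by move: Nn; clear; split; lia.
have un := u_gt0 n n0.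
have eun : 0 <= eta * u n := mulr_ge0 (ltW eta0) (ltW un).
(* One of [k] and [n - k] is at least [n / 2], where [u] is at most [C * u n];
   the sum over the other one is the tail of a convergent series. *)
have mid : \sum_(M.+1 <= k < n - M) g k * u (n - k)%N <= 2 * `|C| * eta * u n.
  apply: (@le_trans _ _ (\sum_(M.+1 <= k < n - M) (u k + u (n - k)%N) * (`|C| * u n))).
    rewrite !big_nat; apply: ler_sum => k /andP[Mk kn].
    apply: (@le_trans _ _ (u k * u (n - k)%N)); first by rewrite ler_wpM2r// first_le_renewal.
    have Cu j : (n <= 2 * j)%N -> (j <= n)%N -> u j <= `|C| * u n.
      move=> nj jn; apply: (@le_trans _ _ (C * u n)); last by rewrite ler_wpM2r ?ler_norm// ltW.
      by apply: u_dom; [move: n1 nj; clear; lia | rewrite jn nj].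
    have CU : 0 <= `|C| * u n by rewrite mulr_ge0// ltW.
    have [kn2|kn2] := leqP n (2 * k).
      have kn' : (k <= n)%N by move: kn; clear; lia.
      have := ler_wpM2r (u0 (n - k)) (Cu k kn2 kn').
      have := mulr_ge0 (u0 k) CU; lra.
    have nk : (n <= 2 * (n - k))%N by move: kn2; clear; lia.
    have := ler_wpM2l (u0 k) (Cu _ nk (leq_subr _ _)).
    have := mulr_ge0 (u0 (n - k)%N) CU; lra.
  have tl : \sum_(M.+1 <= k < n - M) u k <= eta.
    have Mn : (M <= (n - M).-1)%N by move: nM; clear; lia.
    have -> : (n - M = (n - M).-1.+1)%N by move: nM; clear; lia.
    by rewrite sum_nat_psum//; have := uU1 (n - M).-1; lra.
  rewrite -mulr_suml big_split/=.
  have -> : \sum_(M.+1 <= k < n - M) u (n - k)%N = \sum_(M.+1 <= k < n - M) u k.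
    rewrite big_nat_rev/= !big_nat; apply: eq_bigr => i /andP[iM iN].
    by congr u; move: iM iN nM; clear; lia.
  have -> : 2 * `|C| * eta * u n = 2 * eta * (`|C| * u n) by ring.
  by rewrite ler_wpM2r ?mulr_ge0 ?(ltW un)//; lra.
have split_un : u n = \sum_(0 <= k < M.+1) g k * u (n - k)%N +
    \sum_(M.+1 <= k < n - M) g k * u (n - k)%N + \sum_(0 <= j < M.+1) u j * g (n - j)%N.
  have -> : u n = conv g u n.
    have n_gt0 : (0 < n)%N by move: nM; clear; lia.
    rewrite {1}(rp_eq gu) /= /delta0; case: (n) n_gt0 => // k _; by rewrite add0r.
  rewrite convE (@big_cat_nat _ _ _ M.+1)//=; last by move: nM; clear; lia.
  rewrite -addrA; congr (_ + _).
  rewrite (@big_cat_nat _ _ _ (n - M))//=; [|by move: nM; clear; lia..].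
  congr (_ + _); rewrite -{1}[(n - M)%N]add0n big_addn.
  have -> : (n.+1 - (n - M) = M.+1)%N by move: nM; clear; lia.
  rewrite big_nat_rev/= add0n !big_nat; apply: eq_bigr => i /andP[_ iM].
  by rewrite mulrC; congr (u _ * g _); move: iM nM; clear; lia.
set S1 := \sum_(0 <= k < M.+1) g k * _ in split_un.
set S2 := \sum_(M.+1 <= k < n - M) _ in split_un mid.
set S3 := \sum_(0 <= j < M.+1) u j * _ in split_un.
have S20 : 0 <= S2 by apply: sumr_ge0 => i _; rewrite mulr_ge0.
have S1E : `|S1 - psum g M * u n| <= eta * u n.
  rewrite psumE mulr_suml -sumrB (le_trans (ler_norm_sum _ _ _))//.
  apply: (@le_trans _ _ (\sum_(0 <= k < M.+1) g k * (eta * u n))).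
    rewrite !big_nat; apply: ler_sum => k /andP[_ kM].
    by rewrite -mulrBr normrM (ger0_norm (g0 _)) ler_wpM2l// long.
  rewrite -mulr_suml -psumE ler_piMl//.
  exact: (rp_le1 gu).
pose Z := \sum_(0 <= j < M.+1) u j * y (n - j)%N.
have ZE : `|Z * u n - S3| <= eta * U * u n.
  rewrite /Z mulr_suml -sumrB (le_trans (ler_norm_sum _ _ _))//.
  apply: (@le_trans _ _ (\sum_(0 <= j < M.+1) u j * (eta * u n))).
    rewrite !big_nat; apply: ler_sum => j /andP[_ jM].
    have yE : g (n - j)%N = y (n - j)%N * u (n - j)%N.
      rewrite /y; have [un0|un0] := eqVneq (u (n - j)%N) 0; last by rewrite divfK.
      rewrite un0 mulr0; apply/eqP; rewrite eq_le g0 andbT -un0.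
      exact: first_le_renewal.
    rewrite yE -mulrA -mulrBr -mulrBr normrM (ger0_norm (u0 _)) ler_wpM2l//.
    have /andP[y0 y1] := y01 (n - j)%N; rewrite normrM (ger0_norm y0) distrC.
    by rewrite (le_trans (ler_piMl _ y1))// long.
  have -> : eta * U * u n = U * (eta * u n) by ring.
  by rewrite -mulr_suml -psumE ler_wpM2r.
have nM1 : (M.+1 <= n.+1)%N by move: nM; clear; lia.
rewrite convE (@big_cat_nat _ _ _ M.+1)//= -/Z.
set W := \sum_(M.+1 <= j < n.+1) _.
have WE : 0 <= W <= eta.
  apply/andP; split.
    by apply: sumr_ge0 => i _; rewrite mulr_ge0//; case/andP: (y01 (n - i)%N).
  apply: (@le_trans _ _ (\sum_(M.+1 <= j < n.+1) u j)).
    by apply: ler_sum => i _; rewrite ler_piMr//; case/andP: (y01 (n - i)%N).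
  by rewrite sum_nat_psum//; have := uU1 n; lra.
have GE : `|(G - psum g M) * u n| <= eta * u n.
  rewrite normrM (gtr0_norm un) ler_wpM2r ?(ltW un)// ger0_norm; last by rewrite subr_ge0.
  by move: gM; lra.
have WU : 0 <= W * u n <= eta * u n.
  by case/andP: WE => w0 w1; rewrite mulr_ge0 ?(ltW un)//= ler_wpM2r ?(ltW un).
rewrite -(ler_pM2r un) -[X in _ * X <= _](gtr0_norm un) -normrM.
rewrite -etaE /K ler_norml.
move: S1E ZE GE WU mid S20; rewrite !ler_norml.
move=> /andP[a1 a2] /andP[a3 a4] /andP[a5 a6] /andP[a7 a8] a9 a10.
apply/andP; split; rewrite /S1; lra.
Qed.

(** [delta0 - g] is the convolution inverse of [u], so [conv u y] determines [y]. *)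
Lemma first_renewal_ratio : g n / (1 / U ^+ 2 * u n) @[n --> \oo] --> (1 : R).
Proof.
have [G gG] := total_mass_exists (rp_le1 gu).
have UG := total_mass_defect gG.
have U0 : U != 0 by apply: contra_eq_neq UG => ->; rewrite mul0r eq_sym oner_eq0.
have GE : 1 - G = U^-1 by apply: (mulfI U0); rewrite UG mulfV.
set y := fun n => g n / u n.
have zl := conv_ratio_cvg gG; rewrite -/y in zl.
have zb n : `|conv u y n| <= U.
  have y01 k : 0 <= y k <= 1.
    rewrite divr_ge0//= /y; have [->|un] := eqVneq (u k) 0; first by rewrite invr0 mulr0.
    by rewrite ler_pdivrMr ?mul1r ?first_le_renewal// lt_def un u0.
  rewrite ger0_norm; last first.
    by apply: conv_ge0 => // k; case/andP: (y01 k).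
  apply: le_trans (uU.1 n); apply: ler_sum => i _; rewrite ler_piMr//.
  by case/andP: (y01 (n - i)%N).
have yE : y = conv u y \- conv g (conv u y).
  apply/funext => n /=; rewrite convA; move: (rp_eq gu) => /(congr1 (fun x => conv x y n)).
  by rewrite convDl conv_delta0 /= => ->; rewrite addrK.
have yl : y @ \oo --> (U^-1 ^+ 2 : R).
  have -> : U^-1 ^+ 2 = (1 - G) - G * (1 - G) by rewrite -GE; ring.
  rewrite yE; apply: cvgB => //; exact: conv_cvg.
have -> : (fun n => g n / (1 / U ^+ 2 * u n)) = (fun n => U ^+ 2 * y n).
  apply/funext => n; rewrite /y; have [->|un] := eqVneq (u n) 0.
    by rewrite !(mulr0, invr0).
  by field; rewrite un U0.
have -> : 1 = U ^+ 2 * (U^-1 ^+ 2) :> R by rewrite exprVn mulfV// expf_neq0.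
exact: cvgMl_tmp.
Qed.

End TransientRatio.

(** * Probability of visiting given sites *)

Section RenewalSequence.
Variable R : realType.

(** The values of the renewal sequence from index [n] down to 0: the recursion
    refers to all previous values. *)
Fixpoint renewal_rev (f : nat -> R) (n : nat) : seq R :=
  if n is k.+1 then
    \sum_(i < n) f i.+1 * nth 0 (renewal_rev f k) i :: renewal_rev f k
  else [:: 1].

Lemma renewal_exists (f : nat -> R) : (forall n, 0 <= f n) -> f 0%N = 0 ->
  (forall n, psum f n <= 1) -> exists a, renewal_pair f a.
Proof.
move=> f_ge0 f0 f_le1; pose a n := head 0 (renewal_rev f n).
have nthE n i : (i <= n)%N -> nth 0 (renewal_rev f n) i = a (n - i)%N.
  elim: n i => [|n IH] [|i] //=; rewrite ltnS => iN.
  by rewrite IH// subSS.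
exists a; split => //; apply/funext => -[|n].
  by rewrite /= /conv big_ord1 f0 mul0r addr0 /delta0 eqxx.
rewrite /= {1}/delta0 /= add0r /conv big_ord_recl f0 mul0r add0r.
by rewrite {1}/a /=; apply: eq_bigr => i _; rewrite nthE ?subSS// -ltnS.
Qed.

(** The probability that a renewal process with renewal sequence [u] and started
    at [p] passes through all sites of the sorted list [s]. *)
Fixpoint gaps (u : nat -> R) (p : nat) (s : seq nat) : R :=
  if s is t :: s' then u (t - p)%N * gaps u t s' else 1.

Lemma gapsM (u v : nat -> R) p s : gaps (u \* v) p s = gaps u p s * gaps v p s.
Proof. by elim: s p => [|t s IH] p /=; rewrite ?mulr1// IH mulrACA. Qed.

End RenewalSequence.

Section Visits.
Context d (T : measurableType d) (R : realType) (P : probability T R).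
Variable xi : nat -> {RV P >-> \bar R}.
Hypothesis xi_val : forall i w,
  xi i w = +oo%E \/ exists2 n, (1 <= n)%N & xi i w = (n%:R)%:E.
Hypothesis xi_indep : mutually_independent xi.
Hypothesis xi_ident : identically_distributed xi.

Definition step_sum k l w : \bar R := (\sum_(i < l) xi (k + i)%N w)%E.

(** The sites of [s] are visited by the walk that starts at [p] and whose steps are
    [xi k], [xi (k + 1)], and so on. *)
Definition visits k p (s : seq nat) : set T :=
  [set w | forall t, t \in s -> exists l, step_sum k l w = ((t - p)%N%:R)%:E].

Definition steps (y : seq nat) : set T :=
  [set w | forall i, (i < size y)%N -> xi i w = ((nth 0%N y i)%:R)%:E].

Let f n : R := fine (P [set w | xi 0%N w = (n%:R)%:E]).

Lemma xi_ge0 i w : (0 <= xi i w)%E.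
Proof. by have [->//|[n _ ->]] := xi_val i w; rewrite lee_fin. Qed.

Lemma step_sum_ge0 k l w : (0 <= step_sum k l w)%E.
Proof. by apply: sume_ge0 => i _; exact: xi_ge0. Qed.

Lemma step_sumS k l w : step_sum k l.+1 w = (xi k w + step_sum k.+1 l w)%E.
Proof.
rewrite /step_sum big_ord_recl addn0; congr (_ + _)%E.
by apply: eq_bigr => i _; rewrite addnS.
Qed.

Lemma step_sum_split k l w n : (0 < n)%N -> step_sum k l w = (n%:R)%:E ->
  exists j l', [/\ (1 <= j <= n)%N, xi k w = (j%:R)%:E &
    step_sum k.+1 l' w = ((n - j)%N%:R)%:E].
Proof.
case: l => [|l] n0.
  by rewrite /step_sum big_ord0 => -[] /esym/eqP; rewrite pnatr_eq0 -leqn0 leqNgt n0.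
rewrite step_sumS; have := step_sum_ge0 k.+1 l w.
have [->|[j j1 ->]] := xi_val k w.
  by case: (step_sum _ _ _).
case E : (step_sum _ _ _) => [r| |] //; rewrite lee_fin => r0 [] jr.
have jn : (j <= n)%N by rewrite -(ler_nat R) -jr lerDl.
exists j, l; split; rewrite ?j1 ?jn//.
by rewrite E natrB// -jr addrAC subrr add0r.
Qed.

Lemma measurable_step_sum k l (n : nat) : measurable [set w | step_sum k l w = (n%:R)%:E].
Proof.
have h : measurable_fun setT (fun w => step_sum k l w).
  by apply: emeasurable_sum => i; exact: measurable_funPT.
by rewrite -[X in measurable X]setTI; exact: (h _ _ (emeasurable_set1 _)).
Qed.

Lemma measurable_visits k p s : measurable (visits k p s).
Proof.
rewrite (_ : visits k p s = \bigcap_(t in [set` s]) \bigcup_l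
  [set w | step_sum k l w = ((t - p)%N%:R)%:E]); last first.
  by apply/seteqP; split => w h t ts; have [l] := h t ts; exists l.
apply: fin_bigcap_measurable; first exact: finite_seq.
by move=> t _; apply: bigcup_measurable => l _; exact: measurable_step_sum.
Qed.

Lemma measurable_xi i (x : \bar R) : measurable [set w | xi i w = x].
Proof.
have h : measurable_fun setT (xi i) by exact: measurable_funPT.
by rewrite -[X in measurable X]setTI; exact: (h _ _ (emeasurable_set1 _)).
Qed.

Lemma measurable_steps y : measurable (steps y).
Proof.
rewrite (_ : steps y = \bigcap_(i in [set` iota 0 (size y)])
  [set w | xi i w = ((nth 0%N y i)%:R)%:E]); last first.
  apply/seteqP; split => w h i /=; first by rewrite mem_iota => /h.
  by move=> iy; apply: h; rewrite /= mem_iota.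
apply: fin_bigcap_measurable; first exact: finite_seq.
by move=> t _; exact: measurable_xi.
Qed.

Lemma probability_steps y : P (steps y) = (\prod_(j <- y) f j)%:E.
Proof.
pose J := [fset i in iota 0 (size y)]%fset.
pose A i : set (\bar R) := [set ((nth 0%N y i)%:R)%:E].
have -> : steps y = \bigcap_(i in [set` J]) (xi i @^-1` A i).
  apply/seteqP; split => w h i /=; first by rewrite !inE mem_iota /= => iy; exact: h.
  by move=> iy; apply: h; rewrite /= !inE mem_iota.
rewrite xi_indep => [|i]; last exact: emeasurable_set1.
have perm : perm_eq J (iota 0 (size y)).
  by apply: uniq_perm; rewrite ?iota_uniq// => i; rewrite !inE.
rewrite (perm_big _ perm)/= [in RHS](big_nth 0%N) /index_iota subn0.
elim: (iota _ _) => [|i r IH]; first by rewrite !big_nil.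
rewrite !big_cons EFinM -IH; congr (_ * _)%E.
have := xi_ident i (emeasurable_set1 ((nth 0%N y i)%:R)%:E).
rewrite /f fineK; last by apply: fin_num_measure; exact: measurable_xi.
exact.
Qed.

Lemma steps_rcons y n :
  steps (rcons y n) = steps y `&` [set w | xi (size y) w = (n%:R)%:E].
Proof.
apply/seteqP; split => w.
  move=> h; split => [i iy|] /=.
    by rewrite h ?size_rcons ?ltnS 1?ltnW// nth_rcons iy.
  by rewrite h ?size_rcons// nth_rcons ltnn eqxx.
move=> [h hn] i; rewrite size_rcons ltnS leq_eqVlt nth_rcons => /orP[/eqP ->|iy].
  by rewrite ltnn eqxx.
by rewrite iy h.
Qed.

(** As [t] is the smallest site to visit and is not yet reached, the first step
    does not go beyond it. *)
Lemma visits_first_step k p t s : (p < t)%N -> path leq t s ->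
  visits k p (t :: s) = \bigcup_(i < (t - p)%N)
    ([set w | xi k w = (i.+1%:R)%:E] `&` visits k.+1 (p + i.+1) (t :: s)).
Proof.
move=> pt ts; have st r : r \in t :: s -> (t <= r)%N.
  by rewrite inE => /orP[/eqP ->//|]; apply/allP: r; exact: order_path_min leq_trans ts.
apply/seteqP; split => w.
  move=> h; have [l /step_sum_split[|j [l' [/andP[j1 jt] xj _]]]] := h t (mem_head _ _).
    by rewrite subn_gt0.
  exists j.-1; first by rewrite /= prednK.
  split => [|r rs]; rewrite ?prednK//.
  have [l0 /step_sum_split[|j' [l1 [_ xj' sj]]]] := h r rs.
    by rewrite subn_gt0 (leq_trans pt)// st.
  have jj : j' = j by move: xj'; rewrite xj => -[] /eqP; rewrite eqr_nat => /eqP.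
  by exists l1; rewrite sj jj subnDA.
move=> [i /= it [xik h]] r rs; have [l hl] := h r rs.
exists l.+1; rewrite step_sumS hl xik -EFinD -natrD subnDA subnKC//.
by move: (st r rs) it pt; clear; lia.
Qed.

Variable a : nat -> R.
Hypothesis fa : renewal_pair f a.

(** First-step decomposition, which reproduces the renewal equation of [a].  The
    cylinder [steps y] of the past steps is carried along, so that the independence
    of the steps is only ever applied to cylinders. *)
Lemma probability_visits p s y : path leq p s ->
  P (steps y `&` visits (size y) p s) = (\prod_(j <- y) f j * gaps a p s)%:E.
Proof.
elim: s p y => [|t s IHs] p y /=.
  move=> _; rewrite (_ : visits _ _ _ = setT); last by apply/seteqP; split.
  by rewrite setIT probability_steps mulr1.
move=> /andP[pt ts]; elim/ltn_ind: (t - p)%N {-2}p (erefl (t - p)%N) pt y => n IH q nq qt y.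
have [n0|n0] := posnP n.
  have qtE : q = t by move: nq qt; rewrite n0; clear; lia.
  rewrite qtE subnn (ren0 fa) mul1r -IHs//; congr (P (_ `&` _)).
  apply/seteqP; split => w h r rs; first by apply: h; rewrite inE rs orbT.
  move: rs; rewrite inE => /orP[/eqP ->|]; last exact: h.
  by exists 0%N; rewrite /step_sum big_ord0 subnn.
have qt' : (q < t)%N by move: nq n0 qt; clear; lia.
pose F i := steps (rcons y i.+1) `&` visits (size (rcons y i.+1)) (q + i.+1) (t :: s).
have -> : steps y `&` visits (size y) q (t :: s) = \big[setU/set0]_(i < n) F i.
  rewrite visits_first_step// -nq setI_bigcupr -bigcup_mkord.
  by apply: eq_bigcupr => i _; rewrite /F steps_rcons size_rcons setIA.
have mF i : measurable (F i).
  by apply: measurableI; [exact: measurable_steps | exact: measurable_visits].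
rewrite measure_semi_additive//.
- rewrite (eq_bigr (fun i : 'I_n => (\prod_(j <- y) f j * gaps a t s * (f i.+1 * a (n.-1 - i)%N))%:E)).
    rewrite sumEFin -mulr_sumr; congr (_%:E).
    have -> : a (t - q)%N = \sum_(i < n) f i.+1 * a (n.-1 - i)%N.
      by rewrite nq; case: (n) n0 => // m _; rewrite (renS fa).
    by rewrite -mulrA; congr (_ * _); rewrite mulrC.
  move=> i _; have iN := ltn_ord i.
  have lt_in : (n - i.+1 < n)%N by move: iN; clear; lia.
  have qi : (t - (q + i.+1) = n - i.+1)%N by rewrite subnDA nq.
  have qit : (q + i.+1 <= t)%N by move: iN nq qt'; clear; lia.
  rewrite [LHS](IH _ lt_in _ qi qit (rcons y i.+1)).
  rewrite -cats1 big_cat/= big_seq1; congr (_%:E).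
  have -> : (t - (q + i.+1) = n.-1 - i)%N by move: iN nq; clear; lia.
  by ring.
- apply/trivIsetP => i j _ _ ij; rewrite /F !steps_rcons.
  apply/seteqP; split => // w [[[_ /= xi1] _] [[_ /= xi2] _]].
  by move: xi2; rewrite xi1 => -[] /eqP; rewrite eqr_nat eqSS (negbTE ij).
- exact: bigsetU_measurable.
Qed.

End Visits.

(** * Renewal processes and regenerative sets *)

Lemma renewal_process_law d (T : measurableType d) (R : realType) (P : probability T R)
    (tau : nat -> {RV P >-> \bar R}) : renewal_process tau ->
  exists2 a, renewal_pair (fun n => fine (P [set w | tau 1%N w = (n%:R)%:E])) a &
    forall s, path leq 0 s ->
      P [set w | forall t, t \in s -> renewal_set tau w t] = (gaps a 0 s)%:E.
Proof.
move=> [xi [xi_val indep ident tauE]].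
pose f n : R := fine (P [set w | xi 0%N w = (n%:R)%:E]).
have -> : (fun n => fine (P [set w | tau 1%N w = (n%:R)%:E])) = f.
  apply/funext => n; congr (fine (P _)); apply/seteqP; split => w /=;
    by rewrite tauE big_ord1.
pose F n := [set w | xi 0%N w = (n%:R)%:E].
have mF n : measurable (F n) by exact: measurable_xi.
have fE n : P (F n) = (f n)%:E.
  by symmetry; apply: fineK; apply: fin_num_measure; exact: mF.
have f_ge0 n : 0 <= f n by rewrite -lee_fin -fE.
have f0 : f 0%N = 0.
  rewrite /f (_ : [set w | _] = set0) ?measure0//; apply/seteqP; split => // w /=.
  have [->//|[n n1 ->]] := xi_val 0%N w.
  by move=> [] /eqP; rewrite pnatr_eq0 => /eqP n0; rewrite n0 in n1.
have f_le1 n : psum f n <= 1.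
  have mU : measurable (\big[setU/set0]_(i < n.+1) F i) by exact: bigsetU_measurable.
  have := probability_le1 P mU; rewrite measure_semi_additive//.
    by rewrite (eq_bigr (fun i : 'I_n.+1 => (f i)%:E)) => [|i _]; rewrite ?sumEFin// -fE.
  apply/trivIsetP => i j _ _ ij; apply/seteqP; split => // w [].
  by rewrite /F /= => -> [] /eqP; rewrite eqr_nat (negbTE ij).
have [a fa] := renewal_exists f_ge0 f0 f_le1.
exists a => // s s_sorted.
have := probability_visits xi_val indep ident fa [::] s_sorted; rewrite big_nil mul1r => <-.
congr (P _); apply/seteqP; split => w /=.
  move=> h; split => // t ts; have [k tk] := h t ts.
  by exists k; rewrite subn0 /step_sum -tk tauE.
move=> [_ h] t ts; have [k tk] := h t ts.
by exists k; rewrite subn0 in tk; rewrite tauE -tk.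
Qed.

Section FirstPoint.
Variable R : realType.
Implicit Types S : set nat.

Lemma first_point_min S n : (1 <= n)%N -> S n -> (forall i, (1 <= i < n)%N -> ~ S i) ->
  first_point R S = (n%:R)%:E.
Proof.
move=> n1 Sn Smin; apply/eqP; rewrite eq_le; apply/andP; split.
  by apply: ereal_inf_lbound; exists n.
apply: le_ereal_inf_tmp => _ [m [m1 Sm] <-]; rewrite lee_fin ler_nat leqNgt.
by apply/negP => mn; apply: (Smin m); rewrite ?m1.
Qed.

Lemma first_point_cases S : (forall n, (1 <= n)%N -> ~ S n) \/
  exists n, [/\ (1 <= n)%N, S n & forall i, (1 <= i < n)%N -> ~ S i].
Proof.
have [[n Sn]|none] := pselect (exists n, (1 <= n)%N && `[< S n >]); last first.
  left => n n1 Sn; apply: none; exists n; rewrite n1; exact/asboolP.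
right; have ex : exists n, (1 <= n)%N && `[< S n >] by exists n.
case: (ex_minnP ex) => m /andP[m1 /asboolP Sm] mmin.
exists m; split => // i /andP[i1 im] Si; have := mmin i; rewrite i1 => /(_ (asboolT Si)).
by rewrite leqNgt im.
Qed.

Lemma first_point_eq S n : first_point R S = (n%:R)%:E <->
  [/\ (1 <= n)%N, S n & forall i, (1 <= i < n)%N -> ~ S i].
Proof.
split => [|[]]; last exact: first_point_min.
have [none|[m [m1 Sm mmin]]] := first_point_cases S.
  rewrite /first_point (_ : [set _ | _ in _] = set0) ?ereal_inf0//.
  by apply/seteqP; split => // x [m [m1 Sm] _]; exact: none Sm.
rewrite (first_point_min m1 Sm mmin) => -[] /eqP; rewrite eqr_nat => /eqP <-.
by split.
Qed.

Lemma first_point_fin S : (first_point R S < +oo)%E <-> exists2 n, (1 <= n)%N & S n.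
Proof.
split => [|[n n1 Sn]].
  have [none|[m [m1 Sm _]]] := first_point_cases S; last by exists m.
  rewrite /first_point (_ : [set _ | _ in _] = set0) ?ereal_inf0//.
  by apply/seteqP; split => // x [m [m1 Sm] _]; exact: none Sm.
apply: (@le_lt_trans _ _ (n%:R)%:E); last exact: ltry.
by apply: ereal_inf_lbound; exists n.
Qed.

End FirstPoint.

(** A random set whose finite-dimensional probabilities are products of [u] over
    gaps.  Arguing from these probabilities covers the intersection of two renewal
    processes without constructing its inter-arrival times. *)
Section Regenerative.
Context d (T : measurableType d) (R : realType) (P : probability T R).
Variables (rho : T -> set nat) (u : nat -> R).
Hypothesis m_rho : forall n, measurable [set w | rho w n].
Hypothesis u_at0 : u 0%N = 1.
Hypothesis law : forall s, path leq 0 s ->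
  P [set w | forall t, t \in s -> rho w t] = (gaps u 0 s)%:E.

Definition avoids l (s : seq nat) : set T :=
  [set w | (forall i, (1 <= i <= l)%N -> ~ rho w i) /\ forall t, t \in s -> rho w t].

Let q l s : R := fine (P (avoids l s)).

Lemma measurable_avoids l s : measurable (avoids l s).
Proof.
rewrite (_ : avoids l s = (\bigcap_(i in [set` iota 1 l]) ~` [set w | rho w i]) `&`
   (\bigcap_(t in [set` s]) [set w | rho w t])); last first.
  apply/seteqP; split => w [h1 h2]; split => [i /= il|//].
    by apply: h1; rewrite mem_iota add1n ltnS in il.
  by apply: h1; rewrite /= mem_iota add1n ltnS.
apply: measurableI; apply: fin_bigcap_measurable => [|i _]; do ?exact: finite_seq.
  by apply: measurableC.
exact: m_rho.
Qed.

Lemma avoidsE l s : P (avoids l s) = (q l s)%:E.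
Proof. by rewrite /q fineK ?fin_num_measure//; exact: measurable_avoids. Qed.

(** Case distinction on whether [l.+1] belongs to [rho]. *)
Lemma avoidsS l s : q l.+1 s = q l s - q l (l.+1 :: s).
Proof.
suff h : q l s = q l.+1 s + q l (l.+1 :: s) by rewrite h addrK.
apply: EFin_inj; rewrite EFinD -!avoidsE.
rewrite -measure_semi_additive2; [|exact: measurable_avoids..| |].
- congr (P _); apply/seteqP; split => w.
    move=> [h1 h2]; have [rl|nrl] := pselect (rho w l.+1).
      by right; split => // t; rewrite inE => /orP[/eqP ->//|]; exact: h2.
    left; split => // i /andP[i1]; rewrite leq_eqVlt => /orP[/eqP ->//|il].
    by apply: h1; rewrite i1.
  case=> -[h1 h2]; split => //.
    by move=> i /andP[i1 il]; apply: h1; rewrite i1 (leq_trans il).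
  by move=> t ts; apply: h2; rewrite inE ts orbT.
- by apply: measurableU; exact: measurable_avoids.
- apply/seteqP; split => // w [[h1 _] [_ h2]].
  by apply: (h1 l.+1); [rewrite ltnS leqnn | exact/h2/mem_head].
Qed.

Lemma avoids0 s : path leq 0 s -> q 0 s = gaps u 0 s.
Proof.
move=> s_sorted; apply: EFin_inj; rewrite -avoidsE -law//; congr (P _).
by apply/seteqP; split => w /=; [case | move=> h; split => // -[]].
Qed.

(** Regeneration at [k]: given that [k] is a point, the points after [k] are independent
    of those before [k].  By [avoidsS], avoidance is an alternating
    combination of visit probabilities, for which the product form of [gaps] gives
    the factorization. *)
Lemma avoids_regenerate l k s : (l < k)%N -> path leq k s ->
  q l (k :: s) = q l [:: k] * gaps u k s.
Proof.
elim: l k s => [|l IH] k s lk ks.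
  by rewrite !avoids0 //= subn0 mulr1.
have lk' := ltnW lk.
have kk : path leq k [::] by [].
rewrite !avoidsS IH// (IH l.+1 (k :: s))//=; last by rewrite lk' ks.
rewrite (IH l.+1 [:: k])//=; last by rewrite lk'.
by ring.
Qed.

Definition first_law : nat -> R :=
  fun n => fine (P [set w | first_point R (rho w) = (n%:R)%:E]).

Lemma first_lawS n : first_law n.+1 = q n [:: n.+1].
Proof.
congr (fine (P _)); apply/seteqP; split => w /=.
  move=> /first_point_eq[_ rn h]; split => // t.
  by rewrite inE => /eqP ->.
by move=> [h1 h2]; apply/first_point_eq; split => //; apply: h2; exact: mem_head.
Qed.

Lemma first_law0 : first_law 0 = 0.
Proof.
rewrite /first_law (_ : [set w | _] = set0) ?measure0//.
by apply/seteqP; split => // w /= /first_point_eq[].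
Qed.

Lemma avoids_nil n : q n [::] = tail first_law n.
Proof.
elim: n => [|n IH]; first by rewrite avoids0//= /tail psum0 first_law0 subr0.
by rewrite avoidsS IH /tail psumS first_lawS opprD addrA.
Qed.

(** The decomposition of [u n.+1] by the first point of [rho] is reached by ruling
    out the points [1, 2, ...] one after the other. *)
Lemma first_law_renewal_pair : renewal_pair first_law u.
Proof.
have q0 l s : 0 <= q l s by rewrite -lee_fin -avoidsE.
split.
- by case=> [|n]; rewrite ?first_law0// first_lawS.
- exact: first_law0.
- by move=> n; rewrite -subr_ge0 -/(tail _ _) -avoids_nil.
apply/funext => -[|n].
  by rewrite /= /conv big_ord1 first_law0 mul0r addr0 /delta0 eqxx.
rewrite /= /delta0 /= add0r.
have h l : (l <= n)%N -> u n.+1 = q l [:: n.+1] + \sum_(0 <= k < l.+1) first_law k * u (n.+1 - k)%N.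
  elim: l => [_|l IH ln].
    by rewrite avoids0//= subn0 mulr1 big_nat1 first_law0 mul0r addr0.
  rewrite IH ?(ltnW ln)// avoidsS [in RHS]big_nat_recr//= first_lawS.
  rewrite (@avoids_regenerate l l.+1 [:: n.+1])//=; last by rewrite (leqW ln).
  by ring.
rewrite (h n)// convE [in RHS]big_nat_recr//= subnn u_at0 mulr1 first_lawS.
by rewrite addrC.
Qed.

(** Transience bounds [tail first_law] from below by the probability [p] that [rho]
    has no point but 0, and [psum u n * tail first_law n <= 1]. *)
Lemma transient_total_mass : transient P rho -> exists U, total_mass u U.
Proof.
move=> tr; pose hit := [set w | (first_point R (rho w) < +oo)%E].
have hitE : hit = \bigcup_(n in [set n | (1 <= n)%N]) [set w | rho w n].
  apply/seteqP; split => w /=; first by move=> /first_point_fin[n n1 rn]; exists n.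
  by move=> [n n1 rn]; apply/first_point_fin; exists n.
have mhit : measurable hit by rewrite hitE; apply: bigcup_measurable => n _.
have mC : measurable (~` hit) by exact: measurableC.
pose p := fine (P (~` hit)).
have pE : P (~` hit) = p%:E by rewrite /p fineK ?fin_num_measure.
have p0 : 0 < p.
  have p_ge0 : 0 <= p by rewrite -lee_fin -pE.
  rewrite lt_def p_ge0 andbT; apply/eqP => p00; apply: tr; rewrite /recurrent -/hit.
  have := probability_setC P mC; rewrite setCK pE p00 => ->.
  by rewrite sube0.
apply: (@total_mass_exists _ _ p^-1) => n.
have ptail : p <= tail first_law n.
  rewrite -avoids_nil -lee_fin -pE -avoidsE.
  apply: le_measure; rewrite ?inE//; first exact: measurable_avoids.
  move=> w nh; split => // i /andP[i1 _] ri; apply: nh.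
  by apply/first_point_fin; exists i.
rewrite -[leRHS]mul1r ler_pdivlMr//.
apply: le_trans (psum_tail_le1 first_law_renewal_pair n).
rewrite ler_wpM2l//; apply: psum_ge0; exact: ren_ge0 first_law_renewal_pair.
Qed.

(** The cardinality is the sum of the indicators of the points (Tonelli). *)
Lemma expected_card_total_mass U : total_mass u U -> expected_card P rho = U%:E.
Proof.
move=> [uU Uu].
have u_ge0 := ren_ge0 first_law_renewal_pair.
rewrite /expected_card.
under eq_integral do rewrite counting_dirac.
have diracE n w : (\d_n (rho w) = (\1_[set w | rho w n] w)%:E :> \bar R)%E.
  rewrite diracE indicE.
  have -> // : (n \in rho w) = (w \in [set w0 | rho w0 n]).
  by apply/idP/idP; rewrite !inE.
rewrite (_ : (fun w => _) = (fun w => \sum_(n <oo) (\1_[set w | rho w n] w)%:E)%E); last first.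
  by apply/funext => w; apply: eq_eseriesr => n _; rewrite diracE.
rewrite integral_nneseries//; first last.
  by move=> n; apply/measurable_EFinP; exact: measurable_indic.
rewrite (eq_eseriesr (g := fun n => (u n)%:E)); last first.
  move=> n _; rewrite integral_indic// setIT.
  have := @law [:: n] isT; rewrite /= subn0 mulr1 => <-; congr (P _).
  apply/seteqP; split => w /= h; last exact/h/mem_head.
  by move=> t; rewrite inE => /eqP ->.
apply/cvg_lim => //.
rewrite (_ : (fun n => _) = EFin \o (fun n => \sum_(0 <= i < n) u i)); last first.
  by apply/funext => n /=; rewrite sumEFin.
apply: cvg_EFin; first exact: nearW.
apply/cvgrPdist_le => eps eps0; have [M HM] := Uu _ eps0.
exists M.+1 => // -[|n] //= Mn; rewrite -psumE.
have := uU n; have := psum_le u_ge0 (Mn : (M <= n)%N); rewrite ler_norml => h1 h2.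
by apply/andP; split; lra.
Qed.

End Regenerative.

(** * The intersection of two renewal processes *)

Section RenewalEvents.
Context d (T : measurableType d) (R : realType) (P : probability T R).
Variable tau : nat -> {RV P >-> \bar R}.

(** The independence of two processes is about the events of the sigma-algebras
    they generate, to which passing through given sites belongs. *)
Lemma sigma_of_renewal_set (s : seq nat) :
  sigma_of tau [set w | forall t, t \in s -> renewal_set tau w t].
Proof.
rewrite (_ : [set w | _] = \bigcap_(t in [set` s]) \bigcup_k
    [set w | tau k w = (t%:R)%:E]); last first.
  by apply/seteqP; split => w h t /h[k]; exists k.
set G := \bigcup_k preimage_set_system setT (tau k) measurable.
apply: (@fin_bigcap_measurable _ (g_sigma_algebraType G)); first exact: finite_seq.
move=> t _; apply: (@bigcupT_measurable _ (g_sigma_algebraType G)) => k.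
apply: sub_sigma_algebra; exists k => //; exists [set (t%:R)%:E].
  exact: emeasurable_set1.
by rewrite setTI.
Qed.

Lemma measurable_renewal_set n : measurable [set w | renewal_set tau w n].
Proof.
rewrite (_ : [set w | _] = \bigcup_k [set w | tau k w = (n%:R)%:E]); last first.
  by apply/seteqP; split => w [k]; exists k.
apply: bigcupT_measurable => k; rewrite -[X in measurable X]setTI.
have tau_meas : measurable_fun setT (tau k) by exact: measurable_funPT.
exact: (tau_meas measurableT _ (emeasurable_set1 _)).
Qed.

Lemma probability_renewal_set (a : nat -> R) n :
  (forall s, path leq 0 s ->
     P [set w | forall t, t \in s -> renewal_set tau w t] = (gaps a 0 s)%:E) ->
  P [set w | renewal_set tau w n] = (a n)%:E.
Proof.
move=> /(_ [:: n] isT); rewrite /= subn0 mulr1 => <-; congr (P _).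
apply/seteqP; split => w /= h; last exact/h/mem_head.
by move=> t; rewrite inE => /eqP ->.
Qed.

End RenewalEvents.

Theorem theorem1p2 (R : realType) (d : measure_display) (T : measurableType d)
    (P : probability T R) (tau sigma : nat -> {RV P >-> \bar R})
    (alpha alpha' : R) (phi phi' : nat -> R)
    (tau_renewal : renewal_process tau)
    (sigma_renewal : renewal_process sigma)
    (tau_sigma_indep : independent_processes tau sigma)
    (alpha_ge0 : 0 <= alpha) (alpha'_ge0 : 0 <= alpha')
    (phi_sv : slowly_varying phi) (phi'_sv : slowly_varying phi')
    (tau1_law : forall n : nat, (1 <= n)%N ->
       P [set w | tau 1%N w = (n%:R)%:E] =
       (phi n * n%:R `^ (- (1 + alpha)))%:E)
    (sigma1_law : forall n : nat, (1 <= n)%N ->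
       P [set w | sigma 1%N w = (n%:R)%:E] =
       (phi' n * n%:R `^ (- (1 + alpha')))%:E)
    (rho_transient : transient P (renewal_cap tau sigma)) :
  let rho := renewal_cap tau sigma in
  asymp_equiv
    (fun n => fine (P [set w | first_point R (rho w) = (n%:R)%:E]))
    (fun n => 1 / fine (expected_card P rho) ^+ 2 *
              fine (P [set w | renewal_set tau w n]) *
              fine (P [set w | renewal_set sigma w n])).
Proof.
have [a fa a_law] := renewal_process_law tau_renewal.
have [b fb b_law] := renewal_process_law sigma_renewal.
have a_decay : regular_decay a.
  by apply: (renewal_regular_decay fa alpha_ge0 phi_sv) => n /tau1_law ->.
have b_decay : regular_decay b.
  by apply: (renewal_regular_decay fb alpha'_ge0 phi'_sv) => n /sigma1_law ->.
have m_rho n : measurable [set w | renewal_cap tau sigma w n].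
  by apply: measurableI; exact: measurable_renewal_set.
have rho_law s : path leq 0 s ->
    P [set w | forall t, t \in s -> renewal_cap tau sigma w t] = (gaps (a \* b) 0 s)%:E.
  move=> s_sorted; rewrite gapsM EFinM -a_law// -b_law//.
  rewrite -tau_sigma_indep; do ?exact: sigma_of_renewal_set.
  congr (P _); apply/seteqP; split => w; first by move=> h; split => t /h[].
  by move=> [h1 h2] t ts; split; [exact: h1 | exact: h2].
have u_at0 : (a \* b) 0%N = 1 by rewrite /= (ren0 fa) (ren0 fb) mulr1.
have gu := first_law_renewal_pair m_rho u_at0 rho_law.
have [U uU] := transient_total_mass m_rho u_at0 rho_law rho_transient.
have u_decay := regular_decayM (ren_ge0 fa) (ren_ge0 fb) a_decay b_decay.
have := first_renewal_ratio gu u_decay uU.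
rewrite /asymp_equiv (expected_card_total_mass m_rho u_at0 rho_law uU) /=.
under [in X in _ -> X]eq_fun => n.
  rewrite (probability_renewal_set n a_law) (probability_renewal_set n b_law) /= -mulrA.
  over.
exact.
Qed.
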